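(* Let $R$ be a principal ideal domain. Then, up to isomorphism of tangent structures, there are precisely two representable tangent structures on the category $\mathsf{Aff}_R=\mathsf{cAlg}_R^{\mathrm{op}}$ of affine schemes over $R$: the trivial tangent structure and the tangent structure $\mathbb T^\Omega$, whose tangent bundle functor sends a commutative $R$-algebra $A$ to $\mathrm{Sym}_A\Omega_{A/R}$, the symmetric $A$-algebra on the $A$-module of Kähler differentials of $A$ over $R$.
   Context: $\mathsf{cAlg}_R$ is the category of commutative unital $R$-algebras. Tangent structure. A tangent structure $\mathbb T$ on a category $\mathbb X$ consists of an endofunctor $\mathrm T\colon\mathbb X\to\mathbb X$ (tangent bundle functor) and natural transformations $p\colon\mathrm T\Rightarrow\mathrm{Id}$, $z\colon\mathrm{Id}\Rightarrow\mathrm T$, $s\colon\mathrm T_2\Rightarrow\mathrm T$, $l\colon\mathrm T\Rightarrow\mathrm T^2$, $c\colon\mathrm T^2\Rightarrow\mathrm T^2$, where for each object $A$ and $n\ge1$ the $n$-fold pullback $\mathrm T_nA$ of $p_A$ along itself (projections $\pi_k$) exists and is preserved by all $\mathrm T^m$, such that for each object $A$: (i) $(p_A,z_A,s_A)$ is a commutative monoid in the slice category $\mathbb X/A$ (unit $z_A$, multiplication $s_A$); (ii) $\mathrm T p\circ l=z\circ p$, $l\circ z=\mathrm Tz\circ z$, $\mathrm Ts\circ(l\times_z l)=l\circ s$, where $l\times_z l\colon \mathrm T_2\to\mathrm T\mathrm T_2$ is the unique map with $\mathrm T\pi_k\circ(l\times_z l)=l\circ\pi_k$; (iii) $\mathrm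 Tp_A\circ c_A=p_{\mathrm TA}$, $c_A\circ z_{\mathrm TA}=\mathrm Tz_A$, $\mathrm Ts_A\circ(c\times c)=c_A\circ s_{\mathrm TA}$, where $c\times c\colon\mathrm T_2\mathrm TA\to\mathrm T\mathrm T_2A$ is the unique map with $\mathrm T\pi_k\circ(c\times c)=c_A\circ\pi_k$; (iv) $\mathrm Tl_A\circ l_A=l_{\mathrm TA}\circ l_A$, $c_A\circ c_A=\mathrm{id}$, $\mathrm Tc_A\circ c_{\mathrm TA}\circ\mathrm Tc_A=c_{\mathrm TA}\circ\mathrm Tc_A\circ c_{\mathrm TA}$; (v) $c_A\circ l_A=l_A$, $c_{\mathrm TA}\circ\mathrm Tc_A\circ l_{\mathrm TA}=\mathrm Tl_A\circ c_A$; (vi) the square formed by $\mathrm Ts_A\circ u\colon\mathrm T_2A\to\mathrm T^2A$, $\mathrm Tp_A\colon\mathrm T^2A\to\mathrm TA$, $p_A\circ\pi_1\colon\mathrm T_2A\to A$ and $z_A\colon A\to\mathrm TA$ is a pullback, where $u\colon\mathrm T_2A\to\mathrm T\mathrm T_2A$ is the unique map with $\mathrm T\pi_1\circ u=l_A\circ\pi_1$ and $\mathrm T\pi_2\circ u=z_{\mathrm TA}\circ\pi_2$. An isomorphism of tangent structures on $\mathbb X$ is a natural isomorphism of tangent bundle functors commuting with $p,z,s,l,c$. Representability. In a category with finite products, an object $E$ is exponentiable if $E\times -$ has a right adjoint $(-)^E$. A tangent structure on a category with finite products is representable if for every integer $n\geq1$ the functor $\mathrm T_n$ is isomorphic to $(-)^{D_n}$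 for some exponentiable object $D_n$. (In $\mathsf{Aff}_R$ binary products are $\otimes_R$.) The trivial tangent structure has $\mathrm T=\mathrm{Id}$ and all structure transformations identities. The tangent structure $\mathbb T^\Omega$ on $\mathsf{Aff}_R$ is the one represented by the ring of dual numbers $R[\varepsilon]=R[x]/(x^2)$: on $\mathsf{cAlg}_R$, $A\mapsto\mathrm{Sym}_A\Omega_{A/R}$ is left adjoint to $R[\varepsilon]\otimes_R-$, and the structure transformations of $\mathbb T^\Omega$ are the mates of the transformations obtained by tensoring with the following algebra maps: $p\colon R[\varepsilon]\to R$, $\varepsilon\mapsto0$; $z\colon R\to R[\varepsilon]$ the unit map; $s\colon R[\varepsilon_1,\varepsilon_2]=R[x_1,x_2]/(x_ix_j)_{i,j}\to R[\varepsilon]$, $\varepsilon_1,\varepsilon_2\mapsto\varepsilon$; $l\colon R[\varepsilon]\to R[\varepsilon]\otimes_R R[\varepsilon]$, $\varepsilon\mapsto\varepsilon\otimes\varepsilon$; and $c$ the swap on $R[\varepsilon]\otimes_R R[\varepsilon]$. *)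

(* Defs.v *)
(* Mathematical Components, with the classical axioms of boolp.  Arrows of a
   category are compared with Leibniz equality; algebras, modules and tensor
   products are quotients of inductive types of expressions. *)
From HB Require Import structures.
From mathcomp Require Import all_boot all_algebra.
From mathcomp Require Import generic_quotient boolp.

Set Implicit Arguments.
Unset Strict Implicit.
Unset Printing Implicit Defensive.

Import GRing.Theory.

Declare Scope cat_scope.
Delimit Scope cat_scope with cat.
Local Open Scope cat_scope.

Record category := Category {
  ob :> Type;
  hom : ob -> ob -> Type;
  idm : forall A, hom A A;
  comp : forall A B C, hom B C -> hom A B -> hom A C;
  comp_idl : forall A B (f : hom A B), comp (idm B) f = f;
  comp_idr : forall A B (f : hom A B), comp f (idm A) = f;
  compA : forall A B C D (h : hom C D) (g : hom B C) (f : hom A B),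
    comp h (comp g f) = comp (comp h g) f }.

Arguments hom {c}.
Arguments idm {c}.
Arguments comp {c A B C}.
Notation "g ∘ f" := (comp g f) (at level 40, left associativity) : cat_scope.

Definition op_cat (C : category) : category :=
  @Category C (fun A B => @hom C B A) (@idm C) (fun A B D g f => f ∘ g)
    (fun A B f => comp_idr f) (fun A B f => comp_idl f)
    (fun A B D E h g f => esym (compA f g h)).

Record functor (C D : category) := Functor {
  fob :> C -> D;
  fmap : forall A B, hom A B -> hom (fob A) (fob B);
  fmap_id : forall A, fmap (idm A) = idm (fob A);
  fmap_comp : forall A B E (g : hom B E) (f : hom A B),
    fmap (g ∘ f) = fmap g ∘ fmap f }.

Arguments fmap {C D} _ {A B}.

Definition op_functor C D (F : functor C D) : functor (op_cat C) (op_cat D) :=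
  @Functor (op_cat C) (op_cat D) F (fun A B f => @fmap C D F B A f)
    (fun A => fmap_id F A) (fun A B E g f => fmap_comp F f g).

Definition idF (C : category) : functor C C :=
  @Functor C C id (fun A B f => f) (fun A => erefl) (fun A B E g f => erefl).

Lemma compF_id C D E (G : functor D E) (F : functor C D) A :
  fmap G (fmap F (idm A)) = idm (G (F A)).
Proof. by rewrite !fmap_id. Qed.

Lemma compF_comp C D E (G : functor D E) (F : functor C D) A B X
    (g : hom B X) (f : hom A B) :
  fmap G (fmap F (g ∘ f)) = fmap G (fmap F g) ∘ fmap G (fmap F f).
Proof. by rewrite !fmap_comp. Qed.

Definition compF C D E (G : functor D E) (F : functor C D) : functor C E :=
  @Functor C E (fun A => G (F A)) (fun A B f => fmap G (fmap F f))
    (@compF_id C D E G F) (@compF_comp C D E G F).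

Fixpoint iterF (C : category) (m : nat) (F : functor C C) : functor C C :=
  if m is k.+1 then compF F (iterF k F) else idF C.

Record nat_trans C D (F G : functor C D) := NatTrans {
  nt :> forall A, hom (F A) (G A);
  naturality : forall A B (f : hom A B), fmap G f ∘ nt A = nt B ∘ fmap F f }.

Definition is_iso (C : category) (A B : C) (f : hom A B) :=
  exists g : hom B A, g ∘ f = idm A /\ f ∘ g = idm B.

Definition isomorphic_functors C D (F G : functor C D) :=
  exists alpha : nat_trans F G, forall A, is_iso (alpha A).

Record adjunction C D (F : functor C D) (G : functor D C) := Adjunction {
  adj_unit : nat_trans (idF C) (compF G F);
  adj_counit : nat_trans (compF F G) (idF D);
  triangle_l : forall A, adj_counit (F A) ∘ fmap F (adj_unit A) = idm (F A);
  triangle_r : forall B, fmap G (adj_counit B) ∘ adj_unit (G B) = idm (G B) }.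

Definition id_adjunction C : adjunction (idF C) (idF C) :=
  let e A B (f : @hom C A B) := etrans (comp_idr f) (esym (comp_idl f)) in
  @Adjunction C C (idF C) (idF C)
    (@NatTrans C C (idF C) (compF (idF C) (idF C)) (fun A => idm A) e)
    (@NatTrans C C (compF (idF C) (idF C)) (idF C) (fun A => idm A) e)
    (fun A => comp_idl (idm A)) (fun A => comp_idl (idm A)).

Section CompAdjunction.
Variables (C D E : category) (F : functor C D) (G : functor D C).
Variables (F' : functor D E) (G' : functor E D).
Variables (a : adjunction F G) (a' : adjunction F' G').

Fact comp_unit_natural A B (f : hom A B) :
  fmap (compF (compF G G') (compF F' F)) f
    ∘ (fmap G (adj_unit a' (F A)) ∘ adj_unit a A)
  = (fmap G (adj_unit a' (F B)) ∘ adj_unit a B) ∘ fmap (idF C) f.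
Proof.
have h1 := naturality (adj_unit a) f.
have h2 := naturality (adj_unit a') (fmap F f).
rewrite /= in h1 h2 *.
by rewrite compA -fmap_comp h2 fmap_comp -!compA h1.
Qed.

Fact comp_counit_natural A B (f : hom A B) :
  fmap (idF E) f ∘ (adj_counit a' A ∘ fmap F' (adj_counit a (G' A)))
  = (adj_counit a' B ∘ fmap F' (adj_counit a (G' B)))
      ∘ fmap (compF (compF F' F) (compF G G')) f.
Proof.
have h1 := naturality (adj_counit a') f.
have h2 := naturality (adj_counit a) (fmap G' f).
rewrite /= in h1 h2 *.
by rewrite -compA -fmap_comp -h2 fmap_comp !compA h1.
Qed.

Fact comp_triangle_l A :
  (adj_counit a' (F' (F A)) ∘ fmap F' (adj_counit a (G' (F' (F A)))))
    ∘ fmap F' (fmap F (fmap G (adj_unit a' (F A)) ∘ adj_unit a A))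
  = idm (F' (F A)).
Proof.
have h := naturality (adj_counit a) (adj_unit a' (F A)); rewrite /= in h.
rewrite -compA -fmap_comp (fmap_comp F) compA -h -compA triangle_l comp_idr.
exact: triangle_l.
Qed.

Fact comp_triangle_r B :
  fmap G (fmap G' (adj_counit a' B ∘ fmap F' (adj_counit a (G' B))))
    ∘ (fmap G (adj_unit a' (F (G (G' B)))) ∘ adj_unit a (G (G' B)))
  = idm (G (G' B)).
Proof.
have h := naturality (adj_unit a') (adj_counit a (G' B)); rewrite /= in h.
rewrite compA -(fmap_comp G) (fmap_comp G') -compA h compA triangle_r comp_idl.
exact: triangle_r.
Qed.

Definition comp_adjunction : adjunction (compF F' F) (compF G G') :=
  @Adjunction C E (compF F' F) (compF G G')
    (@NatTrans C C (idF C) (compF (compF G G') (compF F' F)) _ comp_unit_natural)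
    (@NatTrans E E (compF (compF F' F) (compF G G')) (idF E) _
       comp_counit_natural)
    comp_triangle_l comp_triangle_r.
End CompAdjunction.

(* The mate G => G' of a transformation tau : F' => F of left adjoints. *)
Definition mate C D (F F' : functor C D) (G G' : functor D C)
    (a : adjunction F G) (a' : adjunction F' G')
    (tau : forall X, hom (F' X) (F X)) (A : D) : hom (G A) (G' A) :=
  fmap G' (adj_counit a A ∘ tau (G A)) ∘ adj_unit a' (G A).

Record finite_products (C : category) := FiniteProducts {
  term : C;
  bang : forall X, hom X term;
  bang_unique : forall X (f : hom X term), f = bang X;
  prd : C -> C -> C;
  pr1 : forall A B, hom (prd A B) A;
  pr2 : forall A B, hom (prd A B) B;
  pairing : forall X A B, hom X A -> hom X B -> hom X (prd A B);
  pair1 : forall X A B (f : hom X A) (g : hom X B), pr1 A B ∘ pairing f g = f;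
  pair2 : forall X A B (f : hom X A) (g : hom X B), pr2 A B ∘ pairing f g = g;
  pair_unique : forall X A B (h : hom X (prd A B)),
    h = pairing (pr1 A B ∘ h) (pr2 A B ∘ h) }.

Arguments bang {C} f X : rename.
Arguments prd {C} f A B : rename.
Arguments pr1 {C} f A B : rename.
Arguments pr2 {C} f A B : rename.
Arguments pairing {C} f {X A B} : rename.

Section Products.
Variables (C : category) (P : finite_products C).

Definition prod_map A A' B B' (f : hom A A') (g : hom B B') :
  hom (prd P A B) (prd P A' B') := pairing P (f ∘ pr1 P A B) (g ∘ pr2 P A B).

Definition unitor_inv A : hom A (prd P (term P) A) := pairing P (bang P A) (idm A).

Definition associator A B E : hom (prd P (prd P A B) E) (prd P A (prd P B E)) :=
  pairing P (pr1 P A B ∘ pr1 P _ E)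
    (pairing P (pr2 P A B ∘ pr1 P _ E) (pr2 P (prd P A B) E)).

Definition associator_inv A B E :
    hom (prd P A (prd P B E)) (prd P (prd P A B) E) :=
  pairing P (pairing P (pr1 P A _) (pr1 P B E ∘ pr2 P A _)) (pr2 P B E ∘ pr2 P A _).

Lemma pair_ext X A B (f g : hom X (prd P A B)) :
  pr1 P A B ∘ f = pr1 P A B ∘ g -> pr2 P A B ∘ f = pr2 P A B ∘ g -> f = g.
Proof. by move=> e1 e2; rewrite (pair_unique f) e1 e2 -pair_unique. Qed.

Fact prod_map_id E A : prod_map (idm E) (idm A) = idm (prd P E A).
Proof.
by apply: pair_ext; rewrite /prod_map ?pair1 ?pair2 comp_idl comp_idr.
Qed.

Fact prod_map_comp E A B D (g : hom B D) (f : hom A B) :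
  prod_map (idm E) (g ∘ f) = prod_map (idm E) g ∘ prod_map (idm E) f.
Proof.
apply: pair_ext; rewrite /prod_map compA !(pair1, pair2).
  by rewrite -compA pair1 !comp_idl.
by rewrite -[RHS]compA pair2 compA.
Qed.

Definition prod_functor (E : C) : functor C C :=
  @Functor C C (prd P E) (fun A B f => prod_map (idm E) f)
    (prod_map_id E) (@prod_map_comp E).

End Products.

Definition is_pullback (C : category) (P A B D : C) (p1 : hom P A) (p2 : hom P B)
    (f : hom A D) (g : hom B D) :=
  f ∘ p1 = g ∘ p2 /\
  forall (X : C) (q1 : hom X A) (q2 : hom X B), f ∘ q1 = g ∘ q2 ->
    exists! h : hom X P, p1 ∘ h = q1 /\ p2 ∘ h = q2.

(* (P, proj) is the n-fold pullback of p along itself (for n > 0). *)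
Definition is_fiber_power (C : category) (n : nat) (E A : C) (p : hom E A)
    (P : C) (proj : 'I_n -> hom P E) :=
  (forall i j, p ∘ proj i = p ∘ proj j) /\
  forall (X : C) (f : 'I_n -> hom X E), (forall i j, p ∘ f i = p ∘ f j) ->
    exists! h : hom X P, forall i, proj i ∘ h = f i.

Record fiber_power (C : category) (n : nat) (E A : C) (p : hom E A) :=
  FiberPower {
    fp_ob :> C;
    fp_proj : 'I_n -> hom fp_ob E;
    fp_univ : is_fiber_power p fp_proj }.

Arguments fp_proj {C n E A p} f i : rename.

Section FiberPower.
Variables (C : category) (n : nat) (E A : C) (p : hom E A).
Variable P : fiber_power n p.

Definition fp_lift (X : C) (f : 'I_n -> hom X E)
    (e : forall i j, p ∘ f i = p ∘ f j) : hom X P :=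
  sval (cid ((fp_univ P).2 X f e)).

Lemma fp_liftE X (f : 'I_n -> hom X E) (e : forall i j, p ∘ f i = p ∘ f j) i :
  fp_proj P i ∘ fp_lift e = f i.
Proof. by rewrite /fp_lift; case: cid => h [/= + _]; apply. Qed.

Lemma fp_ext X (h h' : hom X P) :
  (forall i, fp_proj P i ∘ h = fp_proj P i ∘ h') -> h = h'.
Proof.
move=> e; have [|k [_ ku]] := (fp_univ P).2 X (fun i => fp_proj P i ∘ h).
  by move=> i j; rewrite !compA ((fp_univ P).1 i j).
by rewrite -(ku h) // -(ku h') // => i; rewrite e.
Qed.

Lemma fp_projE i j : p ∘ fp_proj P i = p ∘ fp_proj P j.
Proof. exact: (fp_univ P).1. Qed.

End FiberPower.

Section FiberPowerFunctor.
Variables (C : category) (T : functor C C) (p : nat_trans T (idF C)) (n : nat).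
Variable P : forall A, fiber_power n (p A).

Fact fpF_compat A B (f : hom A B) i j :
  p B ∘ (fmap T f ∘ fp_proj (P A) i) = p B ∘ (fmap T f ∘ fp_proj (P A) j).
Proof. by rewrite !compA -(naturality p f) /= -!compA (fp_projE _ i j). Qed.

Definition fpF_map A B (f : hom A B) : hom (P A) (P B) :=
  fp_lift (P B) (fpF_compat f).

Fact fpF_id A : fpF_map (idm A) = idm (P A : C).
Proof. by apply: fp_ext => i; rewrite fp_liftE fmap_id comp_idl comp_idr. Qed.

Fact fpF_comp A B D (g : hom B D) (f : hom A B) :
  fpF_map (g ∘ f) = fpF_map g ∘ fpF_map f.
Proof.
apply: fp_ext => i.
by rewrite fp_liftE fmap_comp compA fp_liftE -!compA fp_liftE.
Qed.

Definition fiber_powerF : functor C C :=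
  @Functor C C (fun A => P A) fpF_map fpF_id fpF_comp.
End FiberPowerFunctor.

Definition fst2 : 'I_2 := ord0.
Definition snd2 : 'I_2 := ord_max.

(* (p, z, s) is a commutative monoid in the slice category over A, where P2 and
   P3 are the binary and ternary products of p in the slice.  The arrows u, v, w
   asserted to exist are unique by the universal property of P2. *)
Definition is_slice_comm_monoid (C : category) (E A : C) (p : hom E A)
    (P2 : fiber_power 2 p) (P3 : fiber_power 3 p) (z : hom A E)
    (s : hom P2 E) :=
  let is_pair X (h : hom X P2) (f g : hom X E) :=
    fp_proj P2 fst2 ∘ h = f /\ fp_proj P2 snd2 ∘ h = g in
  let q (k : nat) := fp_proj P3 (inord k) in
  [/\ p ∘ z = idm A /\ p ∘ s = p ∘ fp_proj P2 fst2,
      exists2 u : hom E P2, is_pair E u (z ∘ p) (idm E) & s ∘ u = idm E,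
      exists2 u : hom P2 P2,
        is_pair P2 u (fp_proj P2 snd2) (fp_proj P2 fst2) & s ∘ u = s
    & exists u12 u23 v w : hom P3 P2,
      [/\ is_pair P3 u12 (q 0) (q 1) /\ is_pair P3 v (s ∘ u12) (q 2),
          is_pair P3 u23 (q 1) (q 2) /\ is_pair P3 w (q 0) (s ∘ u23)
        & s ∘ v = s ∘ w] ].

Section TangentStructure.
Variables (C : category) (T : functor C C).

(* Tangent structures with tangent bundle functor T.  The n-fold pullbacks T_n A
   (n > 0) are part of the data, so that T_n is a functor; isomorphisms of
   tangent structures do not depend on their choice. *)
Record tangent_on := TangentOn {
  tan_p : nat_trans T (idF C);
  tan_pow : forall n, 0 < n -> forall A, fiber_power n (tan_p A);
  tan_pow_preserved : forall n (n_gt0 : 0 < n) (A : C) (m : nat),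
    is_fiber_power (fmap (iterF m T) (tan_p A))
      (fun k => fmap (iterF m T) (fp_proj (tan_pow n_gt0 A) k));
  tan_z : nat_trans (idF C) T;
  tan_s : nat_trans (fiber_powerF (@tan_pow 2 isT)) T;
  tan_l : nat_trans T (compF T T);
  tan_c : nat_trans (compF T T) (compF T T);
  T2 := fun A : C => tan_pow (isT : 0 < 2) A;
  pi1 := fun A : C => fp_proj (T2 A) fst2;
  pi2 := fun A : C => fp_proj (T2 A) snd2;
  tan_monoid : forall A, is_slice_comm_monoid
    (P2 := T2 A) (tan_pow (isT : 0 < 3) A) (tan_z A) (tan_s A);
  tan_pl : forall A, fmap T (tan_p A) ∘ tan_l A = tan_z A ∘ tan_p A;
  tan_lz : forall A, tan_l A ∘ tan_z A = fmap T (tan_z A) ∘ tan_z A;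
  tan_ls : forall A, exists2 ll : hom (T2 A) (T (T2 A)),
    (forall k, fmap T (fp_proj (T2 A) k) ∘ ll = tan_l A ∘ fp_proj (T2 A) k)
    & fmap T (tan_s A) ∘ ll = tan_l A ∘ tan_s A;
  tan_pc : forall A, fmap T (tan_p A) ∘ tan_c A = tan_p (T A);
  tan_cz : forall A, tan_c A ∘ tan_z (T A) = fmap T (tan_z A);
  tan_cs : forall A, exists2 cc : hom (T2 (T A)) (T (T2 A)),
    (forall k, fmap T (fp_proj (T2 A) k) ∘ cc = tan_c A ∘ fp_proj (T2 (T A)) k)
    & fmap T (tan_s A) ∘ cc = tan_c A ∘ tan_s (T A);
  tan_ll : forall A, fmap T (tan_l A) ∘ tan_l A = tan_l (T A) ∘ tan_l A;
  tan_cc : forall A, tan_c A ∘ tan_c A = idm (T (T A));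
  tan_ccc : forall A,
    fmap T (tan_c A) ∘ tan_c (T A) ∘ fmap T (tan_c A)
    = tan_c (T A) ∘ fmap T (tan_c A) ∘ tan_c (T A);
  tan_cl : forall A, tan_c A ∘ tan_l A = tan_l A;
  tan_ccl : forall A,
    tan_c (T A) ∘ fmap T (tan_c A) ∘ tan_l (T A) = fmap T (tan_l A) ∘ tan_c A;
  tan_universal : forall A, exists2 u : hom (T2 A) (T (T2 A)),
    fmap T (pi1 A) ∘ u = tan_l A ∘ pi1 A
      /\ fmap T (pi2 A) ∘ u = tan_z (T A) ∘ pi2 A
    & is_pullback (fmap T (tan_s A) ∘ u) (tan_p A ∘ pi1 A)
        (fmap T (tan_p A)) (tan_z A) }.

End TangentStructure.

Arguments tan_pow {C T} _ {n}.

Record tangent_structure (C : category) := TangentStructure {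
  tan_T : functor C C;
  tan_on :> tangent_on tan_T }.

Definition tan_Tn C T (t : @tangent_on C T) n (n_gt0 : 0 < n) : functor C C :=
  fiber_powerF (tan_pow t n_gt0).

(* In the last three conditions (alpha x alpha) : T_2 A -> T'_2 A and
   alpha_{T' A} o T alpha_A : T T A -> T' T' A are the induced maps. *)
Definition tangent_iso C (t t' : tangent_structure C) :=
  let T := tan_T t in let T' := tan_T t' in
  exists alpha : nat_trans T T',
    let alpha2 A : hom (T (T A)) (T' (T' A)) :=
      alpha (T' A) ∘ fmap T (alpha A) in
    (forall A, is_iso (alpha A)) /\
    forall A,
    [/\ tan_p t' A ∘ alpha A = tan_p t A,
        alpha A ∘ tan_z t A = tan_z t' A,
        exists2 aa : hom (T2 t A) (T2 t' A),
          (forall k, fp_proj (T2 t' A) k ∘ aa = alpha A ∘ fp_proj (T2 t A) k)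
          & tan_s t' A ∘ aa = alpha A ∘ tan_s t A,
        alpha2 A ∘ tan_l t A = tan_l t' A ∘ alpha A
      & alpha2 A ∘ tan_c t A = tan_c t' A ∘ alpha2 A].

Definition representable C (P : finite_products C) (t : tangent_structure C) :=
  forall n (n_gt0 : 0 < n), exists (D : C) (G : functor C C),
    inhabited (adjunction (prod_functor P D) G)
    /\ isomorphic_functors (tan_Tn t n_gt0) G.

Section Trivial.
Variable C : category.

Fact id_natural A B (f : @hom C A B) : f ∘ idm A = idm B ∘ f.
Proof. by rewrite comp_idl comp_idr. Qed.

Definition id_idF : nat_trans (idF C) (idF C) :=
  @NatTrans C C (idF C) (idF C) (fun A => idm A) id_natural.

Fact triv_fp n (n_gt0 : 0 < n) (F : functor C C) (A : C) :
  is_fiber_power (fmap F (idm A)) (fun k : 'I_n => fmap F (idm A)).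
Proof.
rewrite fmap_id; split=> // X f e; exists (f (Ordinal n_gt0)); split.
  by move=> i; rewrite comp_idl -[LHS]comp_idl (e _ i) comp_idl.
by move=> h /(_ (Ordinal n_gt0)); rewrite comp_idl => ->.
Qed.

Definition triv_pow n (n_gt0 : 0 < n) (A : C) : fiber_power n (id_idF A) :=
  @FiberPower C n A A (idm A) A (fun=> idm A) (triv_fp n_gt0 (idF C) A).

Fact triv_s_natural A B (f : hom A B) :
  fmap (idF C) f ∘ idm A
  = idm B ∘ fmap (fiber_powerF (@triv_pow 2 isT)) f.
Proof.
by rewrite [RHS](fp_liftE (triv_pow (isT : 0 < 2) B) (fpF_compat _ f) fst2).
Qed.

Definition triv_s : nat_trans (fiber_powerF (@triv_pow 2 isT)) (idF C) :=
  @NatTrans C C (fiber_powerF (@triv_pow 2 isT)) (idF C)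
    (fun A => idm A) triv_s_natural.

Definition triv_l : nat_trans (idF C) (compF (idF C) (idF C)) :=
  @NatTrans C C (idF C) (compF (idF C) (idF C)) (fun A => idm A) id_natural.

Definition triv_c : nat_trans (compF (idF C) (idF C)) (compF (idF C) (idF C)) :=
  @NatTrans C C (compF (idF C) (idF C)) (compF (idF C) (idF C))
    (fun A => idm A) id_natural.

Definition trivial_on : tangent_on (idF C).
Proof.
refine (@TangentOn C (idF C) id_idF triv_pow
  (fun n n_gt0 A m => triv_fp n_gt0 (iterF m (idF C)) A)
  id_idF triv_s triv_l triv_c _ _ _ _ _ _ _ _ _ _ _ _ _); move=> A /=;
  rewrite ?comp_idl //.
- split=> /=; first by rewrite !comp_idl.
  + by exists (idm A); rewrite /= ?comp_idl.
  + by exists (idm A); rewrite /= ?comp_idl.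
  + by exists (idm A), (idm A), (idm A), (idm A); rewrite /= !comp_idl.
- by exists (idm A) => [k|]; rewrite /= ?comp_idl.
- by exists (idm A) => [k|]; rewrite /= ?comp_idl.
- exists (idm A); rewrite /= ?comp_idl //.
  split=> // X q1 q2; rewrite !comp_idl => <-; exists q1.
  by split=> [|h []]; rewrite !comp_idl.
Defined.

Definition trivial_tangent : tangent_structure C := TangentStructure trivial_on.
End Trivial.

Local Open Scope ring_scope.
Local Open Scope quotient_scope.

Section PresentedRing.
Variables (K : comPzRingType) (G : Type).

Inductive aexpr :=
  | ACst of K | AGen of G | AAdd of aexpr & aexpr | AOpp of aexpr
  | AMul of aexpr & aexpr.

Variable rel : aexpr -> aexpr -> Prop.

(* The congruence of commutative K-algebras generated by rel. *)
Inductive acongr : aexpr -> aexpr -> Prop :=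
  | acongr_rel x y : rel x y -> acongr x y
  | acongr_refl x : acongr x x
  | acongr_sym x y : acongr x y -> acongr y x
  | acongr_trans y x z : acongr x y -> acongr y z -> acongr x z
  | acongr_add x x' y y' :
      acongr x x' -> acongr y y' -> acongr (AAdd x y) (AAdd x' y')
  | acongr_opp x x' : acongr x x' -> acongr (AOpp x) (AOpp x')
  | acongr_mul x x' y y' :
      acongr x x' -> acongr y y' -> acongr (AMul x y) (AMul x' y')
  | acongr_addA x y z : acongr (AAdd x (AAdd y z)) (AAdd (AAdd x y) z)
  | acongr_addC x y : acongr (AAdd x y) (AAdd y x)
  | acongr_add0 x : acongr (AAdd (ACst 0) x) x
  | acongr_addN x : acongr (AAdd (AOpp x) x) (ACst 0)
  | acongr_mulA x y z : acongr (AMul x (AMul y z)) (AMul (AMul x y) z)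
  | acongr_mulC x y : acongr (AMul x y) (AMul y x)
  | acongr_mul1 x : acongr (AMul (ACst 1) x) x
  | acongr_mulD x y z :
      acongr (AMul (AAdd x y) z) (AAdd (AMul x z) (AMul y z))
  | acongr_cstD a b : acongr (ACst (a + b)) (AAdd (ACst a) (ACst b))
  | acongr_cstM a b : acongr (ACst (a * b)) (AMul (ACst a) (ACst b)).

HB.instance Definition _ := gen_eqMixin aexpr.
HB.instance Definition _ := gen_choiceMixin aexpr.

Definition aequiv (x y : aexpr) : bool := `[< acongr x y >].

Fact aequiv_refl : reflexive aequiv.
Proof. by move=> x; apply/asboolP; apply: acongr_refl. Qed.
Fact aequiv_sym : symmetric aequiv.
Proof. by move=> x y; apply/asbool_equiv_eq; split; apply: acongr_sym. Qed.
Fact aequiv_trans : transitive aequiv.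
Proof.
by move=> y x z /asboolP h /asboolP h'; apply/asboolP; apply: acongr_trans h h'.
Qed.
Canonical aequiv_rel := EquivRel aequiv aequiv_refl aequiv_sym aequiv_trans.

Definition pres := {eq_quot aequiv_rel}.
HB.instance Definition _ := Choice.on pres.

Definition pres_class (x : aexpr) : pres := \pi_pres x.

Lemma pres_eqP x y : pres_class x = pres_class y <-> acongr x y.
Proof. by split=> [/eqmodP/asboolP|h] //; apply/eqmodP/asboolP. Qed.

Lemma pres_ind (P : pres -> Prop) :
  (forall x, P (pres_class x)) -> forall x, P x.
Proof. by move=> h x; rewrite -[x]reprK; apply: h. Qed.

Lemma repr_pres x : acongr (repr (pres_class x)) x.
Proof. by apply/pres_eqP; rewrite /pres_class reprK. Qed.

Definition pres_add (x y : pres) := pres_class (AAdd (repr x) (repr y)).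
Definition pres_opp (x : pres) := pres_class (AOpp (repr x)).
Definition pres_mul (x y : pres) := pres_class (AMul (repr x) (repr y)).

Lemma pres_addE x y :
  pres_add (pres_class x) (pres_class y) = pres_class (AAdd x y).
Proof. by apply/pres_eqP/acongr_add; apply: repr_pres. Qed.
Lemma pres_oppE x : pres_opp (pres_class x) = pres_class (AOpp x).
Proof. by apply/pres_eqP/acongr_opp; apply: repr_pres. Qed.
Lemma pres_mulE x y :
  pres_mul (pres_class x) (pres_class y) = pres_class (AMul x y).
Proof. by apply/pres_eqP/acongr_mul; apply: repr_pres. Qed.

Fact pres_addA : associative pres_add.
Proof.
by elim/pres_ind=> x; elim/pres_ind=> y; elim/pres_ind=> z;
  rewrite !pres_addE; apply/pres_eqP; constructor.
Qed.
Fact pres_addC : commutative pres_add.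
Proof.
by elim/pres_ind=> x; elim/pres_ind=> y; rewrite !pres_addE;
  apply/pres_eqP; apply: acongr_addC.
Qed.
Fact pres_add0 : left_id (pres_class (ACst 0)) pres_add.
Proof.
by elim/pres_ind=> x; rewrite pres_addE; apply/pres_eqP; apply: acongr_add0.
Qed.
Fact pres_addN : left_inverse (pres_class (ACst 0)) pres_opp pres_add.
Proof.
by elim/pres_ind=> x; rewrite pres_oppE pres_addE; apply/pres_eqP;
  apply: acongr_addN.
Qed.
HB.instance Definition _ :=
  GRing.isZmodule.Build pres pres_addA pres_addC pres_add0 pres_addN.

Fact pres_mulA : associative pres_mul.
Proof.
by elim/pres_ind=> x; elim/pres_ind=> y; elim/pres_ind=> z;
  rewrite !pres_mulE; apply/pres_eqP; apply: acongr_mulA.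
Qed.
Fact pres_mulC : commutative pres_mul.
Proof.
by elim/pres_ind=> x; elim/pres_ind=> y; rewrite !pres_mulE;
  apply/pres_eqP; apply: acongr_mulC.
Qed.
Fact pres_mul1 : left_id (pres_class (ACst 1)) pres_mul.
Proof.
by elim/pres_ind=> x; rewrite pres_mulE; apply/pres_eqP; apply: acongr_mul1.
Qed.
Fact pres_mulD : left_distributive pres_mul +%R.
Proof.
elim/pres_ind=> x; elim/pres_ind=> y; elim/pres_ind=> z.
rewrite /GRing.add /= !(pres_addE, pres_mulE).
by apply/pres_eqP; apply: acongr_mulD.
Qed.
HB.instance Definition _ :=
  GRing.Zmodule_isComPzRing.Build pres pres_mulA pres_mulC pres_mul1 pres_mulD.

Lemma pres_classD x y : pres_class (AAdd x y) = pres_class x + pres_class y.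
Proof. by rewrite [RHS]pres_addE. Qed.
Lemma pres_classN x : pres_class (AOpp x) = - pres_class x.
Proof. by rewrite [RHS]pres_oppE. Qed.
Lemma pres_classM x y : pres_class (AMul x y) = pres_class x * pres_class y.
Proof. by rewrite [RHS]pres_mulE. Qed.

Definition pres_gen (g : G) : pres := pres_class (AGen g).
Definition pres_cst (a : K) : pres := pres_class (ACst a).

Fact pres_cst_nmod : nmod_morphism pres_cst.
Proof.
by split=> // a b; rewrite -pres_classD; apply/pres_eqP; apply: acongr_cstD.
Qed.
Fact pres_cst_monoid : monoid_morphism pres_cst.
Proof.
by split=> // a b; rewrite -pres_classM; apply/pres_eqP; apply: acongr_cstM.
Qed.
HB.instance Definition _ :=
  GRing.isNmodMorphism.Build K pres pres_cst pres_cst_nmod.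
HB.instance Definition _ :=
  GRing.isMonoidMorphism.Build K pres pres_cst pres_cst_monoid.

Section Lift.
Variables (S : comPzRingType) (phi : {rmorphism K -> S}) (g : G -> S).

Fixpoint aeval (x : aexpr) : S :=
  match x with
  | ACst a => phi a
  | AGen i => g i
  | AAdd x y => aeval x + aeval y
  | AOpp x => - aeval x
  | AMul x y => aeval x * aeval y
  end.

Hypothesis g_rel : forall x y, rel x y -> aeval x = aeval y.

Lemma aeval_congr x y : acongr x y -> aeval x = aeval y.
Proof.
elim=> //= {x y}.
- by move=> y x z _ -> _ ->.
- by move=> x x' y y' _ -> _ ->.
- by move=> x x' _ ->.
- by move=> x x' y y' _ -> _ ->.
- by move=> x y z; rewrite addrA.
- by move=> x y; rewrite addrC.
- by move=> x; rewrite rmorph0 add0r.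
- by move=> x; rewrite rmorph0 addNr.
- by move=> x y z; rewrite mulrA.
- by move=> x y; rewrite mulrC.
- by move=> x; rewrite rmorph1 mul1r.
- by move=> x y z; rewrite mulrDl.
- by move=> a b; rewrite rmorphD.
- by move=> a b; rewrite rmorphM.
Qed.

Definition pres_lift_fun (x : pres) : S := aeval (repr x).

Lemma pres_lift_class x : pres_lift_fun (pres_class x) = aeval x.
Proof. exact/aeval_congr/repr_pres. Qed.

Fact pres_lift_nmod : nmod_morphism pres_lift_fun.
Proof.
split=> [|x y]; first by rewrite [LHS]pres_lift_class /= rmorph0.
by elim/pres_ind: x => x; elim/pres_ind: y => y;
  rewrite -pres_classD !pres_lift_class.
Qed.
Fact pres_lift_monoid : monoid_morphism pres_lift_fun.
Proof.
split=> [|x y]; first by rewrite [LHS]pres_lift_class /= rmorph1.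
by elim/pres_ind: x => x; elim/pres_ind: y => y;
  rewrite -pres_classM !pres_lift_class.
Qed.
HB.instance Definition _ :=
  GRing.isNmodMorphism.Build pres S pres_lift_fun pres_lift_nmod.
HB.instance Definition _ :=
  GRing.isMonoidMorphism.Build pres S pres_lift_fun pres_lift_monoid.

Definition pres_lift : {rmorphism pres -> S} := pres_lift_fun.

Lemma pres_lift_gen i : pres_lift (pres_gen i) = g i.
Proof. exact: pres_lift_class. Qed.
Lemma pres_lift_cst a : pres_lift (pres_cst a) = phi a.
Proof. exact: pres_lift_class. Qed.
End Lift.

Lemma pres_ext (S : comPzRingType) (f h : {rmorphism pres -> S}) :
  (forall a, f (pres_cst a) = h (pres_cst a)) ->
  (forall i, f (pres_gen i) = h (pres_gen i)) -> f =1 h.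
Proof.
move=> ec eg; elim/pres_ind; elim=> //.
- by move=> x ex y ey; rewrite pres_classD !rmorphD ex ey.
- by move=> x ex; rewrite pres_classN !rmorphN ex.
- by move=> x ex y ey; rewrite pres_classM !rmorphM ex ey.
Qed.

End PresentedRing.

Section PresentedModule.
Variables (K : pzRingType) (G : Type).

Inductive mexpr :=
  | MZero | MGen of G | MAdd of mexpr & mexpr | MOpp of mexpr
  | MScale of K & mexpr.

Variable rel : mexpr -> mexpr -> Prop.

(* The congruence of K-modules generated by rel. *)
Inductive mcongr : mexpr -> mexpr -> Prop :=
  | mcongr_rel x y : rel x y -> mcongr x y
  | mcongr_refl x : mcongr x x
  | mcongr_sym x y : mcongr x y -> mcongr y x
  | mcongr_trans y x z : mcongr x y -> mcongr y z -> mcongr x z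
  | mcongr_add x x' y y' :
      mcongr x x' -> mcongr y y' -> mcongr (MAdd x y) (MAdd x' y')
  | mcongr_opp x x' : mcongr x x' -> mcongr (MOpp x) (MOpp x')
  | mcongr_scale a x x' : mcongr x x' -> mcongr (MScale a x) (MScale a x')
  | mcongr_addA x y z : mcongr (MAdd x (MAdd y z)) (MAdd (MAdd x y) z)
  | mcongr_addC x y : mcongr (MAdd x y) (MAdd y x)
  | mcongr_add0 x : mcongr (MAdd MZero x) x
  | mcongr_addN x : mcongr (MAdd (MOpp x) x) MZero
  | mcongr_scaleA a b x : mcongr (MScale a (MScale b x)) (MScale (a * b) x)
  | mcongr_scale1 x : mcongr (MScale 1 x) x
  | mcongr_scaleDr a x y :
      mcongr (MScale a (MAdd x y)) (MAdd (MScale a x) (MScale a y))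
  | mcongr_scaleDl a b x :
      mcongr (MScale (a + b) x) (MAdd (MScale a x) (MScale b x)).

HB.instance Definition _ := gen_eqMixin mexpr.
HB.instance Definition _ := gen_choiceMixin mexpr.

Definition mequiv (x y : mexpr) : bool := `[< mcongr x y >].

Fact mequiv_refl : reflexive mequiv.
Proof. by move=> x; apply/asboolP; apply: mcongr_refl. Qed.
Fact mequiv_sym : symmetric mequiv.
Proof. by move=> x y; apply/asbool_equiv_eq; split; apply: mcongr_sym. Qed.
Fact mequiv_trans : transitive mequiv.
Proof.
by move=> y x z /asboolP h /asboolP h'; apply/asboolP; apply: mcongr_trans h h'.
Qed.
Canonical mequiv_rel := EquivRel mequiv mequiv_refl mequiv_sym mequiv_trans.

Definition mpres := {eq_quot mequiv_rel}.
HB.instance Definition _ := Choice.on mpres.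

Definition mpres_class (x : mexpr) : mpres := \pi_mpres x.

Lemma mpres_eqP x y : mpres_class x = mpres_class y <-> mcongr x y.
Proof. by split=> [/eqmodP/asboolP|h] //; apply/eqmodP/asboolP. Qed.

Lemma mpres_ind (P : mpres -> Prop) :
  (forall x, P (mpres_class x)) -> forall x, P x.
Proof. by move=> h x; rewrite -[x]reprK; apply: h. Qed.

Lemma repr_mpres x : mcongr (repr (mpres_class x)) x.
Proof. by apply/mpres_eqP; rewrite /mpres_class reprK. Qed.

Definition mpres_add (x y : mpres) := mpres_class (MAdd (repr x) (repr y)).
Definition mpres_opp (x : mpres) := mpres_class (MOpp (repr x)).
Definition mpres_scale (a : K) (x : mpres) := mpres_class (MScale a (repr x)).

Lemma mpres_addE x y :
  mpres_add (mpres_class x) (mpres_class y) = mpres_class (MAdd x y).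
Proof. by apply/mpres_eqP/mcongr_add; apply: repr_mpres. Qed.
Lemma mpres_oppE x : mpres_opp (mpres_class x) = mpres_class (MOpp x).
Proof. by apply/mpres_eqP/mcongr_opp; apply: repr_mpres. Qed.
Lemma mpres_scaleE a x :
  mpres_scale a (mpres_class x) = mpres_class (MScale a x).
Proof. by apply/mpres_eqP/mcongr_scale; apply: repr_mpres. Qed.

Fact mpres_addA : associative mpres_add.
Proof.
by elim/mpres_ind=> x; elim/mpres_ind=> y; elim/mpres_ind=> z;
  rewrite !mpres_addE; apply/mpres_eqP; apply: mcongr_addA.
Qed.
Fact mpres_addC : commutative mpres_add.
Proof.
by elim/mpres_ind=> x; elim/mpres_ind=> y; rewrite !mpres_addE;
  apply/mpres_eqP; apply: mcongr_addC.
Qed.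
Fact mpres_add0 : left_id (mpres_class MZero) mpres_add.
Proof.
by elim/mpres_ind=> x; rewrite mpres_addE; apply/mpres_eqP; apply: mcongr_add0.
Qed.
Fact mpres_addN : left_inverse (mpres_class MZero) mpres_opp mpres_add.
Proof.
by elim/mpres_ind=> x; rewrite mpres_oppE mpres_addE; apply/mpres_eqP;
  apply: mcongr_addN.
Qed.
HB.instance Definition _ :=
  GRing.isZmodule.Build mpres mpres_addA mpres_addC mpres_add0 mpres_addN.

Lemma mpres_classD x y : mpres_class (MAdd x y) = mpres_class x + mpres_class y.
Proof. by rewrite [RHS]mpres_addE. Qed.
Lemma mpres_classN x : mpres_class (MOpp x) = - mpres_class x.
Proof. by rewrite [RHS]mpres_oppE. Qed.

Fact mpres_scaleA a b x :
  mpres_scale a (mpres_scale b x) = mpres_scale (a * b) x.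
Proof.
by elim/mpres_ind: x => x; rewrite !mpres_scaleE; apply/mpres_eqP;
  apply: mcongr_scaleA.
Qed.
Fact mpres_scale1 : left_id 1 mpres_scale.
Proof.
by elim/mpres_ind=> x; rewrite mpres_scaleE; apply/mpres_eqP;
  apply: mcongr_scale1.
Qed.
Fact mpres_scaleDr : right_distributive mpres_scale +%R.
Proof.
move=> a; elim/mpres_ind=> x; elim/mpres_ind=> y.
rewrite -mpres_classD !mpres_scaleE -mpres_classD.
by apply/mpres_eqP; apply: mcongr_scaleDr.
Qed.
Fact mpres_scaleDl x : {morph mpres_scale^~ x : a b / a + b}.
Proof.
move=> a b; elim/mpres_ind: x => x; rewrite !mpres_scaleE -mpres_classD.
by apply/mpres_eqP; apply: mcongr_scaleDl.
Qed.
HB.instance Definition _ := GRing.Zmodule_isLmodule.Build K mpres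
  mpres_scaleA mpres_scale1 mpres_scaleDr mpres_scaleDl.

Lemma mpres_classZ a x : mpres_class (MScale a x) = a *: mpres_class x.
Proof. by rewrite [RHS]mpres_scaleE. Qed.

Definition mpres_gen (i : G) : mpres := mpres_class (MGen i).

Section Lift.
Variables (K' : pzRingType) (phi : {rmorphism K -> K'}) (N : lmodType K').
Variable g : G -> N.

Fixpoint meval (x : mexpr) : N :=
  match x with
  | MZero => 0
  | MGen i => g i
  | MAdd x y => meval x + meval y
  | MOpp x => - meval x
  | MScale a x => phi a *: meval x
  end.

Hypothesis g_rel : forall x y, rel x y -> meval x = meval y.

Lemma meval_congr x y : mcongr x y -> meval x = meval y.
Proof.
elim=> //= {x y}.
- by move=> y x z _ -> _ ->.
- by move=> x x' y y' _ -> _ ->.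
- by move=> x x' _ ->.
- by move=> a x x' _ ->.
- by move=> x y z; rewrite addrA.
- by move=> x y; rewrite addrC.
- by move=> x; rewrite add0r.
- by move=> x; rewrite addNr.
- by move=> a b x; rewrite rmorphM scalerA.
- by move=> x; rewrite rmorph1 scale1r.
- by move=> a x y; rewrite scalerDr.
- by move=> a b x; rewrite rmorphD scalerDl.
Qed.

Definition mpres_lift (x : mpres) : N := meval (repr x).

Lemma mpres_lift_class x : mpres_lift (mpres_class x) = meval x.
Proof. exact/meval_congr/repr_mpres. Qed.
Lemma mpres_lift_gen i : mpres_lift (mpres_gen i) = g i.
Proof. exact: mpres_lift_class. Qed.
Lemma mpres_liftD : {morph mpres_lift : x y / x + y}.
Proof.
by elim/mpres_ind=> x; elim/mpres_ind=> y; rewrite -mpres_classD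
  !mpres_lift_class.
Qed.
Lemma mpres_liftZ a x : mpres_lift (a *: x) = phi a *: mpres_lift x.
Proof.
by elim/mpres_ind: x => x; rewrite -mpres_classZ !mpres_lift_class.
Qed.
End Lift.

Lemma mpres_ext (K' : pzRingType) (phi : K -> K') (N : lmodType K')
    (f h : mpres -> N) :
  {morph f : x y / x + y} -> {morph h : x y / x + y} ->
  (forall a x, f (a *: x) = phi a *: f x) ->
  (forall a x, h (a *: x) = phi a *: h x) ->
  (forall i, f (mpres_gen i) = h (mpres_gen i)) -> f =1 h.
Proof.
move=> fD hD fZ hZ e.
have f0 : f 0 = 0 by apply: (addIr (f 0)); rewrite -fD !add0r.
have h0 : h 0 = 0 by apply: (addIr (h 0)); rewrite -hD !add0r.
elim/mpres_ind; elim=> [|//|x ex y ey|x ex|a x ex].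
- by rewrite -[mpres_class _]/(0 : mpres) f0 h0.
- by rewrite mpres_classD fD hD ex ey.
- rewrite mpres_classN; apply: (addIr (f (mpres_class x))).
  by rewrite -fD addNr f0 ex -hD addNr h0.
- by rewrite mpres_classZ fZ hZ ex.
Qed.

End PresentedModule.

Arguments AGen {K G}.
Arguments ACst {K G}.
Arguments MGen {K G}.

(* A commutative unital R-algebra, as a commutative ring under R.  Unlike for
   comAlgType, the zero ring is allowed. *)
Record calg (R : comPzRingType) := CAlg {
  calg_ring :> comPzRingType;
  calg_str : {rmorphism R -> calg_ring} }.

Record calg_hom (R : comPzRingType) (A B : calg R) := CAlgHom {
  chom :> {rmorphism A -> B};
  chom_str : forall r, chom (calg_str A r) = calg_str B r }.

Lemma rmorphism_ext (A B : pzSemiRingType) (f g : {rmorphism A -> B}) :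
  f =1 g -> f = g.
Proof.
case: f g => [f cf] [g cg] /= /funext e; move: cf cg; rewrite {}e => cf cg.
congr GRing.RMorphism.Pack; case: cf cg => [[a] [b]] [[a'] [b']].
by congr GRing.RMorphism.Class; [congr Algebra.isNmodMorphism.Axioms_
  |congr GRing.isMonoidMorphism.Axioms_]; apply: Prop_irrelevance.
Qed.

Section CAlgCategory.
Variable R : comPzRingType.

Lemma calg_hom_ext (A B : calg R) (f g : calg_hom A B) : f =1 g -> f = g.
Proof.
case: f g => [f hf] [g hg] /= /rmorphism_ext e; move: hf hg; rewrite {}e.
by move=> hf hg; congr CAlgHom; apply: Prop_irrelevance.
Qed.

Definition calg_id (A : calg R) : calg_hom A A :=
  @CAlgHom R A A idfun (fun r => erefl).

Fact calg_comp_str (A B D : calg R) (g : calg_hom B D) (f : calg_hom A B) r :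
  (g \o f) (calg_str A r) = calg_str D r.
Proof. by rewrite /= !chom_str. Qed.

Definition calg_comp (A B D : calg R) (g : calg_hom B D) (f : calg_hom A B) :
  calg_hom A D := CAlgHom (calg_comp_str g f).

Definition cAlg : category.
Proof.
by refine (@Category (calg R) (@calg_hom R) calg_id calg_comp _ _ _);
  move=> *; apply: calg_hom_ext.
Defined.

Definition Aff : category := op_cat cAlg.

Definition base_alg : calg R := @CAlg R R idfun.

Definition str_hom (A : calg R) : calg_hom base_alg A :=
  @CAlgHom R base_alg A (calg_str A) (fun r => erefl).

Definition restrict_scalars (A : calg R) (B : calg A) : calg R :=
  @CAlg R B (calg_str B \o calg_str A).

Definition pres_alg (G : Type) (rel : aexpr R G -> aexpr R G -> Prop) : calg R :=
  @CAlg R (pres rel) (@pres_cst R G rel).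

Section PresHom.
Variables (G : Type) (rel : aexpr R G -> aexpr R G -> Prop) (S : calg R).
Variable g : G -> S.
Hypothesis g_rel :
  forall x y, rel x y -> aeval (calg_str S) g x = aeval (calg_str S) g y.

Definition pres_hom : calg_hom (pres_alg rel) S :=
  @CAlgHom R (pres_alg rel) S (pres_lift g_rel) (pres_lift_cst g_rel).
End PresHom.

Section Tensor.
Variables A B : calg R.

Notation t a b := (AGen (a, b)).

Inductive tensor_rel : aexpr R (A * B) -> aexpr R (A * B) -> Prop :=
  | tensor_Dl a a' b : tensor_rel (t (a + a') b) (AAdd (t a b) (t a' b))
  | tensor_Dr a b b' : tensor_rel (t a (b + b')) (AAdd (t a b) (t a b'))
  | tensor_Zl r a b : tensor_rel (t (calg_str A r * a) b) (AMul (ACst r) (t a b))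
  | tensor_Zr r a b : tensor_rel (t a (calg_str B r * b)) (AMul (ACst r) (t a b))
  | tensor_M a a' b b' : tensor_rel (t (a * a') (b * b')) (AMul (t a b) (t a' b'))
  | tensor_1 : tensor_rel (t 1 1) (ACst 1).

Definition tensor : calg R := pres_alg tensor_rel.

Definition tens (a : A) (b : B) : tensor := pres_gen tensor_rel (a, b).

Let rel_eq x y (h : tensor_rel x y) :
  pres_class tensor_rel x = pres_class tensor_rel y.
Proof. exact/pres_eqP/acongr_rel. Qed.

Lemma tensDl a a' b : tens (a + a') b = tens a b + tens a' b.
Proof. by rewrite -pres_classD; apply: rel_eq; constructor. Qed.
Lemma tensDr a b b' : tens a (b + b') = tens a b + tens a b'.
Proof. by rewrite -pres_classD; apply: rel_eq; constructor. Qed.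
Lemma tensZl r a b : tens (calg_str A r * a) b = calg_str tensor r * tens a b.
Proof. by rewrite -pres_classM; apply: rel_eq; constructor. Qed.
Lemma tensZr r a b : tens a (calg_str B r * b) = calg_str tensor r * tens a b.
Proof. by rewrite -pres_classM; apply: rel_eq; constructor. Qed.
Lemma tensM a a' b b' : tens (a * a') (b * b') = tens a b * tens a' b'.
Proof. by rewrite -pres_classM; apply: rel_eq; constructor. Qed.
Lemma tens0l b : tens 0 b = 0.
Proof. by apply: (addIr (tens 0 b)); rewrite -tensDl !add0r. Qed.
Lemma tens11 : tens 1 1 = 1.
Proof. by apply: rel_eq; constructor. Qed.

Definition inl_fun (a : A) := tens a 1.
Definition inr_fun (b : B) := tens 1 b.

Fact inl_nmod : nmod_morphism inl_fun.
Proof.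
split=> [|a a']; last exact: tensDl.
by apply: (addIr (tens 0 1)); rewrite -[LHS]tensDl !add0r.
Qed.
Fact inl_monoid : monoid_morphism inl_fun.
Proof.
by split=> [|a a']; [exact: tens11 | rewrite -[RHS]tensM mulr1].
Qed.
HB.instance Definition _ := GRing.isNmodMorphism.Build A tensor inl_fun inl_nmod.
HB.instance Definition _ := GRing.isMonoidMorphism.Build A tensor inl_fun inl_monoid.

Fact inr_nmod : nmod_morphism inr_fun.
Proof.
split=> [|b b']; last exact: tensDr.
by apply: (addIr (tens 1 0)); rewrite -[LHS]tensDr !add0r.
Qed.
Fact inr_monoid : monoid_morphism inr_fun.
Proof.
by split=> [|b b']; [exact: tens11 | rewrite -[RHS]tensM mulr1].
Qed.
HB.instance Definition _ := GRing.isNmodMorphism.Build B tensor inr_fun inr_nmod.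
HB.instance Definition _ := GRing.isMonoidMorphism.Build B tensor inr_fun inr_monoid.

Fact inl_str r : tens (calg_str A r) 1 = calg_str tensor r.
Proof. by rewrite -[calg_str A r]mulr1 tensZl tens11 mulr1. Qed.
Fact inr_str r : tens 1 (calg_str B r) = calg_str tensor r.
Proof. by rewrite -[calg_str B r]mulr1 tensZr tens11 mulr1. Qed.

Definition tens_inl : calg_hom A tensor :=
  @CAlgHom R A tensor inl_fun inl_str.
Definition tens_inr : calg_hom B tensor :=
  @CAlgHom R B tensor inr_fun inr_str.

Section Copair.
Variables (S : calg R) (f : calg_hom A S) (g : calg_hom B S).

Fact copair_rel x y : tensor_rel x y ->
  aeval (calg_str S) (fun u => f u.1 * g u.2) x
  = aeval (calg_str S) (fun u => f u.1 * g u.2) y.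
Proof.
case=> /=.
- by move=> a a' b; rewrite rmorphD mulrDl.
- by move=> a b b'; rewrite rmorphD mulrDr.
- by move=> r a b; rewrite rmorphM chom_str mulrA.
- by move=> r a b; rewrite rmorphM chom_str mulrCA.
- by move=> a a' b b'; rewrite !rmorphM mulrACA.
- by rewrite !rmorph1 mulr1.
Qed.

Definition copair : calg_hom tensor S := pres_hom copair_rel.

Lemma copairE a b : copair (tens a b) = f a * g b.
Proof. exact: pres_lift_gen. Qed.
End Copair.

Lemma tensor_ext (S : calg R) (f g : calg_hom tensor S) :
  (forall a b, f (tens a b) = g (tens a b)) -> f = g.
Proof.
move=> e; apply/calg_hom_ext/pres_ext => [a|[a b]]; last exact: e.
by rewrite -[pres_cst _ a]/(calg_str tensor a) !chom_str.
Qed.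

End Tensor.

Definition aff_products : finite_products Aff.
Proof.
refine (@FiniteProducts Aff base_alg str_hom _ tensor tens_inl tens_inr
  (fun X A B f g => copair f g) _ _ _).
- by move=> X f; apply: calg_hom_ext => r; exact: (chom_str f r).
- move=> X A B f g; apply: calg_hom_ext => a.
  by rewrite [LHS]copairE rmorph1 mulr1.
- move=> X A B f g; apply: calg_hom_ext => b.
  by rewrite [LHS]copairE rmorph1 mul1r.
- move=> X A B h; apply: tensor_ext => a b.
  by rewrite copairE /= -rmorphM -tensM mulr1 mul1r.
Defined.

(* R[x_1, ..., x_n]/(x_i x_j)_{i,j} *)
Inductive dual_rel (n : nat) : aexpr R 'I_n -> aexpr R 'I_n -> Prop :=
  | dual_mul0 i j : dual_rel (AMul (AGen i) (AGen j)) (ACst 0).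

Definition dual (n : nat) : calg R := pres_alg (@dual_rel n).

Definition dual_gen n (i : 'I_n) : dual n := pres_gen (@dual_rel n) i.

Lemma dual_gen_mul n (i j : 'I_n) : dual_gen i * dual_gen j = 0.
Proof. by rewrite -pres_classM; apply/pres_eqP/acongr_rel; constructor. Qed.

Section DualHom.
Variables (n : nat) (S : calg R) (x : 'I_n -> S).
Hypothesis x_mul0 : forall i j, x i * x j = 0.

Fact dual_hom_rel y z : dual_rel y z ->
  aeval (calg_str S) x y = aeval (calg_str S) x z.
Proof. by case=> i j /=; rewrite x_mul0 rmorph0. Qed.

Definition dual_hom : calg_hom (dual n) S := pres_hom dual_hom_rel.

Lemma dual_homE i : dual_hom (dual_gen i) = x i.
Proof. exact: pres_lift_gen. Qed.
End DualHom.

Definition Reps : calg R := dual 1.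
Definition eps : Reps := dual_gen ord0.

Definition dual_p : calg_hom Reps base_alg :=
  @dual_hom 1 base_alg (fun=> 0) (fun _ _ => mulr0 0).

Definition dual_z : calg_hom base_alg Reps := str_hom Reps.

Definition dual_s : calg_hom (dual 2) Reps :=
  @dual_hom 2 Reps (fun=> eps) (fun _ _ => dual_gen_mul _ _).

Fact dual_pi_mul0 (k i j : 'I_2) :
  (if i == k then eps else 0) * (if j == k then eps else 0) = 0 :> Reps.
Proof. by case: ifP => _; case: ifP => _; rewrite ?(mulr0, mul0r) ?dual_gen_mul. Qed.

Definition dual_pi (k : 'I_2) : calg_hom (dual 2) Reps :=
  dual_hom (dual_pi_mul0 k).

Fact dual_l_mul0 : tens eps eps * tens eps eps = 0 :> tensor Reps Reps.
Proof. by rewrite -tensM dual_gen_mul tens0l. Qed.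

Definition dual_l : calg_hom Reps (tensor Reps Reps) :=
  @dual_hom 1 _ (fun=> tens eps eps) (fun _ _ => dual_l_mul0).

Definition dual_c : calg_hom (tensor Reps Reps) (tensor Reps Reps) :=
  copair (tens_inr Reps Reps) (tens_inl Reps Reps).

End CAlgCategory.

Section Kaehler.
Variables (R : comPzRingType) (A : calg R).

Inductive kaehler_rel : mexpr A A -> mexpr A A -> Prop :=
  | kaehler_add a b :
      kaehler_rel (MGen (a + b)) (MAdd (MGen a) (MGen b))
  | kaehler_leibniz a b : kaehler_rel (MGen (a * b))
      (MAdd (MScale a (MGen b)) (MScale b (MGen a)))
  | kaehler_str r : kaehler_rel (MGen (calg_str A r)) (MZero _ _).

(* Omega_{A/R}, with its universal derivation. *)
Definition kaehler : lmodType A := mpres kaehler_rel.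
Definition kd (a : A) : kaehler := mpres_gen kaehler_rel a.

Let rel_eq x y (h : kaehler_rel x y) :
  mpres_class kaehler_rel x = mpres_class kaehler_rel y.
Proof. exact/mpres_eqP/mcongr_rel. Qed.

Lemma kdD a b : kd (a + b) = kd a + kd b.
Proof. by rewrite -mpres_classD; apply: rel_eq; constructor. Qed.
Lemma kdM a b : kd (a * b) = a *: kd b + b *: kd a.
Proof. by rewrite -!mpres_classZ -mpres_classD; apply: rel_eq; constructor. Qed.
Lemma kd_str r : kd (calg_str A r) = 0.
Proof. by apply: rel_eq; constructor. Qed.
End Kaehler.

Section Sym.
Variables (A : comPzRingType) (M : lmodType A).

Inductive sym_rel : aexpr A M -> aexpr A M -> Prop :=
  | sym_add m m' : sym_rel (AGen (m + m')) (AAdd (AGen m) (AGen m'))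
  | sym_scale a m : sym_rel (AGen (a *: m)) (AMul (ACst a) (AGen m)).

Definition sym : calg A := pres_alg sym_rel.
Definition sym_gen (m : M) : sym := pres_gen sym_rel m.

Lemma sym_genD m m' : sym_gen (m + m') = sym_gen m + sym_gen m'.
Proof.
by rewrite -pres_classD; apply/pres_eqP/acongr_rel; constructor.
Qed.
Lemma sym_genZ a m : sym_gen (a *: m) = calg_str sym a * sym_gen m.
Proof.
by rewrite -pres_classM; apply/pres_eqP/acongr_rel; constructor.
Qed.
End Sym.

Definition sym_kaehler (R : comPzRingType) (A : calg R) : calg R :=
  restrict_scalars (sym (kaehler A)).

Section SymKaehlerMap.
Variables (R : comPzRingType) (A B : calg R) (f : calg_hom A B).

Fact kaehler_map_rel x y : kaehler_rel x y ->
  meval f (fun a => kd (f a)) x = meval f (fun a => kd (f a)) y.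
Proof.
case=> /= [a b|a b|r].
- by rewrite rmorphD kdD.
- by rewrite rmorphM kdM.
- by rewrite chom_str kd_str.
Qed.

Definition kaehler_map : kaehler A -> kaehler B :=
  mpres_lift f (fun a => kd (f a)).

Lemma kaehler_map_d a : kaehler_map (kd a) = kd (f a).
Proof. exact: (mpres_lift_gen kaehler_map_rel). Qed.
Lemma kaehler_mapD : {morph kaehler_map : x y / x + y}.
Proof. exact: (mpres_liftD kaehler_map_rel). Qed.
Lemma kaehler_mapZ a x : kaehler_map (a *: x) = f a *: kaehler_map x.
Proof. exact: (mpres_liftZ kaehler_map_rel). Qed.

Definition sym_kaehler_cst : {rmorphism A -> sym_kaehler B} :=
  calg_str (sym (kaehler B)) \o f.

Fact sym_kaehler_map_rel x y : sym_rel x y ->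
  aeval sym_kaehler_cst (fun m => sym_gen (kaehler_map m) : sym_kaehler B) x
  = aeval sym_kaehler_cst (fun m => sym_gen (kaehler_map m) : sym_kaehler B) y.
Proof.
case=> /= [m m'|a m]; first by rewrite kaehler_mapD sym_genD.
by rewrite kaehler_mapZ sym_genZ.
Qed.

Fact sym_kaehler_map_str r :
  pres_lift sym_kaehler_map_rel (calg_str (sym_kaehler A) r)
  = calg_str (sym_kaehler B) r.
Proof. by rewrite [LHS]pres_lift_cst /= chom_str. Qed.

(* a |-> f a and da |-> d(f a), for a in A *)
Definition sym_kaehler_map : calg_hom (sym_kaehler A) (sym_kaehler B) :=
  @CAlgHom R (sym_kaehler A) (sym_kaehler B) (pres_lift sym_kaehler_map_rel)
    sym_kaehler_map_str.

Lemma sym_kaehler_map_cst a :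
  sym_kaehler_map (calg_str (sym (kaehler A)) a)
  = calg_str (sym (kaehler B)) (f a).
Proof. exact: pres_lift_cst. Qed.
Lemma sym_kaehler_map_gen m :
  sym_kaehler_map (sym_gen m) = sym_gen (kaehler_map m).
Proof. exact: pres_lift_gen. Qed.
End SymKaehlerMap.

Section SymKaehlerFunctor.
Variable R : comPzRingType.

Fact kaehler_map_id (A : calg R) : kaehler_map (calg_id A) =1 id.
Proof.
apply: (mpres_ext (phi := idfun)) => //.
- exact: kaehler_mapD.
- by move=> a x; rewrite kaehler_mapZ.
- exact: kaehler_map_d.
Qed.

Fact kaehler_map_comp (A B D : calg R) (g : calg_hom B D) (f : calg_hom A B) :
  kaehler_map (calg_comp g f) =1 kaehler_map g \o kaehler_map f.
Proof.
apply: (mpres_ext (phi := g \o f)).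
- exact: kaehler_mapD.
- by move=> x y /=; rewrite !kaehler_mapD.
- by move=> a x; rewrite kaehler_mapZ.
- by move=> a x /=; rewrite !kaehler_mapZ.
- by move=> a; rewrite [LHS]kaehler_map_d [RHS]/= !kaehler_map_d.
Qed.

Fact sym_kaehler_id (A : calg R) :
  sym_kaehler_map (calg_id A) = calg_id (sym_kaehler A).
Proof.
apply/calg_hom_ext/pres_ext => [a|m].
  by rewrite [LHS]sym_kaehler_map_cst.
by rewrite [LHS]sym_kaehler_map_gen kaehler_map_id.
Qed.

Fact sym_kaehler_comp (A B D : calg R) (g : calg_hom B D) (f : calg_hom A B) :
  sym_kaehler_map (calg_comp g f)
  = calg_comp (sym_kaehler_map g) (sym_kaehler_map f).
Proof.
apply/calg_hom_ext/pres_ext => [a|m].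
  by rewrite [LHS]sym_kaehler_map_cst [RHS]/= !sym_kaehler_map_cst.
by rewrite [LHS]sym_kaehler_map_gen kaehler_map_comp [RHS]/= !sym_kaehler_map_gen.
Qed.

Definition sym_kaehlerF_alg : functor (cAlg R) (cAlg R) :=
  @Functor (cAlg R) (cAlg R) (@sym_kaehler R) (@sym_kaehler_map R)
    sym_kaehler_id sym_kaehler_comp.

Definition sym_kaehlerF : functor (Aff R) (Aff R) := op_functor sym_kaehlerF_alg.

End SymKaehlerFunctor.

Section DualNumberStructure.
Variable R : comPzRingType.

Local Notation P := (aff_products R).
Local Notation D := (Reps R : Aff R).
Local Notation F := (prod_functor P D).

(* In Aff_R the product is the tensor product, so prod_functor P D is
   R[eps] (x) -, and the maps below are the transformations induced by the
   algebra maps dual_p, ..., dual_c, read in the opposite category. *)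
Definition tau_p (X : Aff R) : hom X (F X) :=
  prod_map P (dual_p R : @hom (Aff R) (term P) D) (idm X) ∘ unitor_inv P X.

Definition tau_z (X : Aff R) : hom (F X) X :=
  pr2 P (term P) X
    ∘ prod_map P (dual_z R : @hom (Aff R) D (term P)) (idm X).

Definition tau_s (X : Aff R) : hom (F X) (prod_functor P (dual R 2) X) :=
  prod_map P (dual_s R : @hom (Aff R) D (dual R 2)) (idm X).

Definition tau_pi (k : 'I_2) (X : Aff R) :
    hom (F X) (prod_functor P (dual R 2) X) :=
  prod_map P (dual_pi R k : @hom (Aff R) D (dual R 2)) (idm X).

Definition tau_l (X : Aff R) : hom (F (F X)) (F X) :=
  prod_map P (dual_l R : @hom (Aff R) (prd P D D) D) (idm X)
    ∘ associator_inv P D D X.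

Definition tau_c (X : Aff R) : hom (F (F X)) (F (F X)) :=
  associator P D D X
    ∘ (prod_map P (dual_c R : @hom (Aff R) (prd P D D) (prd P D D)) (idm X)
         ∘ associator_inv P D D X).

(* t is the tangent structure T^Omega with tangent bundle functor
   A |-> Sym_A Omega_{A/R}: this functor is left adjoint on algebras (hence
   right adjoint on Aff_R) to R[eps] (x) -, by the adjunction with universal
   arrow A -> R[eps] (x) Sym_A Omega_{A/R}, x |-> 1 (x) x + eps (x) dx;
   T_2 is likewise adjoint to R[eps_1, eps_2] (x) -, its projections being the
   mates of the maps dual_pi k; and p, z, s, l, c are the mates of the
   transformations above. *)
Definition is_TOmega (t : tangent_on (sym_kaehlerF R)) : Prop :=
  exists (a : adjunction F (sym_kaehlerF R))
         (a2 : adjunction (prod_functor P (dual R 2)) (tan_Tn t (isT : 0 < 2)%N)),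
    let i := id_adjunction (Aff R) in
    let aa := comp_adjunction a a in
    [/\ forall (A : calg R) (x : A),
          (adj_counit a A : calg_hom A (tensor (Reps R) (sym_kaehler A))) x
          = tens 1 (calg_str (sym (kaehler A)) x : sym_kaehler A)
            + tens (eps R) (sym_gen (kd x) : sym_kaehler A),
        forall A k, fp_proj (T2 t A) k = mate a2 a (tau_pi k) A
      & forall A : Aff R,
        [/\ tan_p t A = mate a i tau_p A,
            tan_z t A = mate i a tau_z A,
            tan_s t A = mate a2 a tau_s A,
            tan_l t A = mate a aa tau_l A
          & tan_c t A = mate aa aa tau_c A] ].

End DualNumberStructure.

Definition is_pid (R : idomainType) : Prop :=
  forall I : R -> Prop,
    I 0 -> (forall x y, I x -> I y -> I (x + y)) ->
    (forall a x, I x -> I (a * x)) ->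
  exists g, forall x, I x <-> exists a, x = a * g.

(* Main.v *)
Require Import Defs.
From mathcomp Require Import all_boot all_algebra.
From HB Require Import structures.
From mathcomp Require Import boolp.
Import Defs.

Set Implicit Arguments.
Unset Strict Implicit.
Unset Printing Implicit Defensive.

Import GRing.Theory.

Local Open Scope ring_scope.
Local Open Scope cat_scope.

(** A representable tangent structure has a tangent functor T that is right
    adjoint on affine schemes to D (x) -, for an algebra D. Transposing along
    this adjunction turns p, z, l, c into natural algebra maps
      p_B : D (x) B -> B,             z_B : B -> D (x) B,
      l_B : D (x) B -> D (x) D (x) B, c_B : D (x) D (x) B -> D (x) D (x) B
    (the comates), and every axiom of the structure into an identity between
    them, with the order of whiskering reversed.

    Classification. A morphism of schemes is determined by its effect on
    functions, and a function is a map to the affine line, so the addition s can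
    be evaluated on pairs of elements of D (x) B. The monoid laws force it to be
    y1 + y2 - z p y1, and being a ring map it forces the kernel of p to have
    square zero ([comates_additive_sum], [kernel_mul0]). Naturality at the dual
    numbers B[eps] then forces p_B and z_B to be induced by an augmentation
    D -> R and by the unit of D ([p_cst], [z_cst]), and c to be the swap
    ([c_tens]).
    Let I be the kernel of the augmentation. Universality of the vertical lift
    says that l maps I bijectively onto I (x) I, and c l = l makes I (x) I
    symmetric: x (x) y = y (x) x ([ker_swap]). Because D (x) - has a left
    adjoint, D is a finitely generated module and D (x) - preserves injections
    ([algebra_span], [tmap_inj]); so I is torsion free, and any two of its
    elements are linearly dependent ([ker_dependent]). Over a principal ideal
    domain such a module is generated by one element g ([ker_principal]). If
    g = 0, then p is invertible and the structure is trivial. Otherwise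
    l(g) = v g (x) g with v a unit, and e = v g satisfies l(e) = e (x) e, so
    eps |-> e identifies the dual numbers with D and the comates with those of
    T^Omega ([representing_algebra]); isomorphic comates give isomorphic
    tangent structures ([tangent_iso_of_comates]).

    Existence. In the other direction, mates of transformations of a left adjoint
    that satisfy the transposed identities make up a tangent structure
    ([cot_tangent]). For the dual numbers those identities are checked on
    generators, and the n-fold fiber powers of p are right adjoint to
    R[eps_1, .., eps_n] (x) - because the latter is the n-fold fiber power of
    B[eps] -> B ([tau_proj_univ], [fp_adj]). The structure is not trivial, since
    an isomorphism with the trivial one would give eps = 0. *)

(** * Transposition along an adjunction and mates *)

Section Transposes.
Variables (C D : category) (F : functor C D) (T : functor D C).

Section Adjunct.
Variable a : adjunction F T.

Definition flat X A (g : hom X (T A)) : hom (F X) A := adj_counit a A ∘ fmap F g.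
Definition sharp X A (h : hom (F X) A) : hom X (T A) := fmap T h ∘ adj_unit a X.

Lemma flat_pre X Y A (g : hom Y (T A)) (k : hom X Y) :
  flat (g ∘ k) = flat g ∘ fmap F k.
Proof. by rewrite /flat fmap_comp compA. Qed.

Lemma flat_post X A B (f : hom A B) (g : hom X (T A)) :
  flat (fmap T f ∘ g) = f ∘ flat g.
Proof.
have h := naturality (adj_counit a) f; rewrite /= in h.
by rewrite /flat fmap_comp compA -h compA.
Qed.

Lemma sharpK X A (h : hom (F X) A) : flat (sharp h) = h.
Proof. by rewrite flat_post /flat triangle_l comp_idr. Qed.

Lemma flatK X A (g : hom X (T A)) : sharp (flat g) = g.
Proof.
have h := naturality (adj_unit a) g; rewrite /= in h.
by rewrite /sharp fmap_comp -compA h compA triangle_r comp_idl.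
Qed.

Lemma flat_inj X A (g g' : hom X (T A)) : flat g = flat g' -> g = g'.
Proof. by move=> e; rewrite -[g]flatK e flatK. Qed.

Lemma flat_unit X : flat (adj_unit a X) = idm (F X).
Proof. exact: triangle_l. Qed.

Lemma radj_fiber_power n (E A P : D) (p : hom E A) (proj : 'I_n -> hom P E) :
  is_fiber_power p proj ->
  is_fiber_power (fmap T p) (fun k => fmap T (proj k)).
Proof.
move=> [pe pu]; split=> [i j|X f fe]; first by rewrite -!fmap_comp (pe i j).
have [|h [hf hu]] := pu (F X) (fun k => flat (f k)).
  by move=> i j; rewrite -!flat_post (fe i j).
exists (sharp h); split=> [i|k ke]; first by apply: flat_inj; rewrite flat_post sharpK hf.
by apply: flat_inj; rewrite sharpK; apply: hu => i; rewrite -flat_post ke.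
Qed.

End Adjunct.

Section AdjunctionOfUniversal.
Variable e : nat_trans (compF F T) (idF D).
Hypothesis e_univ : forall X A (h : hom (F X) A),
  exists! g : hom X (T A), e A ∘ fmap F g = h.

Let lift X A (h : hom (F X) A) : hom X (T A) := sval (cid (e_univ h)).
Let liftE X A (h : hom (F X) A) : e A ∘ fmap F (lift h) = h.
Proof. by rewrite /lift; case: cid => g []. Qed.
Let lift_inj X A (g g' : hom X (T A)) :
  e A ∘ fmap F g = e A ∘ fmap F g' -> g = g'.
Proof.
move=> h; have [k [_ ku]] := e_univ (e A ∘ fmap F g).
by rewrite -(ku g) // (ku g').
Qed.

Fact univ_unit_natural X Y (f : hom X Y) :
  fmap (compF T F) f ∘ lift (idm (F X)) = lift (idm (F Y)) ∘ fmap (idF C) f.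
Proof.
apply: lift_inj; have h := naturality e (fmap F f); rewrite /= in h *.
by rewrite !fmap_comp compA -h -compA liftE compA liftE comp_idl comp_idr.
Qed.

Fact univ_triangle_l X : e (F X) ∘ fmap F (lift (idm (F X))) = idm (F X).
Proof. exact: liftE. Qed.

Fact univ_triangle_r A : fmap T (e A) ∘ lift (idm (F (T A))) = idm (T A).
Proof.
apply: lift_inj; have h := naturality e (e A); rewrite /= in h.
by rewrite fmap_comp compA -h -compA liftE fmap_id !comp_idr.
Qed.

Definition adj_of_univ : adjunction F T :=
  @Adjunction C D F T
    (@NatTrans C C (idF C) (compF T F) _ univ_unit_natural) e
    univ_triangle_l univ_triangle_r.

End AdjunctionOfUniversal.

End Transposes.

Lemma adj_of_iso C D (F : functor C D) (T G : functor D C)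
    (a : adjunction F G) :
  isomorphic_functors T G -> inhabited (adjunction F T).
Proof.
move=> [b b_iso]; constructor.
have nat A B (f : hom A B) : fmap (idF D) f ∘ flat a (b A) =
    flat a (b B) ∘ fmap (compF F T) f.
  by rewrite /= -flat_post -flat_pre naturality.
apply: (adj_of_univ (e := @NatTrans D D (compF F T) (idF D) _ nat)) => X A h /=.
have [b' [b'b bb']] := b_iso A.
exists (b' ∘ sharp a h); split=> [|g <-].
  by rewrite -flat_pre compA bb' comp_idl sharpK.
by rewrite -flat_pre flatK compA b'b comp_idl.
Qed.

Lemma flat_comp_adj C D E (F : functor C D) (G : functor D C)
    (F' : functor D E) (G' : functor E D) (a : adjunction F G)
    (a' : adjunction F' G') X A (g : hom X (G (G' A))) :
  flat (comp_adjunction a a') g = flat a' (flat a g).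
Proof. by rewrite /flat /= fmap_comp compA. Qed.

Lemma flat_id_adj C X A (g : @hom C X A) : flat (id_adjunction C) g = g.
Proof. exact: comp_idl. Qed.

Lemma iter_ladj C (F T : functor C C) (a : adjunction F T) m :
  exists F', inhabited (adjunction F' (iterF m T)).
Proof.
elim: m => [|m [F' [a']]].
  by exists (idF C); constructor; apply: id_adjunction.
by exists (compF F' F); constructor; apply: (comp_adjunction a a').
Qed.

Lemma eq_mate C D (F F' : functor C D) (G G' : functor D C)
    (a : adjunction F G) (a' : adjunction F' G')
    (tau tau' : forall X, hom (F' X) (F X)) A :
  (forall X, tau X = tau' X) -> mate a a' tau A = mate a a' tau' A.
Proof. by move=> e; rewrite /mate e. Qed.

Section Mates.
Variables (C D : category) (F F' : functor C D) (G G' : functor D C).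
Variables (a : adjunction F G) (a' : adjunction F' G').
Variable tau : nat_trans F' F.

Lemma flat_mate X A (g : hom X (G A)) :
  flat a' (mate a a' tau A ∘ g) = flat a g ∘ tau X.
Proof.
rewrite /mate -compA flat_post flat_pre flat_unit comp_idl -compA -naturality compA.
by [].
Qed.

Fact mate_natural A B (f : hom A B) :
  fmap G' f ∘ mate a a' tau A = mate a a' tau B ∘ fmap G f.
Proof.
apply: (flat_inj (a := a')); rewrite flat_post flat_mate -[mate _ _ _ A]comp_idr.
by rewrite flat_mate -[fmap G f]comp_idr flat_post compA.
Qed.

Definition mateN : nat_trans G G' := NatTrans mate_natural.

End Mates.

Section FiberPowerAdjunction.
Variables (C : category) (F T : functor C C) (a : adjunction F T).
Variables (p : nat_trans T (idF C)) (tp : forall X : C, hom X (F X)).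
Hypothesis tpE : forall X A (g : hom X (T A)), p A ∘ g = flat a g ∘ tp X.

Variables (n : nat) (P : forall A, fiber_power n (p A)) (Fn : functor C C).
Variable tpi : 'I_n -> nat_trans F Fn.
Hypothesis tpi_tp : forall i j X, tpi i X ∘ tp X = tpi j X ∘ tp X.
Hypothesis tpi_univ : forall X A (h : 'I_n -> hom (F X) A),
  (forall i j, h i ∘ tp X = h j ∘ tp X) ->
  exists! k : hom (Fn X) A, forall i, k ∘ tpi i X = h i.

Let e_ex A : exists! k : hom (Fn (P A)) A,
  forall i, k ∘ tpi i (P A) = flat a (fp_proj (P A) i).
Proof. by apply: tpi_univ => i j; rewrite -!tpE; apply: fp_projE. Qed.

Definition fp_counit_map A : hom (Fn (P A)) A := sval (cid (e_ex A)).

Lemma fp_counit_tpi A i :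
  fp_counit_map A ∘ tpi i (P A) = flat a (fp_proj (P A) i).
Proof. by rewrite /fp_counit_map; case: cid => k []. Qed.

Lemma tpi_ext X A (h k : hom (Fn X) A) :
  (forall i, h ∘ tpi i X = k ∘ tpi i X) -> h = k.
Proof.
move=> e; have [|m [_ mu]] := tpi_univ (h := fun i => h ∘ tpi i X).
  by move=> i j; rewrite -!compA (tpi_tp i j).
by rewrite -(mu h) // -(mu k).
Qed.

Fact fp_counit_natural A B (f : hom A B) :
  fmap (idF C) f ∘ fp_counit_map A
  = fp_counit_map B ∘ fmap (compF Fn (fiber_powerF P)) f.
Proof.
apply: tpi_ext => i; rewrite -[LHS]compA fp_counit_tpi -compA /=.
by rewrite naturality compA fp_counit_tpi -flat_pre -flat_post fp_liftE.
Qed.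

Fact fp_counit_univ X A (h : hom (Fn X) A) :
  exists! g : hom X (P A), fp_counit_map A ∘ fmap Fn g = h.
Proof.
have key (g : hom X (P A)) i :
    fp_counit_map A ∘ fmap Fn g ∘ tpi i X = flat a (fp_proj (P A) i ∘ g).
  by rewrite -compA naturality compA fp_counit_tpi -flat_pre.
have [|g [ge gu]] := (fp_univ (P A)).2 X (fun i => sharp a (h ∘ tpi i X)).
  by move=> i j; rewrite !tpE !sharpK -!compA (tpi_tp i j).
exists g; split=> [|k ke]; first by apply: tpi_ext => i; rewrite key ge sharpK.
by apply: gu => i; apply: (flat_inj (a := a)); rewrite -key ke sharpK.
Qed.

(** Fn X is the n-fold pushout of tp, so an arrow out of it is a compatible
    n-tuple of arrows out of F X; these transpose to compatible n-tuples of
    arrows into T A, that is to arrows into the fiber power. *)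
Definition fp_adj : adjunction Fn (fiber_powerF P) :=
  @adj_of_univ C C Fn (fiber_powerF P)
    (@NatTrans C C (compF Fn (fiber_powerF P)) (idF C) _ fp_counit_natural)
    fp_counit_univ.

Lemma flat_fp_adj X A (g : hom X (P A)) i :
  flat fp_adj g ∘ tpi i X = flat a (fp_proj (P A) i ∘ g).
Proof.
by rewrite /flat /= -compA naturality compA fp_counit_tpi -flat_pre.
Qed.

Lemma mate_fp_proj A i :
  fp_proj (P A) i = mate fp_adj a (tpi i) A.
Proof.
apply: (flat_inj (a := a)); rewrite -[mate _ _ _ _]comp_idr flat_mate.
by rewrite flat_fp_adj comp_idr.
Qed.

End FiberPowerAdjunction.

(** * Elements of tensor products and of dual-number algebras *)

Section TensorElements.
Variables (R : comPzRingType) (A B : calg R).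

Lemma tensNl (a : A) (b : B) : tens (- a) b = - tens a b.
Proof. by apply: (addIr (tens a b)); rewrite -tensDl !addNr tens0l. Qed.

Lemma tens0r (a : A) : tens a (0 : B) = 0.
Proof. by apply: (addIr (tens a 0)); rewrite -tensDr !add0r. Qed.

Lemma tensBl (a a' : A) (b : B) : tens (a - a') b = tens a b - tens a' b.
Proof. by rewrite tensDl tensNl. Qed.

Lemma tensNr (a : A) (b : B) : tens a (- b) = - tens a b.
Proof. by apply: (addIr (tens a b)); rewrite -tensDr !addNr tens0r. Qed.

Lemma tensBr (a : A) (b b' : B) : tens a (b - b') = tens a b - tens a b'.
Proof. by rewrite tensDr tensNr. Qed.

Lemma tens_suml I (r : seq I) (f : I -> A) (b : B) :
  tens (\sum_(i <- r) f i) b = \sum_(i <- r) tens (f i) b.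
Proof.
elim: r => [|i r IH]; first by rewrite !big_nil tens0l.
by rewrite !big_cons tensDl IH.
Qed.

Lemma tens_split (a : A) (b : B) : tens a b = tens a 1 * tens 1 b.
Proof. by rewrite -tensM mulr1 mul1r. Qed.

Lemma tens_span (x : tensor A B) :
  exists s : seq (A * B), x = \sum_(u <- s) tens u.1 u.2.
Proof.
elim/pres_ind: x; elim=> [r|[a b]|x [s es] y [t et]|x [s es]|x [s es] y [t et]].
- exists [:: (calg_str A r, 1)]; rewrite big_seq1 /=.
  by rewrite -[RHS]/(tens (calg_str A r) 1) inl_str.
- by exists [:: (a, b)]; rewrite big_seq1.
- by exists (s ++ t); rewrite pres_classD es et big_cat.
- exists [seq (- u.1, u.2) | u <- s]; rewrite pres_classN es big_map -sumrN.
  by apply: eq_bigr => u _; rewrite tensNl.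
- exists [seq (u.1 * v.1, u.2 * v.2) | u <- s, v <- t].
  rewrite pres_classM es et big_allpairs_dep mulr_suml; apply: eq_bigr => u _.
  by rewrite mulr_sumr; apply: eq_bigr => v _; rewrite tensM.
Qed.

Lemma tens_ext (S : calg R) (f g : calg_hom (tensor A B) S) :
  (forall a, f (tens a 1) = g (tens a 1)) ->
  (forall b, f (tens 1 b) = g (tens 1 b)) -> f = g.
Proof.
by move=> ea eb; apply: tensor_ext => a b; rewrite tens_split !rmorphM ea eb.
Qed.

End TensorElements.

Section TensorMaps.
Variables (R : comPzRingType).

Definition tmap (A A' B B' : calg R) (f : calg_hom A A') (g : calg_hom B B') :
    calg_hom (tensor A B) (tensor A' B') :=
  copair (calg_comp (tens_inl A' B') f) (calg_comp (tens_inr A' B') g).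

Lemma tmapE A A' B B' (f : calg_hom A A') (g : calg_hom B B') a b :
  tmap f g (tens a b) = tens (f a) (g b).
Proof. by rewrite copairE /= -[LHS]tensM mulr1 mul1r. Qed.

Definition tswap (A B : calg R) : calg_hom (tensor A B) (tensor B A) :=
  copair (tens_inr B A) (tens_inl B A).

Lemma tswapE (A B : calg R) (a : A) (b : B) : tswap A B (tens a b) = tens b a.
Proof. by rewrite copairE /= -[LHS]tensM mulr1 mul1r. Qed.

Lemma tswapK (A B : calg R) (x : tensor A B) : tswap B A (tswap A B x) = x.
Proof.
suff e : calg_comp (tswap B A) (tswap A B) = calg_id _.
  by rewrite -[RHS]/(calg_id _ x) -e.
by apply: tensor_ext => a b; rewrite /= [X in tswap B A X]tswapE tswapE.
Qed.

Definition tshuffle (A B S : calg R) :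
    calg_hom (tensor A (tensor B S)) (tensor B (tensor A S)) :=
  copair (calg_comp (tens_inr B (tensor A S)) (tens_inl A S))
    (tmap (calg_id B) (tens_inr A S)).

Lemma tshuffleE (A B S : calg R) (a : A) (b : B) (s : S) :
  tshuffle A B S (tens a (tens b s)) = tens b (tens a s).
Proof.
rewrite copairE tmapE -[LHS]/(tens 1 (tens a 1) * tens b (tens 1 s)).
by rewrite -!tensM mul1r mulr1 mul1r.
Qed.

Definition tunit (A : calg R) : calg_hom (tensor A (base_alg R)) A :=
  copair (calg_id A) (str_hom A).

Lemma tunitE (A : calg R) (a : A) (r : base_alg R) : tunit A (tens a r) = calg_str A r * a.
Proof. by rewrite copairE mulrC. Qed.

Lemma tunitK (A : calg R) (x : tensor A (base_alg R)) : tens (tunit A x) 1 = x.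
Proof.
have [s ->] := tens_span x.
rewrite (big_morph _ (rmorphD (tunit A)) (rmorph0 _)) tens_suml.
apply: eq_bigr => u _.
by rewrite tunitE tensZl -tensZr mulr1.
Qed.

Lemma tens1_inj (A : calg R) (a a' : A) :
  tens a (1 : base_alg R) = tens a' 1 -> a = a'.
Proof. by move/(congr1 (tunit A)); rewrite !tunitE rmorph1 !mul1r. Qed.

End TensorMaps.

(** The square-zero extension of S by S^n. Mapping the presented algebra
    R[eps_1, .., eps_n] (x) S to it separates elements by their coefficients. *)
Section SquareZero.
Variables (S : comPzRingType) (n : nat).

Definition sqz : Type := (S * {ffun 'I_n -> S})%type.
HB.instance Definition _ := GRing.Zmodule.on sqz.

Definition sqz_one : sqz := (1, 0).
Definition sqz_mul (x y : sqz) : sqz :=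
  (x.1 * y.1, [ffun i => x.1 * y.2 i + y.1 * x.2 i]).

Fact sqz_mulA : associative sqz_mul.
Proof.
move=> x y z; congr pair; first exact: mulrA.
apply/ffunP => i; rewrite !ffunE /= !mulrDr -!addrA.
congr (_ + _); [exact: mulrA | congr (_ + _); first exact: mulrCA].
by rewrite [X in X * _]mulrC -mulrA.
Qed.

Fact sqz_mulC : commutative sqz_mul.
Proof.
move=> x y; congr pair; first exact: mulrC.
by apply/ffunP => i; rewrite !ffunE addrC.
Qed.

Fact sqz_mul1 : left_id sqz_one sqz_mul.
Proof.
case=> x f; congr pair; first exact: mul1r.
by apply/ffunP => i; rewrite !ffunE mul1r mulr0 addr0.
Qed.

Fact sqz_mulD : left_distributive sqz_mul +%R.
Proof.
move=> x y z; congr pair; first exact: mulrDl.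
by apply/ffunP => i; rewrite !ffunE mulrDl mulrDr addrACA.
Qed.

HB.instance Definition _ :=
  GRing.Zmodule_isComPzRing.Build sqz sqz_mulA sqz_mulC sqz_mul1 sqz_mulD.

Definition sqz_cst (s : S) : sqz := (s, 0).

Fact sqz_cst_nmod : nmod_morphism sqz_cst.
Proof. by split=> // s t; congr pair; rewrite addr0. Qed.
Fact sqz_cst_monoid : monoid_morphism sqz_cst.
Proof.
split=> // s t; congr pair; apply/ffunP => i.
by rewrite !ffunE !mulr0 addr0.
Qed.
HB.instance Definition _ := GRing.isNmodMorphism.Build S sqz sqz_cst sqz_cst_nmod.
HB.instance Definition _ :=
  GRing.isMonoidMorphism.Build S sqz sqz_cst sqz_cst_monoid.

End SquareZero.

Section DualTensor.
Variables (R : comPzRingType) (n : nat).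

Lemma dual_ext (S : calg R) (f g : calg_hom (dual R n) S) :
  (forall i, f (dual_gen R i) = g (dual_gen R i)) -> f = g.
Proof.
move=> e; apply/calg_hom_ext/pres_ext => [a|i]; last exact: e.
by rewrite -[pres_cst _ a]/(calg_str (dual R n) a) !chom_str.
Qed.

Lemma dual_span (x : dual R n) : exists (r : R) (f : 'I_n -> R),
  x = calg_str (dual R n) r
      + \sum_i calg_str (dual R n) (f i) * dual_gen R i.
Proof.
elim/pres_ind: x; elim=> [r|j|x [r [f ex]] y [s [g ey]]|x [r [f ex]]
    |x [r [f ex]] y [s [g ey]]].
- exists r, (fun=> 0); rewrite big1 ?addr0 // => i _.
  by rewrite rmorph0 mul0r.
- exists 0, (fun i => (i == j)%:R); rewrite rmorph0 add0r (bigD1 j) //=.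
  rewrite eqxx rmorph1 mul1r big1 ?addr0 // => i /negbTE->.
  by rewrite rmorph0 mul0r.
- exists (r + s), (fun i => f i + g i); rewrite pres_classD ex ey rmorphD.
  rewrite addrACA -big_split; congr (_ + _); apply: eq_bigr => i _.
  by rewrite rmorphD mulrDl.
- exists (- r), (fun i => - f i); rewrite pres_classN ex rmorphN opprD -sumrN.
  by congr (_ + _); apply: eq_bigr => i _; rewrite rmorphN mulNr.
- exists (r * s), (fun i => r * g i + s * f i); rewrite pres_classM ex ey.
  rewrite mulrDl !mulrDr -addrA -rmorphM; congr (_ + _).
  set u := (X in _ + X); have -> : u = \sum_i calg_str (dual R n) (s * f i) * dual_gen R i.
    rewrite /u [X in _ + X]mulr_suml [X in _ + X]big1 ?addr0 => [|i _].
      by rewrite mulrC mulr_sumr; apply: eq_bigr => i _; rewrite rmorphM mulrA.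
    rewrite mulr_sumr big1 // => j _.
    by rewrite mulrACA dual_gen_mul mulr0.
  rewrite mulr_sumr -big_split; apply: eq_bigr => i _.
  by rewrite rmorphD mulrDl !rmorphM mulrA.
Qed.

Section Coefficients.
Variable S : calg R.

Definition sqz_alg : calg R := @CAlg R (sqz S n) (@sqz_cst S n \o calg_str S).

Definition sqz_gen (s : S) (i : 'I_n) : sqz_alg := (0, [ffun j => s *+ (j == i)]).

Fact sqz_gen_mul i j : sqz_gen 1 i * sqz_gen 1 j = 0.
Proof.
by congr pair; rewrite /= ?mulr0 //; apply/ffunP => k; rewrite !ffunE !mul0r addr0.
Qed.

Fact sqz_cst_str r : @sqz_cst S n (calg_str S r) = calg_str sqz_alg r.
Proof. by []. Qed.

Definition to_sqz : calg_hom (tensor (dual R n) S) sqz_alg :=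
  copair (dual_hom sqz_gen_mul) (@CAlgHom R S sqz_alg (@sqz_cst S n) sqz_cst_str).

Definition cst_coef (x : tensor (dual R n) S) : S := (to_sqz x : sqz S n).1.
Definition gen_coef (i : 'I_n) (x : tensor (dual R n) S) : S :=
  (to_sqz x : sqz S n).2 i.

Lemma to_sqz_cst s : to_sqz (tens 1 s) = (s, 0) :> sqz S n.
Proof. by rewrite copairE rmorph1 mul1r. Qed.

Lemma to_sqz_gen i s : to_sqz (tens (dual_gen R i) s) = sqz_gen s i.
Proof.
rewrite copairE dual_homE; congr pair; rewrite /= ?mul0r //.
by apply/ffunP => j; rewrite !ffunE mul0r add0r mulr_natr.
Qed.

Lemma cst_coefD x y : cst_coef (x + y) = cst_coef x + cst_coef y.
Proof. by rewrite /cst_coef rmorphD. Qed.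

Lemma gen_coefD i x y : gen_coef i (x + y) = gen_coef i x + gen_coef i y.
Proof. by rewrite /gen_coef rmorphD /= ffunE. Qed.

Lemma cst_coef_cst s : cst_coef (tens 1 s) = s.
Proof. by rewrite /cst_coef to_sqz_cst. Qed.

Lemma gen_coef_cst i s : gen_coef i (tens 1 s) = 0.
Proof. by rewrite /gen_coef to_sqz_cst /= ffunE. Qed.

Lemma cst_coef_gen i s : cst_coef (tens (dual_gen R i) s) = 0.
Proof. by rewrite /cst_coef to_sqz_gen. Qed.

Lemma gen_coef_gen i j s :
  gen_coef j (tens (dual_gen R i) s) = s *+ (j == i).
Proof. by rewrite /gen_coef to_sqz_gen /= ffunE. Qed.

Lemma cst_coef0 : cst_coef 0 = 0.
Proof. by rewrite /cst_coef rmorph0. Qed.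

Lemma gen_coef0 i : gen_coef i 0 = 0.
Proof. by rewrite /gen_coef rmorph0 /= ffunE. Qed.

Lemma gen_coef_sum j (f : 'I_n -> S) :
  gen_coef j (\sum_i tens (dual_gen R i) (f i)) = f j.
Proof.
rewrite (big_morph _ (gen_coefD j) (gen_coef0 j)) (bigD1 j) //=.
rewrite gen_coef_gen eqxx mulr1n big1 ?addr0 // => i /negbTE ne.
by rewrite gen_coef_gen eq_sym ne.
Qed.

Lemma cst_coef_sum (f : 'I_n -> S) :
  cst_coef (\sum_i tens (dual_gen R i) (f i)) = 0.
Proof.
rewrite (big_morph _ cst_coefD cst_coef0) big1 // => i _.
exact: cst_coef_gen.
Qed.

Lemma dual_tensor_coef x :
  x = tens 1 (cst_coef x) + \sum_i tens (dual_gen R i) (gen_coef i x).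
Proof.
suff [s [f ->]] : exists s (f : 'I_n -> S),
    x = tens 1 s + \sum_i tens (dual_gen R i) (f i).
  rewrite cst_coefD cst_coef_cst cst_coef_sum addr0; congr (_ + _).
  apply: eq_bigr => i _.
  by rewrite gen_coefD gen_coef_cst gen_coef_sum add0r.
have [u ->] := tens_span x; elim: u => [|[d s] u [t [g IH]]].
  by exists 0, (fun=> 0); rewrite big_nil tens0r big1 ?addr0 // => i _; rewrite tens0r.
rewrite big_cons /= {}IH; have [r [f ->]] := dual_span d.
exists (calg_str S r * s + t), (fun i => calg_str S (f i) * s + g i).
rewrite tensDl addrACA tensDr; congr (_ + _ + _).
  by rewrite tensZr -tensZl mulr1.
rewrite tens_suml -big_split; apply: eq_bigr => i _.
by rewrite tensZl -tensZr tensDr.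
Qed.

End Coefficients.

End DualTensor.

(** * The transformations of affine schemes induced by the dual numbers *)

Section AffineArrows.
Variable R : comPzRingType.
Local Notation P := (aff_products R).
Local Notation E := (prod_functor P (Reps R)).

(** Pullback of functions along a morphism of affine schemes. *)
Definition ap (X Y : Aff R) (g : hom X Y) :
  {rmorphism calg_ring Y -> calg_ring X} := (g : calg_hom Y X).

Lemma ap_comp (X Y Z : Aff R) (g : hom Y Z) (f : hom X Y) z :
  ap (g ∘ f) z = ap f (ap g z).
Proof. by []. Qed.

Lemma ap_id (X : Aff R) x : ap (idm X) x = x.
Proof. by []. Qed.

Lemma ap_str (X Y : Aff R) (g : hom X Y) r :
  ap g (calg_str Y r) = calg_str X r.
Proof. exact: (chom_str (g : calg_hom Y X)). Qed.

Lemma ap_ext (X Y : Aff R) (g g' : hom X Y) : ap g =1 ap g' -> g = g'.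
Proof. exact: (@calg_hom_ext R Y X). Qed.

Lemma ap_prod_map (A A' B B' : Aff R) (f : hom A' A) (g : hom B' B) a b :
  ap (prod_map P f g) (tens a b) = tens (ap f a) (ap g b).
Proof. exact: (@tmapE R A A' B B' f g). Qed.

Lemma ap_prodF (D X Y : Aff R) (f : hom X Y) d y :
  ap (fmap (prod_functor P D) f) (tens d y) = tens d (ap f y).
Proof. exact: ap_prod_map. Qed.

Lemma prodF_ext (D X S : Aff R) (f g : hom S (prod_functor P D X)) :
  (forall d, ap f (tens d 1) = ap g (tens d 1)) ->
  (forall x, ap f (tens 1 x) = ap g (tens 1 x)) -> f = g.
Proof. exact: (@tens_ext R D X S). Qed.

Lemma dualF_ext n (X S : Aff R) (f g : hom S (prod_functor P (dual R n) X)) :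
  (forall i, ap f (tens (dual_gen R i) 1) = ap g (tens (dual_gen R i) 1)) ->
  (forall x, ap f (tens 1 x) = ap g (tens 1 x)) -> f = g.
Proof.
move=> eg ex; apply: prodF_ext => // d.
suff e : calg_comp (f : calg_hom _ S) (tens_inl (dual R n) X)
    = calg_comp (g : calg_hom _ S) (tens_inl (dual R n) X).
  by rewrite -[LHS]/(calg_comp (f : calg_hom _ S) (tens_inl (dual R n) X) d) e.
by apply: dual_ext => i; apply: eg.
Qed.

Lemma RepsF_ext (X S : Aff R) (f g : hom S (E X)) :
  ap f (tens (eps R) 1) = ap g (tens (eps R) 1) ->
  (forall x, ap f (tens 1 x) = ap g (tens 1 x)) -> f = g.
Proof. by move=> eg ex; apply: dualF_ext => // i; rewrite (ord1 i). Qed.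

Lemma RepsF2_ext (X S : Aff R) (f g : hom S (E (E X))) :
  ap f (tens (eps R) (tens 1 1)) = ap g (tens (eps R) (tens 1 1)) ->
  ap f (tens 1 (tens (eps R) 1)) = ap g (tens 1 (tens (eps R) 1)) ->
  (forall x, ap f (tens 1 (tens 1 x)) = ap g (tens 1 (tens 1 x))) -> f = g.
Proof.
rewrite tens11 => e1 e2 ex; apply: RepsF_ext => // y.
have e : pr2 P (Reps R) (E X) ∘ f = pr2 P (Reps R) (E X) ∘ g by apply: RepsF_ext.
by rewrite -[LHS]/(ap (pr2 P (Reps R) (E X) ∘ f) y) e.
Qed.

Lemma RepsF3_ext (X S : Aff R) (f g : hom S (E (E (E X)))) :
  ap f (tens (eps R) (tens 1 (tens 1 1)))
    = ap g (tens (eps R) (tens 1 (tens 1 1))) ->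
  ap f (tens 1 (tens (eps R) (tens 1 1)))
    = ap g (tens 1 (tens (eps R) (tens 1 1))) ->
  ap f (tens 1 (tens 1 (tens (eps R) 1)))
    = ap g (tens 1 (tens 1 (tens (eps R) 1))) ->
  (forall x, ap f (tens 1 (tens 1 (tens 1 x)))
    = ap g (tens 1 (tens 1 (tens 1 x)))) -> f = g.
Proof.
move=> e1 e2 e3 ex; apply: RepsF_ext => [|y]; first by rewrite -!tens11.
have e : pr2 P (Reps R) (E (E X)) ∘ f = pr2 P (Reps R) (E (E X)) ∘ g.
  exact: RepsF2_ext.
by rewrite -[LHS]/(ap (pr2 P (Reps R) (E (E X)) ∘ f) y) e.
Qed.

End AffineArrows.

(* The pattern is matched syntactically, so that the transformations below, some
   of which are composites themselves, are not unfolded. *)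
Ltac ap_comps := repeat match goal with
  | |- context [ap (?g ∘ ?f)] => rewrite (ap_comp g f) end.

Section AffineTransformations.
Variable R : comPzRingType.
Local Notation P := (aff_products R).
Local Notation E := (prod_functor P (Reps R)).

Lemma tau_pE (X : calg R) d (x : X) :
  ap (tau_p X) (tens d x)
  = calg_str X (dual_p R d) * x.
Proof.
rewrite -[LHS]/(copair (str_hom X) (calg_id X) (tmap (dual_p R) (calg_id X) (tens d x))).
by rewrite tmapE copairE.
Qed.

Lemma tau_zE (X : calg R) (x : X) :
  ap (tau_z X) x = tens 1 x.
Proof.
rewrite -[LHS]/(tmap (dual_z R) (calg_id X) (tens 1 x)).
by rewrite tmapE rmorph1.
Qed.

Lemma tau_sE (X : calg R) d (x : X) :
  ap (tau_s X) (tens d x)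
  = tens (dual_s R d) x.
Proof. exact: tmapE. Qed.

Lemma tau_piE k (X : calg R) d (x : X) :
  ap (tau_pi k X) (tens d x)
  = tens (dual_pi R k d) x.
Proof. exact: tmapE. Qed.

Let assoc (X : calg R) : calg_hom (tensor (tensor (Reps R) (Reps R)) X)
    (tensor (Reps R) (tensor (Reps R) X)) :=
  associator_inv P (Reps R) (Reps R) X.
Let assocE (X : calg R) d d' (x : X) :
  assoc X (tens (tens d d') x) = tens d (tens d' x).
Proof.
rewrite -[LHS]/(copair (copair (tens_inl (Reps R) (tensor (Reps R) X))
    (calg_comp (tens_inr (Reps R) _) (tens_inl (Reps R) X)))
  (calg_comp (tens_inr _ _) (tens_inr (Reps R) X)) (tens (tens d d') x)).
rewrite !copairE.
rewrite -[LHS]/(tens d 1 * tens 1 (tens d' 1) * tens 1 (tens 1 x)).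
by rewrite -!tensM !mulr1 mul1r -tensM mulr1 mul1r.
Qed.

Lemma tau_l_eps (X : calg R) (x : X) :
  ap (tau_l X) (tens (eps R) x) = tens (eps R) (tens (eps R) x).
Proof.
rewrite -[LHS]/(assoc X (tmap (dual_l R) (calg_id X) (tens (eps R) x))).
by rewrite tmapE dual_homE assocE.
Qed.

Lemma tau_l_cst (X : calg R) (x : X) :
  ap (tau_l X) (tens 1 x) = tens 1 (tens 1 x).
Proof.
rewrite -[LHS]/(assoc X (tmap (dual_l R) (calg_id X) (tens 1 x))).
by rewrite tmapE rmorph1 -[X in tens X _]tens11 assocE.
Qed.

Lemma tau_cE (X : calg R) d d' (x : X) :
  ap (tau_c X) (tens d (tens d' x)) = tens d' (tens d x).
Proof.
rewrite -[LHS]/(assoc X (tmap (dual_c R) (calg_id X)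
  (copair (calg_comp (tens_inl _ X) (tens_inl (Reps R) (Reps R)))
     (copair (calg_comp (tens_inl _ X) (tens_inr (Reps R) (Reps R)))
        (tens_inr _ X)) (tens d (tens d' x))))).
rewrite !copairE.
rewrite -[X in tmap _ _ X]/(tens (tens d 1) 1 * (tens (tens 1 d') 1 * tens 1 x)).
rewrite -!tensM mulr1 !mul1r -tensM mulr1 mul1r tmapE.
rewrite -[dual_c R]/(tswap (Reps R) (Reps R)) tswapE.
exact: assocE.
Qed.

Lemma tau_p_eps (X : calg R) (x : X) : ap (tau_p X) (tens (eps R) x) = 0.
Proof. by rewrite tau_pE dual_homE rmorph0 mul0r. Qed.

Lemma tau_p_cst (X : calg R) (x : X) : ap (tau_p X) (tens 1 x) = x.
Proof. by rewrite tau_pE !rmorph1 mul1r. Qed.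

Lemma tau_s_gen (X : calg R) i (x : X) :
  ap (tau_s X) (tens (dual_gen R i) x) = tens (eps R) x.
Proof. by rewrite tau_sE dual_homE. Qed.

Lemma tau_s_cst (X : calg R) (x : X) : ap (tau_s X) (tens 1 x) = tens 1 x.
Proof. by rewrite tau_sE rmorph1. Qed.

Definition tauE :=
  (tau_p_eps, tau_p_cst, tau_zE, tau_s_gen, tau_s_cst, tau_l_eps, tau_l_cst,
   tau_cE, ap_prodF, ap_id, rmorph1).

Section Naturality.
Variables (X Y : Aff R) (f : hom X Y).

Fact tau_p_natural : fmap E f ∘ tau_p X = tau_p Y ∘ fmap (idF (Aff R)) f.
Proof. by apply: RepsF_ext => [|x]; ap_comps; rewrite !tauE ?rmorph0. Qed.

Fact tau_z_natural : fmap (idF (Aff R)) f ∘ tau_z X = tau_z Y ∘ fmap E f.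
Proof. by apply: ap_ext => x; ap_comps; rewrite !tauE. Qed.

Fact tau_s_natural :
  fmap (prod_functor P (dual R 2)) f ∘ tau_s X = tau_s Y ∘ fmap E f.
Proof. by apply: dualF_ext => [i|x]; ap_comps; rewrite !tauE. Qed.

Fact tau_l_natural : fmap E f ∘ tau_l X = tau_l Y ∘ fmap (compF E E) f.
Proof. by apply: RepsF_ext => [|x]; ap_comps; rewrite !tauE. Qed.

Fact tau_c_natural :
  fmap (compF E E) f ∘ tau_c X = tau_c Y ∘ fmap (compF E E) f.
Proof. by apply: RepsF2_ext => [||x]; ap_comps; rewrite !tauE. Qed.
End Naturality.

Section Laws.
Variable X : Aff R.

Lemma tau_z_p : tau_z X ∘ tau_p X = idm X.
Proof. by apply: ap_ext => x; ap_comps; rewrite !tauE. Qed.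

Lemma tau_l_p : tau_l X ∘ tau_p (E X) = tau_p X ∘ tau_z X.
Proof. by apply: RepsF_ext => [|x]; ap_comps; rewrite !tauE ?tens0r. Qed.

Lemma tau_z_l : tau_z X ∘ tau_l X = tau_z X ∘ tau_z (E X).
Proof. by apply: ap_ext => x; ap_comps; rewrite !tauE. Qed.

Lemma tau_c_p : tau_c X ∘ tau_p (E X) = fmap E (tau_p X).
Proof. by apply: RepsF2_ext => [||x]; ap_comps; rewrite !tauE ?tens0r. Qed.

Lemma tau_z_c : fmap E (tau_z X) ∘ tau_c X = tau_z (E X).
Proof. by apply: RepsF_ext => [|x]; ap_comps; rewrite !tauE. Qed.

Lemma tau_l_l : tau_l X ∘ tau_l (E X) = tau_l X ∘ fmap E (tau_l X).
Proof. by apply: RepsF_ext => [|x]; ap_comps; rewrite !tauE. Qed.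

Lemma tau_c_c : tau_c X ∘ tau_c X = idm (E (E X)).
Proof. by apply: RepsF2_ext => [||x]; ap_comps; rewrite !tauE. Qed.

Lemma tau_c_c_c :
  tau_c (E X) ∘ fmap E (tau_c X) ∘ tau_c (E X)
  = fmap E (tau_c X) ∘ tau_c (E X) ∘ fmap E (tau_c X).
Proof. by apply: RepsF3_ext => [|||x]; ap_comps; rewrite !tauE. Qed.

Lemma tau_l_c : tau_l X ∘ tau_c X = tau_l X.
Proof. by apply: RepsF_ext => [|x]; ap_comps; rewrite !tauE. Qed.

Lemma tau_l_c_c :
  fmap E (tau_l X) ∘ tau_c (E X) ∘ fmap E (tau_c X) = tau_c X ∘ tau_l (E X).
Proof. by apply: RepsF2_ext => [||x]; ap_comps; rewrite !tauE. Qed.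

End Laws.

End AffineTransformations.

(** * Fiber powers, and the adjunction of Kaehler differentials *)

Section JointLift.
Variables (R : comPzRingType) (I : Type) (A B : calg R) (S : I -> calg R).
Variables (q : forall i, calg_hom B (S i)) (h : forall i, calg_hom A (S i)).
Hypothesis q_inj : forall b b', (forall i, q i b = q i b') -> b = b'.
Hypothesis q_onto : forall a, exists b, forall i, q i b = h i a.

Let lift a : B := sval (cid (q_onto a)).
Let liftE i a : q i (lift a) = h i a.
Proof. by rewrite /lift; case: cid => b /= ->. Qed.

Fact joint_lift_nmod : nmod_morphism lift.
Proof.
by split=> [|a a']; apply: q_inj => i; rewrite ?rmorphD !liftE ?rmorph0 ?rmorphD.
Qed.

Fact joint_lift_monoid : monoid_morphism lift.
Proof.
by split=> [|a a']; apply: q_inj => i; rewrite ?rmorphM !liftE ?rmorph1 ?rmorphM.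
Qed.

HB.instance Definition _ := GRing.isNmodMorphism.Build A B lift joint_lift_nmod.
HB.instance Definition _ := GRing.isMonoidMorphism.Build A B lift joint_lift_monoid.

Fact joint_lift_str r : lift (calg_str A r) = calg_str B r.
Proof. by apply: q_inj => i; rewrite liftE !chom_str. Qed.

(** A pointwise lift along a jointly injective family of homomorphisms is a
    homomorphism, since its values are determined by the family. *)
Lemma joint_lift : exists k : calg_hom A B, forall i, calg_comp (q i) k = h i.
Proof.
exists (@CAlgHom R A B lift joint_lift_str) => i; apply: calg_hom_ext => a.
exact: liftE.
Qed.
End JointLift.

Section DualPowers.
Variable R : comPzRingType.
Local Notation P := (aff_products R).
Local Notation E := (prod_functor P (Reps R)).
Variable n : nat.
Local Notation En := (prod_functor P (dual R n)).

Fact dual_proj_mul0 (k i j : 'I_n) :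
  (if i == k then eps R else 0) * (if j == k then eps R else 0) = 0.
Proof. by case: ifP => _; case: ifP => _; rewrite ?(mulr0, mul0r) ?dual_gen_mul. Qed.

Definition dual_proj (k : 'I_n) : calg_hom (dual R n) (Reps R) :=
  dual_hom (dual_proj_mul0 k).

Definition tau_proj_map (k : 'I_n) (X : Aff R) : hom (E X) (En X) :=
  prod_map P (dual_proj k : @hom (Aff R) (Reps R) (dual R n)) (idm X).

Lemma tau_proj_cst k (X : calg R) (x : X) :
  ap (tau_proj_map k X) (tens 1 x) = tens 1 x.
Proof. by rewrite ap_prod_map rmorph1. Qed.

Lemma tau_proj_gen k i (X : calg R) (x : X) :
  ap (tau_proj_map k X) (tens (dual_gen R i) x)
  = if i == k then tens (eps R) x else 0.
Proof.
rewrite ap_prod_map [X in tens X]dual_homE.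
by case: ifP => _ //; rewrite tens0l.
Qed.

Fact tau_proj_natural k (X Y : Aff R) (f : hom X Y) :
  fmap En f ∘ tau_proj_map k X = tau_proj_map k Y ∘ fmap E f.
Proof.
apply: dualF_ext => [i|x]; ap_comps; rewrite !(tau_proj_gen, tau_proj_cst, ap_prodF) //.
by case: ifP; rewrite ?ap_prodF ?rmorph0.
Qed.

Definition tau_proj (k : 'I_n) : nat_trans E En := NatTrans (@tau_proj_natural k).

Lemma tau_projE k (X : calg R) (x : tensor (dual R n) X) :
  ap (tau_proj k X) x = tens 1 (cst_coef x) + tens (eps R) (gen_coef k x).
Proof.
rewrite {1}[x]dual_tensor_coef rmorphD [X in X + _]tau_proj_cst rmorph_sum.
rewrite (bigD1 k) //= [X in _ + (X + _)]tau_proj_gen eqxx big1 ?addr0 // => i /negbTE ne.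
by rewrite [LHS]tau_proj_gen ne.
Qed.

Lemma tau_proj_p i j (X : Aff R) :
  tau_proj i X ∘ tau_p X = tau_proj j X ∘ tau_p X.
Proof.
apply: ap_ext => x; ap_comps; rewrite !tau_projE !rmorphD.
by rewrite !tau_p_cst !tau_p_eps.
Qed.

Lemma tau_p_coef (X : calg R) (x : tensor (Reps R) X) :
  ap (tau_p X) x = cst_coef x.
Proof.
rewrite {1}[x]dual_tensor_coef big_ord1 rmorphD.
by rewrite [X in X + _]tau_p_cst [X in _ + X]tau_p_eps addr0.
Qed.

Lemma Reps_coef (X : calg R) (x : tensor (Reps R) X) :
  x = tens 1 (ap (tau_p X) x) + tens (eps R) (gen_coef ord0 x).
Proof. by rewrite {1}[x]dual_tensor_coef big_ord1 tau_p_coef. Qed.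

Lemma Reps_coef_inj (X : calg R) (x y : tensor (Reps R) X) :
  ap (tau_p X) x = ap (tau_p X) y -> gen_coef ord0 x = gen_coef ord0 y -> x = y.
Proof. by move=> e1 e2; rewrite [x]Reps_coef [y]Reps_coef e1 e2. Qed.

Hypothesis n_gt0 : (0 < n)%N.

(** R[eps_1, .., eps_n] (x) X is the n-fold fiber power of X[eps] -> X: an
    element is a common constant term with n independent coefficients. *)
Lemma tau_proj_univ (X A : Aff R) (h : 'I_n -> hom (E X) A) :
  (forall i j, h i ∘ tau_p X = h j ∘ tau_p X) ->
  exists! k : hom (En X) A, forall i, k ∘ tau_proj i X = h i.
Proof.
move=> h_p; pose i0 := Ordinal n_gt0.
have inj (x y : tensor (dual R n) X) :
    (forall i, ap (tau_proj i X) x = ap (tau_proj i X) y) -> x = y.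
  move=> e; rewrite [x]dual_tensor_coef [y]dual_tensor_coef.
  have := e i0; rewrite !tau_projE => /(congr1 (@cst_coef R 1 X)).
  rewrite !cst_coefD !cst_coef_cst !cst_coef_gen !addr0 => ->.
  congr (_ + _); apply: eq_bigr => i _; congr tens.
  have := e i; rewrite !tau_projE => /(congr1 (@gen_coef R 1 X ord0)).
  by rewrite !gen_coefD !gen_coef_cst !gen_coef_gen !add0r !mulr1n.
have [a|k ke] := @joint_lift R 'I_n A (tensor (dual R n) X) (fun=> tensor (Reps R) X)
    (fun i => tau_proj i X) h inj.
  exists (tens 1 (ap (tau_p X) (ap (h i0) a))
          + \sum_i tens (dual_gen R i) (gen_coef ord0 (ap (h i) a))) => i.
  rewrite -[LHS]/(ap (tau_proj i X) _) tau_projE.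
  rewrite cst_coefD cst_coef_cst cst_coef_sum addr0.
  rewrite gen_coefD gen_coef_cst gen_coef_sum add0r.
  apply: Reps_coef_inj.
    rewrite rmorphD [X in X + _]tau_p_cst [X in _ + X]tau_p_eps addr0.
    by rewrite -!ap_comp (h_p i0 i).
  by rewrite gen_coefD gen_coef_cst [X in _ + X]gen_coef_gen add0r mulr1n.
exists k; split=> [|k' k'e]; first exact: ke.
by apply: ap_ext => a; apply: inj => i; rewrite -!ap_comp k'e -(ke i).
Qed.

End DualPowers.

Section AffineFiberPowers.
Variables (R : comPzRingType) (n : nat) (A E : calg R) (f : calg_hom A E).

Notation g k x := (AGen (k, x) : aexpr R ('I_n * E)).

Inductive pushout_rel : aexpr R ('I_n * E) -> aexpr R ('I_n * E) -> Prop :=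
  | pushoutD k x y : pushout_rel (g k (x + y)) (AAdd (g k x) (g k y))
  | pushoutM k x y : pushout_rel (g k (x * y)) (AMul (g k x) (g k y))
  | pushout_str k r : pushout_rel (g k (calg_str E r)) (ACst r)
  | pushout_glue i j a : pushout_rel (g i (f a)) (g j (f a)).

Definition pushout : calg R := pres_alg pushout_rel.
Definition pushout_in (k : 'I_n) (x : E) : pushout := pres_gen pushout_rel (k, x).

Let rel_eq x y (h : pushout_rel x y) :
  pres_class pushout_rel x = pres_class pushout_rel y.
Proof. exact/pres_eqP/acongr_rel. Qed.

Fact pushout_in_str k r : pushout_in k (calg_str E r) = calg_str pushout r.
Proof. by apply: rel_eq; constructor. Qed.

Fact pushout_in_nmod k : nmod_morphism (pushout_in k).
Proof.
split=> [|x y]; last by rewrite -pres_classD; apply: rel_eq; constructor.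
by rewrite -(rmorph0 (calg_str E)) pushout_in_str rmorph0.
Qed.

Fact pushout_in_monoid k : monoid_morphism (pushout_in k).
Proof.
split=> [|x y]; last by rewrite -pres_classM; apply: rel_eq; constructor.
by rewrite -(rmorph1 (calg_str E)) pushout_in_str rmorph1.
Qed.

HB.instance Definition _ k :=
  GRing.isNmodMorphism.Build E pushout (pushout_in k) (pushout_in_nmod k).
HB.instance Definition _ k :=
  GRing.isMonoidMorphism.Build E pushout (pushout_in k) (pushout_in_monoid k).

Definition pushout_inh (k : 'I_n) : calg_hom E pushout :=
  @CAlgHom R E pushout (pushout_in k) (pushout_in_str k).

Fact pushout_univ : is_fiber_power (f : @hom (Aff R) E A)
  (pushout_inh : 'I_n -> @hom (Aff R) pushout E).
Proof.
split=> [i j|X h h_f].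
  by apply: ap_ext => a; apply: rel_eq; constructor.
have h_rel x y : pushout_rel x y ->
    aeval (calg_str X) (fun u => ap (h u.1) u.2) x
    = aeval (calg_str X) (fun u => ap (h u.1) u.2) y.
  case=> /= [k x' y'|k x' y'|k r|i j a]; rewrite ?rmorphD ?rmorphM //.
    exact: ap_str.
  by have := congr1 (fun m => ap m a) (h_f i j).
exists (pres_hom h_rel : @hom (Aff R) X pushout); split=> [i|k ke].
  by apply: ap_ext => x; apply: pres_lift_gen.
apply: calg_hom_ext; apply: pres_ext => [r|[i x]].
  by rewrite [RHS](ap_str k r) -(chom_str (pres_hom h_rel)).
by rewrite [LHS]pres_lift_gen -(ke i).
Qed.

Definition aff_fiber_power : fiber_power n (f : @hom (Aff R) E A) :=
  FiberPower pushout_univ.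

End AffineFiberPowers.

Section KaehlerAdjunction.
Variable R : comPzRingType.
Local Notation P := (aff_products R).
Local Notation E := (prod_functor P (Reps R)).
Local Notation T := (sym_kaehlerF R).

Section Counit.
Variable A : calg R.
Local Notation TA := (sym_kaehler A).
Let cst (a : A) : TA := calg_str (sym (kaehler A)) a.
Let d (a : A) : TA := sym_gen (kd a).

Let cstD a b : cst (a + b) = cst a + cst b. Proof. exact: rmorphD. Qed.
Let cstM a b : cst (a * b) = cst a * cst b. Proof. exact: rmorphM. Qed.
Let dD a b : d (a + b) = d a + d b. Proof. by rewrite /d kdD sym_genD. Qed.
Let dM a b : d (a * b) = cst a * d b + cst b * d a.
Proof. by rewrite /d kdM sym_genD !sym_genZ. Qed.

Definition taylor (a : A) : tensor (Reps R) TA := tens 1 (cst a) + tens (eps R) (d a).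

Fact taylor_str r : taylor (calg_str A r) = calg_str (tensor (Reps R) TA) r.
Proof.
rewrite /taylor /d kd_str -(scale0r (0 : kaehler A)) sym_genZ rmorph0 mul0r tens0r addr0.
exact: (inr_str (Reps R) TA).
Qed.

Fact taylor_nmod : nmod_morphism taylor.
Proof.
split=> [|a b]; first by rewrite -(rmorph0 (calg_str A)) taylor_str rmorph0.
by rewrite /taylor cstD dD !tensDr addrACA.
Qed.

Fact taylor_monoid : monoid_morphism taylor.
Proof.
split=> [|a b]; first by rewrite -(rmorph1 (calg_str A)) taylor_str rmorph1.
rewrite /taylor mulrDl !mulrDr -!tensM mul1r mulr1 dual_gen_mul tens0l addr0.
by rewrite cstM dM tensDr -addrA mul1r [cst b * _]mulrC.
Qed.

HB.instance Definition _ :=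
  GRing.isNmodMorphism.Build A (tensor (Reps R) TA) taylor taylor_nmod.
HB.instance Definition _ :=
  GRing.isMonoidMorphism.Build A (tensor (Reps R) TA) taylor taylor_monoid.

Definition taylor_hom : calg_hom A (tensor (Reps R) TA) :=
  @CAlgHom R A (tensor (Reps R) TA) taylor taylor_str.

Lemma sym_kaehler_ext (S : calg R) (f g : calg_hom TA S) :
  (forall a, f (cst a) = g (cst a)) -> (forall a, f (d a) = g (d a)) -> f = g.
Proof.
move=> ec ed; apply: calg_hom_ext; apply: pres_ext => // m.
pose phi a : S := f (cst a).
have fD : {morph (fun m => f (sym_gen m) : S^o) : x y / x + y}.
  by move=> x y; rewrite sym_genD rmorphD.
have gD : {morph (fun m => g (sym_gen m) : S^o) : x y / x + y}.
  by move=> x y; rewrite sym_genD rmorphD.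
apply: (mpres_ext (phi := phi) fD gD) => [a x|a x|a]; last exact: ed.
  by rewrite sym_genZ rmorphM.
by rewrite sym_genZ rmorphM /phi ec.
Qed.

(** An algebra map h : A -> X[eps] has as components an algebra map h0 and a
    derivation h1 along it, which is a linear map on Kaehler differentials. *)
Lemma taylor_univ (X : calg R) (h : calg_hom A (tensor (Reps R) X)) :
  exists! g : calg_hom TA X, calg_comp (tmap (calg_id (Reps R)) g) taylor_hom = h.
Proof.
pose h0 : {rmorphism A -> X} := ap (tau_p X) \o h.
pose h1 (a : A) : X^o := gen_coef ord0 (h a).
have hE a : h a = tens 1 (h0 a) + tens (eps R) (h1 a : X).
  apply: Reps_coef_inj.
    by rewrite rmorphD [X in X + _]tau_p_cst [X in _ + X]tau_p_eps addr0.
  by rewrite gen_coefD gen_coef_cst gen_coef_gen add0r mulr1n.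
have h1D a b : h1 (a + b) = h1 a + h1 b by rewrite /h1 rmorphD gen_coefD.
have h1M a b : h1 (a * b) = h0 a *: h1 b + h0 b *: h1 a.
  rewrite {1}/h1 rmorphM !hE mulrDl !mulrDr -!tensM !mul1r !mulr1.
  rewrite !gen_coefD gen_coef_cst !gen_coef_gen !mulr1n add0r.
  by rewrite dual_gen_mul tens0l gen_coef0 addr0 [X in _ + X]mulrC.
have h1_str r : h1 (calg_str A r) = 0.
  by rewrite /h1 chom_str -(inr_str (Reps R) X) gen_coef_cst.
have krel x y : kaehler_rel x y -> meval h0 h1 x = meval h0 h1 y.
  by case=> /= [a b|a b|r]; [exact: h1D | exact: h1M | exact: h1_str].
pose H : kaehler A -> X := mpres_lift h0 h1.
have srel x y : sym_rel x y -> aeval h0 H x = aeval h0 H y.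
  case=> /= [m m'|a m]; first exact: (mpres_liftD krel).
  exact: (mpres_liftZ krel).
have g_str r : pres_lift srel (calg_str TA r) = calg_str X r.
  rewrite [LHS]pres_lift_cst -[LHS]/(ap (tau_p X) (h (calg_str A r))) chom_str.
  exact: ap_str.
pose g : calg_hom TA X := @CAlgHom R TA X (pres_lift srel) g_str.
have g_cst a : g (cst a) = h0 a by apply: pres_lift_cst.
have g_d a : g (d a) = h1 a.
  by rewrite [LHS]pres_lift_gen; apply: (mpres_lift_gen krel).
have compE (g' : calg_hom TA X) a :
    calg_comp (tmap (calg_id (Reps R)) g') taylor_hom a
    = tens 1 (g' (cst a)) + tens (eps R) (g' (d a)).
  by rewrite -[LHS]/(tmap (calg_id (Reps R)) g' (_ + _)) rmorphD !tmapE.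
exists g; split=> [|g' g'e].
  by apply: calg_hom_ext => a; rewrite compE g_cst g_d -hE.
have key a : tens 1 (g' (cst a)) + tens (eps R) (g' (d a)) = h a.
  by rewrite -compE g'e.
apply: sym_kaehler_ext => a.
  rewrite g_cst -[LHS]/(ap (tau_p X) (h a)) -key rmorphD.
  by rewrite [X in X + _]tau_p_cst [X in _ + X]tau_p_eps addr0.
rewrite g_d /h1 -key gen_coefD gen_coef_cst gen_coef_gen.
by rewrite add0r mulr1n.
Qed.

End Counit.

Fact taylor_natural (A B : Aff R) (f : hom A B) :
  fmap (idF (Aff R)) f ∘ (taylor_hom A : @hom (Aff R) (E (T A)) A)
  = (taylor_hom B : @hom (Aff R) (E (T B)) B) ∘ fmap (compF E T) f.
Proof.
apply: ap_ext => b.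
rewrite -[RHS]/(ap (fmap E (fmap T f)) (taylor b)) rmorphD !ap_prodF.
by rewrite [ap (fmap T f) _]sym_kaehler_map_cst [X in tens (eps R) X]sym_kaehler_map_gen
  kaehler_map_d.
Qed.

Definition kaehler_adj : adjunction E T :=
  @adj_of_univ (Aff R) (Aff R) E T
    (@NatTrans _ _ (compF E T) (idF (Aff R)) _ taylor_natural)
    (fun X A h => taylor_univ (h : calg_hom A (tensor (Reps R) X))).

End KaehlerAdjunction.

(** * Tangent structures from structure on a left adjoint *)

Lemma ord2P (Q : 'I_2 -> Prop) : Q fst2 -> Q snd2 -> forall i, Q i.
Proof.
move=> q1 q2 [[|[|//]] h]; [move: q1 | move: q2]; congr Q; exact: val_inj.
Qed.

Lemma fp2_lift (C : category) (E A X : C) (p : hom E A) (P : fiber_power 2 p)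
    (f g : hom X E) : p ∘ f = p ∘ g ->
  exists h : hom X P, fp_proj P fst2 ∘ h = f /\ fp_proj P snd2 ∘ h = g.
Proof.
move=> e; have e2 i j : p ∘ (if i == fst2 then f else g)
    = p ∘ (if j == fst2 then f else g) by case: ifP; case: ifP.
by exists (fp_lift P e2); rewrite !fp_liftE.
Qed.

Section AffineAddition.
Variables (R : comPzRingType) (D : calg R).
Local Notation F := (prod_functor (aff_products R) D).

Lemma prodF_additive (X Y : Aff R) (k k1 k2 k3 : hom X Y) :
  (forall y, ap k y = ap k1 y + ap k2 y - ap k3 y) ->
  forall y, ap (fmap F k) y = ap (fmap F k1) y + ap (fmap F k2) y - ap (fmap F k3) y.
Proof.
move=> ke y; have [s ->] := @tens_span R D Y y.
elim: s => [|[d b] s IH]; first by rewrite big_nil !rmorph0 subr0 addr0.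
rewrite big_cons !rmorphD {}IH !ap_prodF /= ke.
by rewrite tensBr tensDr addrACA -opprD addrACA.
Qed.
End AffineAddition.

(** The setting for a tangent structure built from transformations of a left
    adjoint E of T. U and ap, the functions on an object and their pullback, are
    used only to say that s is addition relative to z p. The arrow tau_v is the
    transpose of the map T_2 -> T T in the universality of the vertical lift. *)
Section CotangentStructure.
Variables (C : category) (U : C -> comPzRingType).
Variable ap : forall X Y : C, hom X Y -> {rmorphism U Y -> U X}.
Hypothesis ap_comp : forall (X Y Z : C) (g : hom Y Z) (f : hom X Y) x,
  ap (g ∘ f) x = ap f (ap g x).
Hypothesis ap_ext : forall (X Y : C) (g h : hom X Y),
  (forall x, ap g x = ap h x) -> g = h.

Variable E : functor C C.
Hypothesis E_additive : forall (X Y : C) (k k1 k2 k3 : hom X Y),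
  (forall y, ap k y = ap k1 y + ap k2 y - ap k3 y) ->
  forall y, ap (fmap E k) y
    = ap (fmap E k1) y + ap (fmap E k2) y - ap (fmap E k3) y.
Variables (tau_p : nat_trans (idF C) E) (tau_z : nat_trans E (idF C)).
Variables (tau_l : nat_trans (compF E E) E).
Variable tau_c : nat_trans (compF E E) (compF E E).

Variables (En : nat -> functor C C) (tau_s : nat_trans E (En 2)).
Variable tau_proj : forall n, 'I_n -> nat_trans E (En n).
Hypothesis tau_proj_p : forall n (i j : 'I_n) X,
  tau_proj i X ∘ tau_p X = tau_proj j X ∘ tau_p X.
Hypothesis tau_proj_univ : forall n, (0 < n)%N ->
  forall (X A : C) (h : 'I_n -> hom (E X) A),
  (forall i j, h i ∘ tau_p X = h j ∘ tau_p X) ->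
  exists! k : hom (En n X) A, forall i, k ∘ tau_proj i X = h i.
Hypothesis tau_s_proj : forall (X : C) (x : U (En 2 X)),
  ap (tau_s X) x = ap (tau_proj fst2 X) x + ap (tau_proj snd2 X) x
    - ap (tau_z X) (ap (tau_p X) (ap (tau_proj fst2 X) x)).
Hypothesis tau_s_p : forall X, tau_s X ∘ tau_p X = tau_proj fst2 X ∘ tau_p X.

Hypothesis tau_z_p : forall X, tau_z X ∘ tau_p X = idm X.
Hypothesis tau_l_p : forall X, tau_l X ∘ tau_p (E X) = tau_p X ∘ tau_z X.
Hypothesis tau_z_l : forall X, tau_z X ∘ tau_l X = tau_z X ∘ tau_z (E X).
Hypothesis tau_c_p : forall X, tau_c X ∘ tau_p (E X) = fmap E (tau_p X).
Hypothesis tau_z_c : forall X, fmap E (tau_z X) ∘ tau_c X = tau_z (E X).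
Hypothesis tau_l_l : forall X,
  tau_l X ∘ tau_l (E X) = tau_l X ∘ fmap E (tau_l X).
Hypothesis tau_c_c : forall X, tau_c X ∘ tau_c X = idm (E (E X)).
Hypothesis tau_c_c_c : forall X,
  tau_c (E X) ∘ fmap E (tau_c X) ∘ tau_c (E X)
  = fmap E (tau_c X) ∘ tau_c (E X) ∘ fmap E (tau_c X).
Hypothesis tau_l_c : forall X, tau_l X ∘ tau_c X = tau_l X.
Hypothesis tau_l_c_c : forall X,
  fmap E (tau_l X) ∘ tau_c (E X) ∘ fmap E (tau_c X) = tau_c X ∘ tau_l (E X).

Variable tau_v : forall X, hom (E (E X)) (En 2 X).
Hypothesis tau_vE : forall X x, ap (tau_v X) x
  = ap (tau_l X) (ap (tau_proj fst2 X) x)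
    + ap (fmap E (tau_z X)) (ap (tau_proj snd2 X) x)
    - ap (tau_z (E X)) (ap (tau_p (E X)) (ap (tau_l X) (ap (tau_proj fst2 X) x))).
Hypothesis tau_v_pushout : forall (X A : C) (m : hom (E (E X)) A) (n : hom X A),
  m ∘ tau_p (E X) = n ∘ tau_z X ->
  exists! k : hom (En 2 X) A,
    k ∘ tau_v X = m /\ k ∘ (tau_proj fst2 X ∘ tau_p X) = n.

Variables (T : functor C C) (a : adjunction E T).
Variable pow : forall n (B A : C) (f : hom B A), fiber_power n f.
Local Notation aa := (comp_adjunction a a).
Local Notation i := (id_adjunction C).

Definition cot_p : nat_trans T (idF C) := mateN a i tau_p.

Lemma cot_pE (X A : C) (g : hom X (T A)) : cot_p A ∘ g = flat a g ∘ tau_p X.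
Proof. by rewrite -(flat_id_adj (cot_p A ∘ g)) flat_mate. Qed.

Definition cot_pow n (n_gt0 : (0 < n)%N) (A : C) : fiber_power n (cot_p A) :=
  pow n (cot_p A).

Definition cot_pow_adj n (n_gt0 : (0 < n)%N) :
    adjunction (En n) (fiber_powerF (cot_pow n_gt0)) :=
  fp_adj cot_pE (cot_pow n_gt0) (@tau_proj_p n) (tau_proj_univ n_gt0).

Local Notation a2 := (@cot_pow_adj 2 isT).
Local Notation O2 := (@cot_pow 2 isT).
Local Notation q1 A := (fp_proj (O2 A) fst2).
Local Notation q2 A := (fp_proj (O2 A) snd2).

Definition cot_z : nat_trans (idF C) T := mateN i a tau_z.
Definition cot_s : nat_trans (fiber_powerF O2) T := mateN a2 a tau_s.
Definition cot_l : nat_trans T (compF T T) := mateN a aa tau_l.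
Definition cot_c : nat_trans (compF T T) (compF T T) := mateN aa aa tau_c.

Lemma cot_zE (X A : C) (g : hom X A) : flat a (cot_z A ∘ g) = g ∘ tau_z X.
Proof. by rewrite flat_mate flat_id_adj. Qed.

Lemma cot_lE (X A : C) (g : hom X (T A)) :
  flat a (flat a (cot_l A ∘ g)) = flat a g ∘ tau_l X.
Proof. by rewrite -flat_comp_adj flat_mate. Qed.

Lemma cot_cE (X A : C) (g : hom X (T (T A))) :
  flat a (flat a (cot_c A ∘ g)) = flat a (flat a g) ∘ tau_c X.
Proof. by rewrite -flat_comp_adj flat_mate flat_comp_adj. Qed.

Lemma cot_proj_mate n (n_gt0 : (0 < n)%N) (A : C) k :
  fp_proj (cot_pow n_gt0 A) k = mate (cot_pow_adj n_gt0) a (tau_proj k) A.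
Proof. exact: mate_fp_proj. Qed.

Lemma cot_projE (X A : C) (g : hom X (O2 A)) k :
  flat a2 g ∘ tau_proj k X = flat a (fp_proj (O2 A) k ∘ g).
Proof. exact: flat_fp_adj. Qed.

Lemma cot_sE (X A : C) (g : hom X (O2 A)) :
  flat a (cot_s A ∘ g) = flat a2 g ∘ tau_s X.
Proof. exact: flat_mate. Qed.

Lemma cot_sum (X A : C) (g : hom X (O2 A)) x :
  ap (flat a (cot_s A ∘ g)) x
  = ap (flat a (q1 A ∘ g)) x + ap (flat a (q2 A ∘ g)) x
    - ap (flat a (cot_z A ∘ (cot_p A ∘ (q1 A ∘ g)))) x.
Proof.
by rewrite cot_sE ap_comp tau_s_proj cot_zE cot_pE -!cot_projE !ap_comp.
Qed.

Lemma cot_p_z (A : C) : cot_p A ∘ cot_z A = idm A.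
Proof.
by rewrite cot_pE -[cot_z A]comp_idr cot_zE comp_idl tau_z_p.
Qed.

Lemma cot_p_s (A : C) : cot_p A ∘ cot_s A = cot_p A ∘ q1 A.
Proof.
rewrite !cot_pE -[cot_s A]comp_idr cot_sE -[q1 A]comp_idr -cot_projE.
by rewrite -!compA tau_s_p.
Qed.

Lemma flat_ext (X A : C) (g h : hom X (T A)) :
  (forall x, ap (flat a g) x = ap (flat a h) x) -> g = h.
Proof. by move=> e; apply: (flat_inj (a := a)); apply: ap_ext. Qed.

Lemma cot_monoid (A : C) : is_slice_comm_monoid (P2 := O2 A)
  (@cot_pow 3 isT A) (cot_z A) (cot_s A).
Proof.
have pz := cot_p_z A.
split.
- by rewrite pz cot_p_s.
- have [|u [u1 u2]] := fp2_lift (f := cot_z A ∘ cot_p A) (g := idm (T A)) (O2 A).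
    by rewrite compA pz comp_idl comp_idr.
  exists u; first by [].
  apply: flat_ext => x; rewrite cot_sum u1 u2 (compA (cot_p A)) pz comp_idl.
  by rewrite addrC addKr.
- have [|u [u1 u2]] := fp2_lift (f := q2 A) (g := q1 A) (O2 A).
    exact: fp_projE.
  exists u; first by [].
  apply: flat_ext => x; rewrite cot_sum u1 u2 -[cot_s A]comp_idr cot_sum.
  rewrite !comp_idr (fp_projE (O2 A) snd2 fst2).
  by congr (_ - _); rewrite addrC.
- pose q k := fp_proj (@cot_pow 3 isT A) (inord k).
  have qE j k : cot_p A ∘ q j = cot_p A ∘ q k by apply: fp_projE.
  have [|u12 [u12a u12b]] := fp2_lift (f := q 0%N) (g := q 1%N) (O2 A); first exact: qE.
  have [|u23 [u23a u23b]] := fp2_lift (f := q 1%N) (g := q 2%N) (O2 A); first exact: qE.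
  have [|v [va vb]] := fp2_lift (f := cot_s A ∘ u12) (g := q 2%N) (O2 A).
    by rewrite [LHS]compA cot_p_s -[LHS]compA u12a; apply: qE.
  have [|w [wa wb]] := fp2_lift (f := q 0%N) (g := cot_s A ∘ u23) (O2 A).
    by rewrite [RHS]compA cot_p_s -[RHS]compA u23a; apply: qE.
  exists u12, u23, v, w; split=> //.
  have p12 : cot_p A ∘ (cot_s A ∘ u12) = cot_p A ∘ q 0%N.
    by rewrite compA cot_p_s -compA u12a.
  apply: flat_ext => x; rewrite cot_sum va vb p12 cot_sum u12a u12b.
  rewrite cot_sum wa wb cot_sum u23a u23b (qE 1%N 0%N).
  by rewrite -!addrA; congr (_ + (_ + _)); rewrite addrCA.
Qed.

Lemma cot_p_counit (A : C) :
  cot_p A = flat a (idm (T A)) ∘ tau_p (T A).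
Proof. by rewrite -cot_pE comp_idr. Qed.
Lemma flat_cot_z (A : C) : flat a (cot_z A) = tau_z A.
Proof. by rewrite -[cot_z A]comp_idr cot_zE comp_idl. Qed.
Lemma flat_cot_l (A : C) :
  flat a (flat a (cot_l A)) = flat a (idm (T A)) ∘ tau_l (T A).
Proof. by rewrite -[cot_l A]comp_idr cot_lE. Qed.
Lemma flat_cot_c (A : C) :
  flat a (flat a (cot_c A)) = flat a (flat a (idm (T (T A)))) ∘ tau_c (T (T A)).
Proof. by rewrite -[cot_c A]comp_idr cot_cE. Qed.

Lemma cot_p_l (A : C) :
  fmap T (cot_p A) ∘ cot_l A = cot_z A ∘ cot_p A.
Proof.
apply: (flat_inj (a := a)).
by rewrite flat_post cot_zE cot_pE flat_cot_l cot_p_counit -!compA tau_l_p.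
Qed.

Lemma cot_l_z (A : C) :
  cot_l A ∘ cot_z A = fmap T (cot_z A) ∘ cot_z A.
Proof.
apply: (flat_inj (a := a)); apply: (flat_inj (a := a)).
by rewrite cot_lE flat_post flat_cot_z cot_zE tau_z_l.
Qed.

Lemma cot_p_c (A : C) : fmap T (cot_p A) ∘ cot_c A = cot_p (T A).
Proof.
apply: (flat_inj (a := a)); rewrite flat_post cot_pE flat_cot_c -compA tau_c_p.
by rewrite cot_p_counit [RHS]flat_pre.
Qed.

Lemma cot_c_z (A : C) : cot_c A ∘ cot_z (T A) = fmap T (cot_z A).
Proof.
apply: (flat_inj (a := a)); apply: (flat_inj (a := a)).
rewrite cot_cE flat_cot_z -[tau_z _]comp_idl flat_pre -compA tau_z_c.
by rewrite -[fmap T _]comp_idr flat_post cot_zE.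
Qed.

Lemma cot_l_l (A : C) :
  fmap T (cot_l A) ∘ cot_l A = cot_l (T A) ∘ cot_l A.
Proof.
do 3! apply: (flat_inj (a := a)).
rewrite flat_post cot_lE flat_cot_l cot_lE flat_pre flat_cot_l -!compA.
by rewrite tau_l_l.
Qed.

Lemma cot_c_c (A : C) : cot_c A ∘ cot_c A = idm (T (T A)).
Proof.
do 2! apply: (flat_inj (a := a)).
by rewrite cot_cE flat_cot_c -compA tau_c_c comp_idr.
Qed.

(** Transposing a composite reads it backwards, which turns one side of the braid
    relation for c into the other side of the one for tau_c. *)
Lemma cot_c_c_c (A : C) :
  fmap T (cot_c A) ∘ cot_c (T A) ∘ fmap T (cot_c A)
  = cot_c (T A) ∘ fmap T (cot_c A) ∘ cot_c (T A).
Proof.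
have flTc : flat a (flat a (flat a (fmap T (cot_c A))))
    = flat a (flat a (flat a (idm (T (T (T A)))))) ∘ tau_c (E (T (T (T A)))).
  by rewrite -[fmap T _]comp_idr flat_post cot_cE.
do 3! apply: (flat_inj (a := a)).
transitivity (flat a (flat a (flat a (idm (T (T (T A))))))
    ∘ (tau_c (E (T (T (T A)))) ∘ fmap E (tau_c (T (T (T A))))
       ∘ tau_c (E (T (T (T A)))))).
  by rewrite -compA flat_post cot_cE cot_cE [X in X ∘ _]flat_pre flTc -!compA.
symmetry; rewrite tau_c_c_c -[in LHS]compA cot_cE [LHS]flat_pre flat_post cot_cE flat_cot_c.
by rewrite [X in X ∘ _ ∘ _ = _]flat_pre -!compA.
Qed.

Lemma cot_c_l (A : C) : cot_c A ∘ cot_l A = cot_l A.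
Proof.
do 2! apply: (flat_inj (a := a)).
by rewrite cot_cE flat_cot_l -compA tau_l_c.
Qed.

Lemma cot_c_c_l (A : C) :
  cot_c (T A) ∘ fmap T (cot_c A) ∘ cot_l (T A)
  = fmap T (cot_l A) ∘ cot_c A.
Proof.
do 3! apply: (flat_inj (a := a)).
rewrite [RHS](congr1 (fun g => flat a (flat a g)) (flat_post _ _ _)).
rewrite cot_lE flat_cot_c -[RHS]compA.
rewrite -tau_l_c_c -compA cot_cE [LHS]flat_pre flat_post cot_cE flat_cot_l.
by rewrite [X in X ∘ _ ∘ _ = _]flat_pre -!compA.
Qed.

(** T preserves the fiber square T_2, being a right adjoint. *)
Lemma T_lift2 (X A : C) (f : 'I_2 -> hom X (T (T A))) :
  (forall j k, fmap T (cot_p A) ∘ f j = fmap T (cot_p A) ∘ f k) ->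
  exists h : hom X (T (O2 A)), forall k, fmap T (fp_proj (O2 A) k) ∘ h = f k.
Proof.
move=> fE; have [_ u] := radj_fiber_power a (fp_univ (O2 A)).
by have [h [hE _]] := u X f fE; exists h.
Qed.

Lemma flat_zp (X A : C) (g : hom X (T A)) :
  flat a (cot_z A ∘ (cot_p A ∘ g)) = flat a g ∘ tau_p X ∘ tau_z X.
Proof. by rewrite cot_zE cot_pE. Qed.

Lemma cot_l_s (A : C) : exists2 ll : hom (O2 A) (T (O2 A)),
  (forall k, fmap T (fp_proj (O2 A) k) ∘ ll = cot_l A ∘ fp_proj (O2 A) k)
  & fmap T (cot_s A) ∘ ll = cot_l A ∘ cot_s A.
Proof.
have [j k|ll llE] := @T_lift2 _ A (fun k => cot_l A ∘ fp_proj (O2 A) k).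
  by rewrite [LHS]compA [RHS]compA cot_p_l -[LHS]compA -[RHS]compA (fp_projE _ j k).
exists ll => //; do 2! apply: (flat_inj (a := a)); apply: ap_ext => x.
rewrite cot_lE flat_post cot_sum flat_zp -!flat_post !llE !cot_lE [RHS]ap_comp.
rewrite -[cot_s A]comp_idr cot_sum !comp_idr flat_zp rmorphB rmorphD -!ap_comp.
congr (_ - ap _ _); rewrite -!compA; congr (_ ∘ _).
by rewrite tau_z_l; congr (_ ∘ _); rewrite !compA tau_l_p.
Qed.

Lemma cot_c_s (A : C) : exists2 cc : hom (O2 (T A)) (T (O2 A)),
  (forall k, fmap T (fp_proj (O2 A) k) ∘ cc
     = cot_c A ∘ fp_proj (O2 (T A)) k)
  & fmap T (cot_s A) ∘ cc = cot_c A ∘ cot_s (T A).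
Proof.
have [j k|cc ccE] := @T_lift2 _ A (fun k => cot_c A ∘ fp_proj (O2 (T A)) k).
  by rewrite [LHS]compA [RHS]compA cot_p_c (fp_projE _ j k).
exists cc => //; do 2! apply: (flat_inj (a := a)); apply: ap_ext => x.
rewrite cot_cE flat_post cot_sum flat_zp -!flat_post !ccE !cot_cE.
have flE (g : hom (O2 (T A)) (T (T A))) y :
    ap (flat a (flat a g)) y = ap (fmap E (flat a g)) (ap (adj_counit a A) y).
  by rewrite -ap_comp.
rewrite [RHS]ap_comp flE (E_additive (k1 := flat a (q1 (T A))) (k2 := flat a (q2 (T A)))
  (k3 := flat a (cot_z (T A) ∘ (cot_p (T A) ∘ q1 (T A))))) => [|y]; last first.
  by rewrite -[cot_s _]comp_idr cot_sum !comp_idr.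
rewrite -!flE rmorphB rmorphD -!ap_comp; congr (_ - ap _ _).
rewrite flat_zp !flat_pre -!compA tau_z_c; congr (_ ∘ _).
by congr (_ ∘ (_ ∘ _)); rewrite compA tau_c_p.
Qed.

Lemma cot_universal (A : C) : exists2 u : hom (O2 A) (T (O2 A)),
  fmap T (q1 A) ∘ u = cot_l A ∘ q1 A /\ fmap T (q2 A) ∘ u = cot_z (T A) ∘ q2 A
  & is_pullback (fmap T (cot_s A) ∘ u) (cot_p A ∘ q1 A)
      (fmap T (cot_p A)) (cot_z A).
Proof.
have q12 : cot_p A ∘ q1 A = cot_p A ∘ q2 A by apply: fp_projE.
have plE : fmap T (cot_p A) ∘ (cot_l A ∘ q1 A) = cot_z A ∘ (cot_p A ∘ q1 A).
  by rewrite [LHS]compA cot_p_l [RHS]compA.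
have pzE : fmap T (cot_p A) ∘ (cot_z (T A) ∘ q2 A) = cot_z A ∘ (cot_p A ∘ q1 A).
  by rewrite q12 [LHS]compA (naturality cot_z) [RHS]compA.
have [j k|u uE] := @T_lift2 _ A (fun k => if k == fst2 then cot_l A ∘ q1 A
    else cot_z (T A) ∘ q2 A).
  by do 2! case: ifP => _; rewrite ?plE ?pzE.
have u1 := uE fst2; have u2 := uE snd2; rewrite /= in u1 u2.
exists u => //.
have key X (h : hom X (O2 A)) :
    flat a (flat a (fmap T (cot_s A) ∘ u ∘ h)) = flat a2 h ∘ tau_v X.
  apply: ap_ext => x; rewrite -[fmap T (cot_s A) ∘ u ∘ h]compA flat_post cot_sum flat_zp.
  rewrite -!flat_post [fmap T (q1 A) ∘ _]compA u1 [fmap T (q2 A) ∘ _]compA u2.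
  rewrite -[cot_l A ∘ _ ∘ h]compA -[cot_z (T A) ∘ _ ∘ h]compA.
  rewrite cot_lE cot_zE [flat a (q2 A ∘ h ∘ _)]flat_pre.
  by rewrite [RHS]ap_comp tau_vE -!cot_projE !ap_comp.
have key2 X (h : hom X (O2 A)) :
    cot_p A ∘ q1 A ∘ h = flat a2 h ∘ (tau_proj fst2 X ∘ tau_p X).
  by rewrite -compA cot_pE compA cot_projE.
split=> [|X r1 r2 r12].
  rewrite [LHS]compA -fmap_comp cot_p_s fmap_comp -[LHS]compA u1.
  exact: plE.
have [|k [[k1 k2] ku]] := @tau_v_pushout X A (flat a (flat a r1)) r2.
  by rewrite -cot_pE -flat_post r12 cot_zE.
exists (sharp a2 k); split=> [|h [h1 h2]].
  split; last by rewrite key2 sharpK.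
  by do 2! apply: (flat_inj (a := a)); rewrite key sharpK.
apply: (flat_inj (a := a2)); rewrite sharpK; apply: ku.
by rewrite -key -key2 h1 h2.
Qed.

(** The fiber powers are preserved by the iterates of T because these are right
    adjoints. *)
Definition cot_tangent : tangent_on T := @TangentOn C T cot_p cot_pow
  (fun n n_gt0 A m => 
     match iter_ladj a m with ex_intro F' (inhabits a') =>
       radj_fiber_power a' (fp_univ (cot_pow n_gt0 A)) end)
  cot_z cot_s cot_l cot_c cot_monoid cot_p_l cot_l_z cot_l_s cot_p_c cot_c_z
  cot_c_s cot_l_l cot_c_c cot_c_c_c cot_c_l cot_c_c_l cot_universal.

End CotangentStructure.

Section DualSums.
Variable R : comPzRingType.
Local Notation P := (aff_products R).
Local Notation E := (prod_functor P (Reps R)).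

Lemma tau_s_proj (X : calg R) (x : tensor (dual R 2) X) :
  ap (tau_s X) x = ap (tau_proj R fst2 X) x + ap (tau_proj R snd2 X) x
    - ap (tau_z X) (ap (tau_p X) (ap (tau_proj R fst2 X) x)).
Proof.
rewrite !tau_projE rmorphD [X in ap (tau_z _) (X + _)]tau_p_cst.
rewrite [X in ap (tau_z _) (_ + X)]tau_p_eps addr0 tau_zE.
rewrite {1}[x]dual_tensor_coef rmorphD [X in X + _]tau_s_cst.
rewrite big_ord_recl big_ord1 rmorphD [X in _ + (X + _)]tau_s_gen.
rewrite [X in _ + (_ + X)]tau_s_gen [X in _ = X - _]addrACA -[X in _ = X - _]addrA.
by rewrite [RHS]addrC addKr; congr (_ + (_ + tens _ (gen_coef _ x))); apply: val_inj.
Qed.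

Lemma tau_s_p (X : Aff R) : tau_s X ∘ tau_p X = tau_proj R fst2 X ∘ tau_p X.
Proof.
apply: dualF_ext => [k|x]; ap_comps; rewrite !tauE.
  by rewrite [ap (tau_proj _ _ _) _]tau_proj_gen; case: ifP; rewrite ?tauE ?rmorph0.
by rewrite [ap (tau_proj _ _ _) _]tau_proj_cst tauE.
Qed.


Definition univ_gen (k : 'I_2) : tensor (Reps R) (tensor (Reps R) (base_alg R)) :=
  tens (eps R) (if k == fst2 then tens (eps R) 1 else 1).

Fact univ_gen_mul0 j k : univ_gen j * univ_gen k = 0.
Proof. by rewrite /univ_gen -tensM dual_gen_mul tens0l. Qed.

(** R[eps_1, eps_2] (x) X -> R[eps] (x) R[eps] (x) X sends eps_1 to
    eps (x) eps and eps_2 to eps (x) 1. *)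
Definition tau_v (X : Aff R) : hom (E (E X)) (prod_functor P (dual R 2) X) :=
  copair (calg_comp (tmap (calg_id (Reps R)) (tmap (calg_id (Reps R)) (str_hom X)))
            (dual_hom univ_gen_mul0))
    (calg_comp (tens_inr (Reps R) (tensor (Reps R) X)) (tens_inr (Reps R) X)).

Lemma tau_v_coef (X : calg R) (x : tensor (dual R 2) X) :
  ap (tau_v X) x = tens 1 (tens 1 (cst_coef x))
    + tens (eps R) (tens 1 (gen_coef snd2 x) + tens (eps R) (gen_coef fst2 x)).
Proof.
have vgen k y : ap (tau_v X) (tens (dual_gen R k) y)
    = tens (eps R) (if k == fst2 then tens (eps R) y else tens 1 y).
  rewrite [LHS]copairE -[X in X * _]/(tmap (calg_id (Reps R))
    (tmap (calg_id (Reps R)) (str_hom X)) (dual_hom univ_gen_mul0 (dual_gen R k))).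
  rewrite dual_homE tmapE.
  rewrite -[X in _ * X]/(tens 1 (tens 1 y)) -tensM mulr1; congr tens.
  case: ifP => _; last by rewrite rmorph1 mul1r.
  by rewrite tmapE rmorph1 -tensM mulr1 mul1r.
rewrite {1}[x]dual_tensor_coef big_ord_recl big_ord1 !rmorphD !vgen.
rewrite [X in X + _]copairE rmorph1 mul1r tensDr; congr (_ + _).
by rewrite addrC; congr (tens _ (tens _ (gen_coef _ x)) + _); apply: val_inj.
Qed.

Lemma tau_vE (X : Aff R) x : ap (tau_v X) x
  = ap (tau_l X) (ap (tau_proj R fst2 X) x)
    + ap (fmap E (tau_z X)) (ap (tau_proj R snd2 X) x)
    - ap (tau_z (E X)) (ap (tau_p (E X)) (ap (tau_l X) (ap (tau_proj R fst2 X) x))).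
Proof.
rewrite tau_v_coef !tau_projE !rmorphD !tauE tens0r addr0 tensDr.
rewrite [X in _ = X - _]addrACA -[X in _ = X - _]addrA [RHS]addrC addKr.
by congr (_ + _); rewrite addrC.
Qed.

Lemma tau_v_pushout (X A : Aff R) (m : hom (E (E X)) A) (n : hom X A) :
  m ∘ tau_p (E X) = n ∘ tau_z X ->
  exists! k : hom (prod_functor P (dual R 2) X) A,
    k ∘ tau_v X = m /\ k ∘ (tau_proj R fst2 X ∘ tau_p X) = n.
Proof.
move=> mn.
have tau_p_v (x : tensor (dual R 2) X) :
    ap (tau_p (E X)) (ap (tau_v X) x) = tens 1 (cst_coef x).
  by rewrite tau_v_coef rmorphD [X in X + _]tau_p_cst [X in _ + X]tau_p_eps addr0.
have v_inj (x y : tensor (dual R 2) X) : ap (tau_v X) x = ap (tau_v X) y -> x = y.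
  move=> e; have e0 : cst_coef x = cst_coef y.
    have := congr1 (ap (tau_p (E X))) e; rewrite !tau_p_v.
    by move/(congr1 (@cst_coef R 1 X)); rewrite !cst_coef_cst.
  have e1 : gen_coef snd2 x = gen_coef snd2 y /\ gen_coef fst2 x = gen_coef fst2 y.
    have := congr1 (@gen_coef R 1 (tensor (Reps R) X) ord0) e.
    rewrite !tau_v_coef !gen_coefD !gen_coef_cst !gen_coef_gen !mulr1n !add0r => {}e.
    have := congr1 (@cst_coef R 1 X) e; have := congr1 (@gen_coef R 1 X ord0) e.
    rewrite !gen_coefD !cst_coefD !cst_coef_cst !cst_coef_gen !gen_coef_cst.
    by rewrite !gen_coef_gen !mulr1n !add0r !addr0.
  rewrite [x]dual_tensor_coef [y]dual_tensor_coef e0; congr (_ + _).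
  by apply: eq_bigr; apply: ord2P; rewrite ?e1.1 ?e1.2.
have v_onto b : exists x, ap (tau_v X) x = ap m b.
  pose w := gen_coef ord0 (ap m b : tensor (Reps R) (tensor (Reps R) X)).
  exists (tens 1 (ap n b) + (tens (dual_gen R fst2) (gen_coef ord0 w)
    + tens (dual_gen R snd2) (ap (tau_p X) w))).
  rewrite tau_v_coef !(cst_coefD, gen_coefD) !cst_coef_cst !cst_coef_gen.
  rewrite !gen_coef_cst !gen_coef_gen !mulr1n !mulr0n !(addr0, add0r).
  rewrite -Reps_coef [RHS]Reps_coef; congr (tens _ _ + _).
  by rewrite -ap_comp mn ap_comp tau_zE.
have [||k /(_ tt) ke] := @joint_lift R unit A (tensor (dual R 2) X)
    (fun=> tensor (Reps R) (tensor (Reps R) X)) (fun=> tau_v X) (fun=> m).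
- by move=> x y /(_ tt); apply: v_inj.
- by move=> b; have [x xe] := v_onto b; exists x.
exists k; split=> [|k' [k'm k'n]]; last first.
  by apply: ap_ext => b; apply: v_inj; rewrite -!ap_comp k'm -ke.
split; first exact: ke.
apply: ap_ext => b; ap_comps; rewrite tau_projE rmorphD.
rewrite [X in X + _]tau_p_cst [X in _ + X]tau_p_eps addr0.
have := congr1 (ap (tau_p (E X))) (congr1 (fun g => ap g b) ke).
rewrite [LHS]tau_p_v -ap_comp mn ap_comp tau_zE.
by move/(congr1 (@cst_coef R 1 X)); rewrite !cst_coef_cst.
Qed.

End DualSums.

(** * Comparing tangent structures through their left adjoints *)

Section Comates.
Variables (C : category) (t : tangent_structure C).
Local Notation T := (tan_T t).
Variables (F : functor C C) (a : adjunction F T).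

Record comates (tp : forall X : C, hom X (F X)) (tz : forall X : C, hom (F X) X)
    (tl : forall X : C, hom (F (F X)) (F X))
    (tc : forall X : C, hom (F (F X)) (F (F X))) : Prop := Comates {
  cm_p : forall X A (g : hom X (T A)), tan_p t A ∘ g = flat a g ∘ tp X;
  cm_z : forall X A (g : hom X A), flat a (tan_z t A ∘ g) = g ∘ tz X;
  cm_l : forall X A (g : hom X (T A)),
    flat a (flat a (tan_l t A ∘ g)) = flat a g ∘ tl X;
  cm_c : forall X A (g : hom X (T (T A))),
    flat a (flat a (tan_c t A ∘ g)) = flat a (flat a g) ∘ tc X }.

(** By naturality a transformation out of T is determined by its value on the
    unit, the universal arrow into T. *)
Lemma comates_exist : comates
  (fun X => tan_p t (F X) ∘ adj_unit a X)
  (fun X => flat a (tan_z t X))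
  (fun X => flat a (flat a (tan_l t (F X) ∘ adj_unit a X)))
  (fun X => flat a (flat a (tan_c t (F (F X)) ∘ sharp a (sharp a (idm (F (F X))))))).
Proof.
split=> X A g.
- have h := naturality (tan_p t) (flat a g); rewrite /= in h.
  by rewrite compA h -compA; congr (_ ∘ _); rewrite -[LHS](flatK a).
- by rewrite -flat_post (naturality (tan_z t)).
- have h := naturality (tan_l t) (flat a g); rewrite /= in h.
  rewrite -flat_post -flat_post compA h -compA.
  by congr (flat a (flat a (_ ∘ _))); rewrite -[LHS](flatK a).
- have h := naturality (tan_c t) (flat a (flat a g)); rewrite /= in h.
  rewrite -flat_post -flat_post compA h -compA.
  congr (flat a (flat a (_ ∘ _))).
  by do 2! apply: (flat_inj (a := a)); rewrite flat_post flat_post !sharpK comp_idr.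
Qed.

End Comates.

Section IsoOfComates.
Variables (C : category) (U : C -> comPzRingType).
Variable ap : forall X Y : C, hom X Y -> {rmorphism U Y -> U X}.
Hypothesis ap_comp : forall (X Y Z : C) (g : hom Y Z) (f : hom X Y) x,
  ap (g ∘ f) x = ap f (ap g x).
Hypothesis ap_ext : forall (X Y : C) (g h : hom X Y),
  (forall x, ap g x = ap h x) -> g = h.

Definition additive_sum (t : tangent_structure C) (F : functor C C)
    (a : adjunction F (tan_T t)) :=
  forall (X A : C) (g : hom X (T2 t A)) x,
  ap (flat a (tan_s t A ∘ g)) x
  = ap (flat a (pi1 t A ∘ g)) x + ap (flat a (pi2 t A ∘ g)) x
    - ap (flat a (tan_z t A ∘ (tan_p t A ∘ (pi1 t A ∘ g)))) x.

Variables (t t' : tangent_structure C) (F F' : functor C C).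
Local Notation T := (tan_T t).
Local Notation T' := (tan_T t').
Variables (a : adjunction F T) (a' : adjunction F' T').
Variables (tp : forall X : C, hom X (F X)) (tz : forall X : C, hom (F X) X).
Variables (tl : forall X : C, hom (F (F X)) (F X)).
Variables (tc : forall X : C, hom (F (F X)) (F (F X))).
Variables (tp' : forall X : C, hom X (F' X)) (tz' : forall X : C, hom (F' X) X).
Variables (tl' : forall X : C, hom (F' (F' X)) (F' X)).
Variables (tc' : forall X : C, hom (F' (F' X)) (F' (F' X))).
Hypotheses (m : comates a tp tz tl tc) (m' : comates a' tp' tz' tl' tc').
Hypotheses (sum : additive_sum a) (sum' : additive_sum a').

Variables (phi : nat_trans F' F) (psi : nat_trans F F').
Hypotheses (phiK : forall X, psi X ∘ phi X = idm (F' X)).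
Hypotheses (psiK : forall X, phi X ∘ psi X = idm (F X)).
Let phi2 X : hom (F' (F' X)) (F (F X)) := fmap F (phi X) ∘ phi (F' X).
Let psi2 X : hom (F (F X)) (F' (F' X)) := fmap F' (psi X) ∘ psi (F X).
Hypothesis psi_p : forall X, psi X ∘ tp X = tp' X.
Hypothesis psi_z : forall X, tz' X ∘ psi X = tz X.
Hypothesis psi_l : forall X, psi X ∘ tl X = tl' X ∘ psi2 X.
Hypothesis psi_c : forall X, psi2 X ∘ tc X = tc' X ∘ psi2 X.

Let phi2K X : psi2 X ∘ phi2 X = idm (F' (F' X)).
Proof.
rewrite -compA (compA (psi (F X))) -(naturality psi) -compA phiK comp_idr.
by rewrite -fmap_comp phiK fmap_id.
Qed.

Let psi2K X : phi2 X ∘ psi2 X = idm (F (F X)).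
Proof.
rewrite -compA (compA (phi (F' X))) -(naturality phi) -compA psiK comp_idr.
by rewrite -fmap_comp psiK fmap_id.
Qed.

Let phi_p X : phi X ∘ tp' X = tp X.
Proof. by rewrite -psi_p compA psiK comp_idl. Qed.

Let phi_z X : tz X ∘ phi X = tz' X.
Proof. by rewrite -psi_z -compA phiK comp_idr. Qed.

Let phi_l X : tl X ∘ phi2 X = phi X ∘ tl' X.
Proof.
rewrite -[tl X]comp_idl -psiK -(compA (phi X)) psi_l -!(compA (phi X)).
by rewrite -(compA (tl' X)) phi2K comp_idr.
Qed.

Let phi_c X : tc X ∘ phi2 X = phi2 X ∘ tc' X.
Proof.
rewrite -[tc X]comp_idl -psi2K -(compA (phi2 X)) psi_c -!(compA (phi2 X)).
by rewrite -(compA (tc' X)) phi2K comp_idr.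
Qed.

(** The mate of phi transports the structure. All conditions transpose to
    identities between comates, except the one for s, which holds because phi is
    additive on functions. *)
Lemma tangent_iso_of_comates : tangent_iso t t'.
Proof.
have [alpha alphaE] : exists alpha : nat_trans T T', forall X A (g : hom X (T A)),
    flat a' (alpha A ∘ g) = flat a g ∘ phi X.
  by exists (mateN a a' phi) => X A g; apply: flat_mate.
exists alpha.
have alpha2E X A (g : hom X (T (T A))) :
    flat a' (flat a' (alpha (T' A) ∘ fmap T (alpha A) ∘ g))
    = flat a (flat a g) ∘ phi2 X.
  rewrite -[_ ∘ g]compA alphaE flat_post -compA alphaE [flat a (_ ∘ phi X)]flat_pre.
  by rewrite compA.
have p_alpha A : tan_p t' A ∘ alpha A = tan_p t A.
  rewrite (cm_p m') -[alpha A]comp_idr alphaE -[RHS]comp_idr (cm_p m).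
  by rewrite -compA phi_p.
split=> [A|A].
  exists (mateN a' a psi A); split.
    apply: (flat_inj (a := a)); rewrite flat_mate -[alpha A]comp_idr alphaE.
    by rewrite -compA psiK comp_idr.
  apply: (flat_inj (a := a')); rewrite alphaE -[mateN _ _ _ _]comp_idr flat_mate.
  by rewrite -compA phiK comp_idr.
split.
- exact: p_alpha.
- apply: (flat_inj (a := a')); rewrite alphaE -[tan_z t A]comp_idr (cm_z m).
  by rewrite -[tan_z t' A]comp_idr (cm_z m') -compA phi_z.
- have pe : tan_p t' A ∘ (alpha A ∘ pi1 t A) = tan_p t' A ∘ (alpha A ∘ pi2 t A).
    by rewrite !compA p_alpha; apply: fp_projE.
  have [aa [aa1 aa2]] := fp2_lift (T2 t' A) pe.
  exists aa; first by apply: ord2P.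
  apply: (flat_inj (a := a')); apply: ap_ext => x.
  have e : flat a' (tan_z t' A ∘ (tan_p t' A ∘ (pi1 t' A ∘ aa)))
      = flat a (tan_z t A ∘ (tan_p t A ∘ pi1 t A)) ∘ phi _.
    by rewrite (cm_z m') (cm_z m) /pi1 aa1 -compA phi_z compA p_alpha.
  rewrite sum' e /pi1 /pi2 aa1 aa2 !alphaE !(ap_comp _ (phi _)) -rmorphD -rmorphB.
  rewrite -[tan_s t A]comp_idr.
  by rewrite sum !comp_idr.
- do 2! apply: (flat_inj (a := a')).
  rewrite alpha2E (cm_l m') -[tan_l t A]comp_idr (cm_l m) -[alpha A]comp_idr.
  by rewrite alphaE -!compA phi_l.
- do 2! apply: (flat_inj (a := a')).
  rewrite alpha2E (cm_c m') -[tan_c t A]comp_idr (cm_c m).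
  by rewrite -[_ ∘ fmap T _]comp_idr alpha2E -[LHS]compA phi_c [LHS]compA.
Qed.

End IsoOfComates.

(** When p is invertible it is itself an isomorphism onto the trivial structure. *)
Lemma tangent_iso_trivial (C : category) (t : tangent_structure C) :
  (forall A, is_iso (tan_p t A)) -> tangent_iso t (trivial_tangent C).
Proof.
move=> p_iso; exists (tan_p t); split=> // A /=; rewrite !comp_idl.
have pT : tan_p t A ∘ fmap (tan_T t) (tan_p t A) = tan_p t A ∘ tan_p t (tan_T t A).
  exact: (esym (naturality (tan_p t) (tan_p t A))).
have [[pz ps] _ _ _] := tan_monoid t A.
split=> //.
- exists (tan_p t A ∘ pi1 t A).
    by apply: ord2P; rewrite comp_idl //; apply: fp_projE.
  by rewrite comp_idl.
- by rewrite -compA tan_pl compA pz comp_idl.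
- by rewrite -compA tan_pc pT.
Qed.

(** * The two representable structures *)

Section TOmega.
Variable R : comPzRingType.
Local Notation P := (aff_products R).
Local Notation E := (prod_functor P (Reps R)).
Local Notation En := (fun n => prod_functor P (dual R n)).

Definition tauN_p : nat_trans (idF (Aff R)) E :=
  @NatTrans _ _ (idF (Aff R)) E _ (@tau_p_natural R).
Definition tauN_z : nat_trans E (idF (Aff R)) :=
  @NatTrans _ _ E (idF (Aff R)) _ (@tau_z_natural R).
Definition tauN_s : nat_trans E (En 2) :=
  @NatTrans _ _ E (En 2) _ (@tau_s_natural R).
Definition tauN_l : nat_trans (compF E E) E :=
  @NatTrans _ _ (compF E E) E _ (@tau_l_natural R).
Definition tauN_c : nat_trans (compF E E) (compF E E) :=
  @NatTrans _ _ (compF E E) (compF E E) _ (@tau_c_natural R).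

Definition TOmega : tangent_on (sym_kaehlerF R) :=
  @cot_tangent (Aff R) (fun X => calg_ring X) (@ap R) (@ap_comp R) (@ap_ext R)
    E (@prodF_additive R (Reps R)) tauN_p tauN_z tauN_l tauN_c En tauN_s
    (tau_proj R) (@tau_proj_p R) (@tau_proj_univ R) (@tau_s_proj R)
    (@tau_s_p R) (@tau_z_p R) (@tau_l_p R) (@tau_z_l R) (@tau_c_p R)
    (@tau_z_c R) (@tau_l_l R) (@tau_c_c R) (@tau_c_c_c R) (@tau_l_c R)
    (@tau_l_c_c R) (@tau_v R) (@tau_vE R) (@tau_v_pushout R)
    (sym_kaehlerF R) (kaehler_adj R)
    (fun n B A f => aff_fiber_power n (f : calg_hom A B)).

Definition TOmega_pow_adj n (n_gt0 : (0 < n)%N) :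
    adjunction (prod_functor P (dual R n)) (tan_Tn TOmega n_gt0) :=
  cot_pow_adj (tau_p := tauN_p) (En := En) (tau_proj := tau_proj R) (@tau_proj_p R)
    (@tau_proj_univ R) (kaehler_adj R)
    (fun n B A f => aff_fiber_power n (f : calg_hom A B)) n_gt0.

Lemma tau_pi_proj k (X : Aff R) : tau_pi k X = tau_proj R k X.
Proof.
apply: dualF_ext => [i|x]; rewrite tau_piE.
  rewrite dual_homE [RHS]tau_proj_gen.
  by case: ifP => // _; rewrite tens0l.
by rewrite rmorph1 [RHS]tau_proj_cst.
Qed.

Lemma TOmega_is : is_TOmega TOmega.
Proof.
exists (kaehler_adj R), (TOmega_pow_adj (isT : 0 < 2)%N); split.
- by move=> A x; reflexivity.
- move=> A k.
  transitivity (mate (TOmega_pow_adj (isT : 0 < 2)%N) (kaehler_adj R) (tau_proj R k) A).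
    exact: (cot_proj_mate (tau_p := tauN_p) (En := En) (tau_proj := tau_proj R)).
  apply: (@eq_mate _ _ (prod_functor P (dual R 2)) E
    (tan_Tn TOmega (isT : 0 < 2)%N) (sym_kaehlerF R)
    (TOmega_pow_adj (isT : 0 < 2)%N) (kaehler_adj R) (tau_proj R k) (tau_pi k)) => X.
  exact: esym (tau_pi_proj k X).
- by move=> A; split; reflexivity.
Qed.

Lemma TOmega_comates : @comates (Aff R) (TangentStructure TOmega) E
  (kaehler_adj R) tauN_p tauN_z tauN_l tauN_c.
Proof. by split=> X A g; [apply: cot_pE | apply: cot_zE | apply: cot_lE | apply: cot_cE]. Qed.

Lemma TOmega_additive_sum : @additive_sum (Aff R) (fun X => calg_ring X)
  (@ap R) (TangentStructure TOmega) E (kaehler_adj R).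
Proof.
move=> X A g x.
exact: (cot_sum (U := fun X : Aff R => calg_ring X) (ap := @ap R)
  (tau_p := tauN_p) (tau_z := tauN_z) (En := En) (tau_s := tauN_s)
  (tau_proj := tau_proj R) (@ap_comp R) (@tau_proj_p R) (@tau_proj_univ R) (@tau_s_proj R)).
Qed.

Lemma TOmega_representable : representable P (TangentStructure TOmega).
Proof.
move=> n n_gt0; exists (dual R n), (tan_Tn TOmega n_gt0); split.
  by constructor; apply: TOmega_pow_adj.
exists (@NatTrans _ _ (tan_Tn TOmega n_gt0) (tan_Tn TOmega n_gt0)
  (fun A => idm _) (fun A B f => etrans (comp_idr _) (esym (comp_idl _)))).
by move=> A; exists (idm _); rewrite comp_idl.
Qed.

Lemma trivial_representable : representable P (trivial_tangent (Aff R)).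
Proof.
move=> n n_gt0; exists (base_alg R : Aff R), (idF (Aff R)); split.
  have nat (A B : Aff R) (f : hom A B) : fmap (idF (Aff R)) f ∘ pr2 P (base_alg R) A
      = pr2 P (base_alg R) B ∘ fmap (compF (prod_functor P (base_alg R)) (idF (Aff R))) f.
    by rewrite [RHS]pair2.
  constructor; apply: (adj_of_univ
    (e := @NatTrans _ _ (compF (prod_functor P (base_alg R)) (idF _)) (idF _) _ nat)).
  move=> X A h.
  have prK : unitor_inv P X ∘ pr2 P (base_alg R) X = idm _.
    apply: pair_ext; rewrite compA ?pair1 ?pair2 ?comp_idl ?comp_idr //.
    by rewrite [LHS](@bang_unique _ P) [RHS](@bang_unique _ P).
  have key (g : hom X A) :
      pr2 P (base_alg R) A ∘ prod_map P (idm (base_alg R : Aff R)) g = g ∘ pr2 P _ X.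
    by rewrite pair2.
  exists (h ∘ unitor_inv P X); split=> [|g <-].
    by rewrite [LHS]key -compA prK comp_idr.
  by rewrite [X in X ∘ _]key -compA pair2 comp_idr.
pose k0 := Ordinal n_gt0.
have nat (A B : Aff R) (f : hom A B) :
    fmap (idF (Aff R)) f ∘ idm A
    = idm B ∘ fmap (tan_Tn (trivial_tangent (Aff R)) n_gt0) f.
  exact: esym (fp_liftE (triv_pow n_gt0 B)
    (fpF_compat (@triv_pow (Aff R) n n_gt0) f) k0).
exists (@NatTrans _ _ (tan_Tn (trivial_tangent (Aff R)) n_gt0) (idF (Aff R)) _ nat).
by move=> A; exists (idm A); rewrite comp_idl.
Qed.

Lemma trivial_not_TOmega : (1 : R) <> 0 ->
  ~ tangent_iso (trivial_tangent (Aff R)) (TangentStructure TOmega).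
Proof.
move=> R1 [alpha [alpha_iso alpha_h]]; apply: R1.
have m := TOmega_comates.
have zp A : tan_z TOmega A ∘ tan_p TOmega A = idm _.
  have az : alpha A = tan_z TOmega A.
    by have [_ <- _ _ _] := alpha_h A; rewrite [RHS]comp_idr.
  have [[pz _] _ _ _] := tan_monoid TOmega A.
  have [b [ba ab]] := alpha_iso A.
  have <- : b = tan_p TOmega A.
    by rewrite -[b]comp_idl -pz -compA -az ab comp_idr.
  by rewrite -az.
pose X : Aff R := base_alg R.
have e : tau_p X ∘ tau_z X = idm (E X).
  have := cm_z m (tan_p TOmega (E X) ∘ sharp (kaehler_adj R) (idm (E X))).
  by rewrite compA zp comp_idl sharpK (cm_p m) sharpK comp_idl.
have := congr1 (fun f => ap f (tens (eps R) 1)) e.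
rewrite ap_id; ap_comps; rewrite tau_p_eps tau_zE tens0r.
move/(congr1 (@gen_coef R 1 (base_alg R) ord0)).
by rewrite gen_coef0 gen_coef_gen => ->.
Qed.

End TOmega.

(** * The structure that a tangent structure induces on a left adjoint *)

Section LawsOfComates.
Variables (C : category) (t : tangent_structure C).
Local Notation T := (tan_T t).
Variables (F : functor C C) (a : adjunction F T).
Variables (tp : forall X : C, hom X (F X)) (tz : forall X : C, hom (F X) X).
Variables (tl : forall X : C, hom (F (F X)) (F X)).
Variables (tc : forall X : C, hom (F (F X)) (F (F X))).
Hypothesis m : comates a tp tz tl tc.

Let unit2 X : hom X (T (T (F (F X)))) := sharp a (sharp a (idm (F (F X)))).
Let fl_unit2 X : flat a (flat a (unit2 X)) = idm (F (F X)).
Proof. by rewrite !sharpK. Qed.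

Section Naturality.
Variables (X Y : C) (f : hom X Y).
Let fl_unit_f : flat a (adj_unit a Y ∘ f) = fmap F f.
Proof. by rewrite flat_pre flat_unit comp_idl. Qed.

Lemma cm_p_natural : fmap F f ∘ tp X = tp Y ∘ f.
Proof.
by rewrite -fl_unit_f -(cm_p m) compA (cm_p m) flat_unit comp_idl.
Qed.

Lemma cm_z_natural : f ∘ tz X = tz Y ∘ fmap F f.
Proof.
by rewrite -(cm_z m) flat_pre -[tan_z t Y]comp_idr (cm_z m) comp_idl.
Qed.

Lemma cm_l_natural : fmap F f ∘ tl X = tl Y ∘ fmap F (fmap F f).
Proof.
rewrite -{1}fl_unit_f -(cm_l m) compA [X in flat a X]flat_pre [LHS]flat_pre (cm_l m).
by rewrite flat_unit comp_idl.
Qed.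
End Naturality.

Lemma cm_z_p X : tz X ∘ tp X = idm X.
Proof.
have [[pz _] _ _ _] := tan_monoid t X.
by rewrite -pz (cm_p m) -[tan_z t X]comp_idr (cm_z m) comp_idl.
Qed.

Lemma cm_l_p X : tl X ∘ tp (F X) = tp X ∘ tz X.
Proof.
have := congr1 (fun g => flat a (g ∘ adj_unit a X)) (tan_pl t (F X)).
rewrite -compA flat_post (cm_p m) (cm_l m) flat_unit comp_idl => ->.
by rewrite -compA (cm_z m) (cm_p m) flat_unit comp_idl.
Qed.

Lemma cm_z_l X : tz X ∘ tl X = tz X ∘ tz (F X).
Proof.
have := congr1 (fun g => flat a (flat a g)) (tan_lz t X).
rewrite (cm_l m) flat_post -[tan_z t X]comp_idr !(cm_z m) comp_idl => ->.
by rewrite comp_idr (cm_z m).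
Qed.

Lemma cm_c_p X : tc X ∘ tp (F X) = fmap F (tp X).
Proof.
have := congr1 (fun g => flat a (g ∘ unit2 X)) (tan_pc t (F (F X))).
rewrite -compA flat_post (cm_p m) (cm_c m) fl_unit2 comp_idl => ->.
by rewrite (cm_p m) flat_pre fl_unit2 comp_idl.
Qed.

Lemma cm_z_c X : fmap F (tz X) ∘ tc X = tz (F X).
Proof.
have := congr1 (fun g => flat a (flat a (g ∘ adj_unit a X))) (tan_cz t (F X)).
rewrite -compA (cm_c m) (cm_z m) flat_pre flat_unit comp_idl => ->.
by rewrite flat_post (cm_z m) flat_unit comp_idl.
Qed.

Lemma cm_c_c X : tc X ∘ tc X = idm (F (F X)).
Proof.
have := congr1 (fun g => flat a (flat a (g ∘ unit2 X))) (tan_cc t (F (F X))).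
by rewrite -compA !(cm_c m) comp_idl fl_unit2 comp_idl.
Qed.

Lemma cm_l_c X : tl X ∘ tc X = tl X.
Proof.
have := congr1 (fun g => flat a (flat a (g ∘ adj_unit a X))) (tan_cl t (F X)).
by rewrite -compA (cm_c m) (cm_l m) flat_unit comp_idl.
Qed.

End LawsOfComates.

Section AdditionOfTransposes.
Variables (C : category) (U : C -> comPzRingType).
Variable ap : forall X Y : C, hom X Y -> {rmorphism U Y -> U X}.
Hypothesis ap_comp : forall (X Y Z : C) (g : hom Y Z) (f : hom X Y) x,
  ap (g ∘ f) x = ap f (ap g x).
Variables (Pol : Type -> C) (var : forall G, G -> U (Pol G)).
Variable ev : forall G (X : C), (G -> U X) -> hom X (Pol G).
Hypothesis ev_var : forall G (X : C) (v : G -> U X) g, ap (ev v) (var g) = v g.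
Hypothesis Pol_ext : forall G (X : C) (f g : hom X (Pol G)),
  (forall i, ap f (var i) = ap g (var i)) -> f = g.

Variables (t : tangent_structure C).
Local Notation T := (tan_T t).
Variables (F : functor C C) (a : adjunction F T).
Variables (tp : forall X : C, hom X (F X)) (tz : forall X : C, hom (F X) X).
Variables (tl : forall X : C, hom (F (F X)) (F X)).
Variables (tc : forall X : C, hom (F (F X)) (F (F X))).
Hypothesis m : comates a tp tz tl tc.

Lemma comate_pz X (y : U X) : ap (tp X) (ap (tz X) y) = y.
Proof.
rewrite -ap_comp (cm_z_p m).
suff -> : y = ap (ev (fun _ : unit => y)) (var tt) by rewrite -ap_comp comp_idr.
by rewrite ev_var.
Qed.

(** The value at x of a pair of tangent vectors determines the value of their
    sum at x, because x comes from the free object on one generator. *)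
Lemma sum_value X A A' (h : hom X (T2 t A)) x (h' : hom X (T2 t A')) x' :
  (forall k, ap (flat a (fp_proj (T2 t A) k ∘ h)) x
     = ap (flat a (fp_proj (T2 t A') k ∘ h')) x') ->
  ap (flat a (tan_s t A ∘ h)) x = ap (flat a (tan_s t A' ∘ h')) x'.
Proof.
move=> e; pose S := fiber_powerF (@tan_pow C T t 2 isT).
pose j B (b : U B) : hom B (Pol unit) := ev (fun _ => b).
have jE B (b : U B) Y (g : hom Y (T2 t B)) :
    ap (flat a (tan_s t B ∘ g)) b
    = ap (flat a (tan_s t (Pol unit) ∘ (fmap S (j B b) ∘ g))) (var tt).
  have h1 := naturality (tan_s t) (j B b).
  by rewrite [in RHS](compA (tan_s t _)) -h1 -[in RHS]compA flat_post [RHS]ap_comp ev_var.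
rewrite [LHS]jE [RHS]jE; congr (ap (flat a (_ ∘ _)) _); apply: fp_ext => k.
have projS B (b : U B) Y (g : hom Y (T2 t B)) :
    fp_proj (T2 t (Pol unit)) k ∘ (fmap S (j B b) ∘ g)
    = fmap T (j B b) ∘ (fp_proj (T2 t B) k ∘ g).
  have e1 : fp_proj (T2 t (Pol unit)) k ∘ fmap S (j B b)
    = fmap T (j B b) ∘ fp_proj (T2 t B) k by apply: fp_liftE.
  by rewrite [LHS]compA e1 [RHS]compA.
rewrite !projS; apply: (flat_inj (a := a)); rewrite !flat_post.
by apply: Pol_ext => i; rewrite [LHS]ap_comp [RHS]ap_comp !ev_var.
Qed.

Let proj_p X A (h : hom X (T2 t A)) :
  tan_p t A ∘ (fp_proj (T2 t A) fst2 ∘ h) = tan_p t A ∘ (fp_proj (T2 t A) snd2 ∘ h).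
Proof. by rewrite !compA (fp_projE (T2 t A) fst2 snd2). Qed.

Lemma sum_unitl X A (h : hom X (T2 t A)) x :
  ap (flat a (pi1 t A ∘ h)) x = ap (tz X) (ap (tp X) (ap (flat a (pi2 t A ∘ h)) x)) ->
  ap (flat a (tan_s t A ∘ h)) x = ap (flat a (pi2 t A ∘ h)) x.
Proof.
move=> e; have [[pz _] [u [u1 u2] su] _ _] := tan_monoid t A.
have -> : ap (flat a (pi2 t A ∘ h)) x = ap (flat a (tan_s t A ∘ (u ∘ (pi2 t A ∘ h)))) x.
  by rewrite (compA (tan_s t A)) su comp_idl.
apply: sum_value; apply: ord2P; last by rewrite (compA _ u) u2 comp_idl.
rewrite (compA _ u) u1 -[in RHS]compA (cm_z m) (cm_p m).
by rewrite (ap_comp _ (tz X)) (ap_comp _ (tp X)).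
Qed.

(** The two pairs are related by the symmetry of T_2. *)
Lemma sum_comm X A (h h' : hom X (T2 t A)) x :
  ap (flat a (pi1 t A ∘ h)) x = ap (flat a (pi2 t A ∘ h')) x ->
  ap (flat a (pi2 t A ∘ h)) x = ap (flat a (pi1 t A ∘ h')) x ->
  ap (flat a (tan_s t A ∘ h)) x = ap (flat a (tan_s t A ∘ h')) x.
Proof.
move=> e1 e2; have [_ _ [u [u1 u2] su] _] := tan_monoid t A.
rewrite -[in RHS]su -[in RHS]compA.
apply: sum_value; apply: ord2P; first by rewrite (compA _ u) u1.
by rewrite (compA _ u) u2.
Qed.

Lemma sum_unitr X A (h : hom X (T2 t A)) x :
  ap (flat a (pi2 t A ∘ h)) x = ap (tz X) (ap (tp X) (ap (flat a (pi1 t A ∘ h)) x)) ->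
  ap (flat a (tan_s t A ∘ h)) x = ap (flat a (pi1 t A ∘ h)) x.
Proof.
move=> e; have [h' [h1 h2]] := fp2_lift (T2 t A) (esym (proj_p h)).
rewrite (@sum_comm _ _ h h') /pi1 /pi2 ?h1 ?h2 //.
rewrite sum_unitl /pi1 /pi2 ?h1 ?h2 //.
Qed.

(** Families of values, indexed by G, are realized on the free object on G. *)
Lemma pair_of_values G X (v1 v2 : G -> U (F X)) :
  (forall g, ap (tp X) (v1 g) = ap (tp X) (v2 g)) ->
  exists h : hom X (T2 t (Pol G)),
    flat a (pi1 t _ ∘ h) = ev v1 /\ flat a (pi2 t _ ∘ h) = ev v2.
Proof.
move=> e; have [|h [h1 h2]] := fp2_lift (f := sharp a (ev v1)) (g := sharp a (ev v2))
    (T2 t (Pol G)).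
  rewrite !(cm_p m) !sharpK; apply: Pol_ext => g.
  by rewrite !ap_comp !ev_var e.
by exists h; rewrite /pi1 /pi2 h1 h2 !sharpK.
Qed.

(** With w = z p y1 = z p y2, the pair (y1, y2) is the sum of (y1, w) and
    (0, y2 - w), whose values under s are given by the unit laws; both pairs are
    coordinates of one map from the free object on two generators. *)
Lemma comates_additive_sum : additive_sum ap a.
Proof.
move=> X A h x; set y1 := ap (flat a (pi1 t A ∘ h)) x.
set y2 := ap (flat a (pi2 t A ∘ h)) x; set w := ap (flat a (tan_z t A ∘ _)) x.
have wE : w = ap (tz X) (ap (tp X) y1).
  by rewrite /w (cm_z m) (cm_p m) (ap_comp _ (tz X)) (ap_comp _ (tp X)).
have pw : ap (tp X) w = ap (tp X) y1 by rewrite wE comate_pz.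
have p12 : ap (tp X) y1 = ap (tp X) y2.
  by rewrite /y1 /y2 -!ap_comp -!(cm_p m) proj_p.
pose v1 b := if b then y1 else 0; pose v2 b := if b then w else y2 - w.
have [|k [k1 k2]] := @pair_of_values bool X v1 v2.
  by case; rewrite /= ?pw // rmorph0 rmorphB pw p12 subrr.
have -> : ap (flat a (tan_s t A ∘ h)) x
    = ap (flat a (tan_s t _ ∘ k)) (var true + var false).
  apply: sum_value; apply: ord2P.
    by rewrite k1 rmorphD !ev_var addr0.
  by rewrite k2 rmorphD !ev_var addrC subrK.
rewrite rmorphD sum_unitr; last by rewrite k1 k2 !ev_var.
rewrite sum_unitl k1 k2 !ev_var /=; last by rewrite rmorphB pw p12 subrr rmorph0.
by rewrite addrA.
Qed.

(** As s is a ring map, y1 y2 = s(y1, 0) s(0, y2) = s(y1 0, 0 y2) = s(0, 0)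
    = 0. *)
Lemma kernel_mul0 X (y1 y2 : U (F X)) :
  ap (tp X) y1 = 0 -> ap (tp X) y2 = 0 -> y1 * y2 = 0.
Proof.
move=> e1 e2; pose v1 b := if b then y1 else 0; pose v2 b := if b then 0 else y2.
have [|k [k1 k2]] := @pair_of_values bool X v1 v2.
  by case; rewrite /= ?e1 ?e2 rmorph0.
have q12 b : ap (tp X) (v1 b) = 0.
  by case: b; rewrite //= rmorph0.
have s1 : ap (flat a (tan_s t _ ∘ k)) (var true) = y1.
  rewrite sum_unitr ?k1 ?k2 ?ev_var // q12.
  by rewrite rmorph0.
have s2 : ap (flat a (tan_s t _ ∘ k)) (var false) = y2.
  by rewrite sum_unitl ?k1 ?k2 ?ev_var //= e2 rmorph0.
rewrite -s1 -s2 -rmorphM comates_additive_sum k1 k2 !rmorphM !ev_var /=.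
rewrite mulr0 mul0r add0r (cm_z m) (cm_p m) k1.
rewrite !(ap_comp _ (tz X)) !(ap_comp _ (tp X)) !ev_var /=.
by rewrite !rmorph0 mulr0 subr0.
Qed.

Lemma universal_map_value X A (h : hom X (T2 t A)) x
    (u : hom (T2 t A) (T (T2 t A))) :
  fmap T (pi1 t A) ∘ u = tan_l t A ∘ pi1 t A ->
  fmap T (pi2 t A) ∘ u = tan_z t (T A) ∘ pi2 t A ->
  ap (flat a (flat a (fmap T (tan_s t A) ∘ u ∘ h))) x
  = ap (tl X) (ap (flat a (pi1 t A ∘ h)) x)
    + ap (fmap F (tz X)) (ap (flat a (pi2 t A ∘ h)) x)
    - ap (tz (F X)) (ap (tz X) (ap (tp X) (ap (flat a (pi1 t A ∘ h)) x))).
Proof.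
move=> u1 u2; rewrite -(compA (fmap T (tan_s t A))) flat_post comates_additive_sum.
rewrite (cm_z m) (cm_p m) -!flat_post (compA _ u) u1 (compA _ u) u2.
rewrite -!(compA _ _ h) (cm_l m) (cm_z m) [flat a (_ ∘ tz X)]flat_pre.
move: (flat a (pi1 t A ∘ h)) (flat a (pi2 t A ∘ h)) => f1 f2; rewrite !ap_comp.
by rewrite -(ap_comp (tl X)) (cm_l_p m) ap_comp.
Qed.

(** An element y of F (F X) is a map from F (F X) to the free object on one
    generator, to which the pullback property applies. *)
Lemma lift_exists X (y : U (F (F X))) : ap (tp (F X)) y = 0 ->
  exists y1 y2, [/\ ap (tp X) y1 = 0, ap (tp X) y2 = 0
    & y = ap (tl X) y1 + ap (fmap F (tz X)) y2].
Proof.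
move=> y0; pose A := Pol unit; have [u [u1 u2] [_ pb]] := tan_universal t A.
pose r1 := sharp a (sharp a (ev (fun _ : unit => y))).
pose r2 : hom X A := ev (fun _ : unit => 0).
have [|h [[h1 h2] _]] := pb X r1 r2.
  apply: (flat_inj (a := a)); rewrite flat_post (cm_z m) (cm_p m) !sharpK.
  by apply: Pol_ext => i; rewrite !ap_comp !ev_var y0 rmorph0.
have p1 : ap (tp X) (ap (flat a (pi1 t A ∘ h)) (var tt)) = 0.
  by rewrite -ap_comp -(cm_p m) compA h2 ev_var.
have p2 : ap (tp X) (ap (flat a (pi2 t A ∘ h)) (var tt)) = 0.
  by rewrite -ap_comp -(cm_p m) -proj_p compA h2 ev_var.
exists (ap (flat a (pi1 t A ∘ h)) (var tt)), (ap (flat a (pi2 t A ∘ h)) (var tt)).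
split=> //.
have := universal_map_value h (var tt) u1 u2; rewrite h1 !sharpK ev_var p1 !rmorph0 subr0.
by [].
Qed.

Lemma lift_unique X (y y' : U (F X)) : ap (tp X) y = 0 -> ap (tp X) y' = 0 ->
  ap (tl X) y = ap (tl X) y' -> y = y'.
Proof.
move=> y0 y'0 e; pose A := Pol unit; have [u [u1 u2] [sq pb]] := tan_universal t A.
have mk z : ap (tp X) z = 0 -> exists h : hom X (T2 t A),
    flat a (pi1 t A ∘ h) = ev (fun=> z) /\ flat a (pi2 t A ∘ h) = ev (fun=> 0).
  by move=> z0; apply: pair_of_values => _; rewrite z0 rmorph0.
have [h [h1 h2]] := mk y y0; have [h' [h'1 h'2]] := mk y' y'0.
suff hh : h = h'.
  by have := h1; rewrite hh h'1 => /(congr1 (fun g => ap g (var tt))); rewrite !ev_var.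
have ph z (k : hom X (T2 t A)) : ap (tp X) z = 0 -> flat a (pi1 t A ∘ k) = ev (fun=> z) ->
    tan_p t A ∘ pi1 t A ∘ k = ev (fun=> 0).
  move=> z0 kz; rewrite -compA (cm_p m) kz; apply: Pol_ext => i.
  by rewrite !ap_comp !ev_var z0.
have [|k [_ ku]] := pb X (fmap T (tan_s t A) ∘ u ∘ h) (tan_p t A ∘ pi1 t A ∘ h).
  by rewrite !(compA _ _ h) sq.
rewrite -(ku h) //; apply: ku; split; last by rewrite (ph y') // (ph y).
do 2! apply: (flat_inj (a := a)); apply: Pol_ext; case.
by rewrite !universal_map_value // h1 h2 h'1 h'2 !ev_var e y0 y'0.
Qed.

End AdditionOfTransposes.

(** * The representing algebra over a principal ideal domain *)

Section RepresentingAlgebra.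
Variables (R : comPzRingType) (D : calg R).
Local Notation P := (aff_products R).
Local Notation F := (prod_functor P D).
Local Notation "x · y" := (tens x y) (at level 35, right associativity).
Local Notation base := (base_alg R).

Variables (tp : forall X : Aff R, hom X (F X)) (tz : forall X : Aff R, hom (F X) X).
Variables (tl : forall X : Aff R, hom (F (F X)) (F X)).
Variables (tc : forall X : Aff R, hom (F (F X)) (F (F X))).
Hypothesis p_natural : forall (X Y : Aff R) (f : hom X Y),
  fmap F f ∘ tp X = tp Y ∘ f.
Hypothesis z_natural : forall (X Y : Aff R) (f : hom X Y),
  f ∘ tz X = tz Y ∘ fmap F f.
Hypothesis l_natural : forall (X Y : Aff R) (f : hom X Y),
  fmap F f ∘ tl X = tl Y ∘ fmap F (fmap F f).
Hypothesis z_p : forall X, tz X ∘ tp X = idm X.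
Hypothesis l_p : forall X, tl X ∘ tp (F X) = tp X ∘ tz X.
Hypothesis z_l : forall X, tz X ∘ tl X = tz X ∘ tz (F X).
Hypothesis c_p : forall X, tc X ∘ tp (F X) = fmap F (tp X).
Hypothesis z_c : forall X, fmap F (tz X) ∘ tc X = tz (F X).
Hypothesis c_c : forall X, tc X ∘ tc X = idm (F (F X)).
Hypothesis l_c : forall X, tl X ∘ tc X = tl X.
Hypothesis ker_mul0 : forall (X : calg R) (y1 y2 : tensor D X),
  ap (tp X) y1 = 0 -> ap (tp X) y2 = 0 -> y1 * y2 = 0.
Hypothesis l_exists : forall (X : calg R) (y : tensor D (tensor D X)),
  ap (tp (F X)) y = 0 ->
  exists y1 y2 : tensor D X, [/\ ap (tp X) y1 = 0, ap (tp X) y2 = 0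
    & y = ap (tl X) y1 + ap (fmap F (tz X)) y2].
Hypothesis l_unique : forall (X : calg R) (y y' : tensor D X),
  ap (tp X) y = 0 -> ap (tp X) y' = 0 -> ap (tl X) y = ap (tl X) y' -> y = y'.
Variables (W : calg R) (w : tensor D W).
Hypothesis w_exists : forall (X : calg R) (y : tensor D X),
  exists f : calg_hom W X, tmap (calg_id D) f w = y.
Hypothesis w_unique : forall (X : calg R) (f g : calg_hom W X),
  tmap (calg_id D) f w = tmap (calg_id D) g w -> f = g.

Let apF (X Y : calg R) (f : calg_hom X Y) (d : D) (x : X) :
  ap (fmap F (f : @hom (Aff R) Y X)) (d · x) = d · f x.
Proof. exact: ap_prodF. Qed.

Let p_nat (X Y : calg R) (f : calg_hom X Y) (y : tensor D X) :
  ap (tp Y) (ap (fmap F (f : @hom (Aff R) Y X)) y) = f (ap (tp X) y).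
Proof. by rewrite -ap_comp p_natural. Qed.

Let z_nat (X Y : calg R) (f : calg_hom X Y) (x : X) :
  ap (tz Y) (f x) = ap (fmap F (f : @hom (Aff R) Y X)) (ap (tz X) x).
Proof.
by rewrite -[LHS]/(ap ((f : @hom (Aff R) Y X) ∘ tz Y) x) z_natural.
Qed.

Let pzK (X : calg R) (x : X) : ap (tp X) (ap (tz X) x) = x.
Proof. by rewrite -ap_comp z_p. Qed.

Definition augmentation (d : D) : R := ap (tp base) (d · (1 : base)).
Local Notation pi := augmentation.

Lemma pi_sub d d' : pi (d - d') = pi d - pi d'.
Proof. by rewrite /augmentation tensBl rmorphB. Qed.

Lemma pi_str r : pi (calg_str D r) = r.
Proof. by rewrite /augmentation inl_str; apply: (ap_str (tp base) r). Qed.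

Lemma piZ r d : pi (calg_str D r * d) = r * pi d.
Proof. by rewrite /augmentation tensZl rmorphM; congr (_ * _); apply: (ap_str (tp base) r). Qed.

Lemma p_tens1 (X : calg R) d : ap (tp X) (d · (1 : X)) = calg_str X (pi d).
Proof.
rewrite -[RHS](p_nat (str_hom X)); congr (ap _ _).
by rewrite apF rmorph1.
Qed.

Lemma tensor_dual_span n (y : tensor D (dual R n)) : exists d0 (d : 'I_n -> D),
  y = d0 · 1 + \sum_i d i · dual_gen R i.
Proof.
have := dual_tensor_coef (tswap _ _ y); set c := cst_coef _.
move/(congr1 (tswap _ _)); rewrite tswapK rmorphD tswapE => ->.
exists c, (fun i => gen_coef i (tswap _ _ y)); congr (_ + _).
rewrite (big_morph _ (rmorphD (tswap _ D)) (rmorph0 _)).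
by apply: eq_bigr => i _; rewrite tswapE.
Qed.

Lemma tensor_dual_inj n (d0 : D) (d : 'I_n -> D) :
  d0 · (1 : dual R n) + \sum_i d i · dual_gen R i = 0 ->
  d0 = 0 /\ forall i, d i = 0.
Proof.
move/(congr1 (tswap _ _)); rewrite rmorph0 rmorphD tswapE.
rewrite (big_morph _ (rmorphD (tswap D _)) (rmorph0 _)).
under eq_bigr do rewrite tswapE.
move=> e; split=> [|i].
  have := congr1 (@cst_coef R n D) e.
  by rewrite cst_coefD cst_coef_cst cst_coef_sum cst_coef0 addr0.
have := congr1 (@gen_coef R n D i) e.
by rewrite gen_coefD gen_coef_cst gen_coef_sum gen_coef0 add0r.
Qed.

Section EpsTimes.
Variables (X : calg R) (x : X).

Fact eps_times_mul0 : (eps R · x) * (eps R · x) = 0.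
Proof. by rewrite -tensM dual_gen_mul tens0l. Qed.

Definition eps_times : calg_hom (Reps R) (tensor (Reps R) X) :=
  dual_hom (fun _ _ => eps_times_mul0).

Lemma eps_timesE : eps_times (eps R) = eps R · x.
Proof. exact: dual_homE. Qed.
End EpsTimes.

Lemma eps_tens_inj (X : calg R) (x x' : X) : eps R · x = eps R · x' -> x = x'.
Proof.
by move/(congr1 (@gen_coef R 1 X ord0)); rewrite !gen_coef_gen !mulr1n.
Qed.

Lemma z_eps : exists d1 : D, ap (tz (Reps R)) (eps R) = d1 · eps R.
Proof.
have [d0 [d e]] := tensor_dual_span (ap (tz (Reps R)) (eps R)).
rewrite big_ord1 in e; exists (d ord0).
have := z_nat (dual_p R) (eps R).
rewrite e rmorphD !apF rmorph1 dual_homE tens0r addr0 rmorph0 => h.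
have -> : d0 = 0 by apply: (@tens1_inj R D); rewrite tens0l.
by rewrite tens0l add0r.
Qed.

Lemma p_eps : exists r1 : R, ap (tp (Reps R)) (1 · eps R) = calg_str (Reps R) r1 * eps R.
Proof.
have [r0 [r e]] := dual_span (ap (tp (Reps R)) (1 · eps R)).
rewrite big_ord1 in e; exists (r ord0).
have := p_nat (dual_p R) (1 · eps R).
rewrite apF dual_homE tens0r rmorph0 e rmorphD rmorphM !chom_str dual_homE.
rewrite mulr0 addr0 => h.
by rewrite -[r0]/(calg_str base r0) -h rmorph0 add0r.
Qed.

(** The map phi : x |-> p(1 (x) x) is a natural endomorphism of the identity, so
    phi(eps) = r1 eps for a scalar r1, a unit because p z = id. Naturality along
    eps |-> eps x gives r1 eps x = phi(eps x) = r1 eps phi(x). *)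
Lemma p_cst (X : calg R) (x : X) : ap (tp X) (1 · x) = x.
Proof.
have [d1 ze] := z_eps; have [r1 pe] := p_eps.
have unit1 : calg_str (Reps R) (pi d1 * r1) * eps R = eps R.
  rewrite -[RHS](pzK (X := Reps R) (eps R)) ze tens_split [RHS]rmorphM.
  by rewrite [X in _ = X * _]p_tens1 pe mulrA -rmorphM.
have unit y : calg_str _ (pi d1 * r1) * (eps R · y) = eps R · y :> tensor _ X.
  by rewrite -eps_timesE -{1}(chom_str (eps_times y)) -rmorphM unit1.
have pY y : ap (tp (tensor (Reps R) X)) (1 · eps R · y) = calg_str _ r1 * (eps R · y).
  rewrite -eps_timesE -(apF (eps_times y)) p_nat pe rmorphM chom_str eps_timesE.
  by [].
have inr_tens y : tens_inr (Reps R) X y = 1 · y by [].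
have key : calg_str _ r1 * (eps R · ap (tp X) (1 · x))
    = calg_str _ r1 * (eps R · x) :> tensor (Reps R) X.
  have e : (1 : D) · eps R · x = (1 · eps R · 1) * (1 · tens_inr (Reps R) X x).
    by rewrite -tensM mulr1 inr_tens -tensM mulr1 mul1r.
  rewrite -[RHS]pY e [RHS]rmorphM pY -(apF (tens_inr (Reps R) X)) p_nat inr_tens.
  by rewrite -mulrA -tensM mulr1 mul1r.
apply: eps_tens_inj; rewrite -[LHS]unit -[RHS]unit !rmorphM -!mulrA.
by rewrite key.
Qed.

(** The difference of z and x |-> 1 (x) x is a natural derivation into the
    square-zero kernel of p. Writing z(eps x) = d1 (x) eps x, once by naturality
    and once as z(eps) z(x), shows that eps annihilates it. *)
Lemma z_cst (X : calg R) (x : X) : ap (tz X) x = 1 · x.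
Proof.
have [d1 ze] := z_eps; set del := ap (tz X) x - 1 · x.
have del_ker : ap (tp X) del = 0 by rewrite rmorphB pzK p_cst subrr.
have zY y : ap (tz (tensor (Reps R) X)) (eps R · y) = d1 · eps R · y.
  by rewrite -eps_timesE z_nat ze apF eps_timesE.
have inr_tens y : tens_inr (Reps R) X y = 1 · y by [].
pose E := fmap F (tens_inr (Reps R) X : @hom (Aff R) _ X).
have prod0 : (d1 · eps R · 1) * ap E del = 0.
  have e1 : (d1 · eps R · 1) * ap E (ap (tz X) x) = d1 · eps R · x.
    rewrite -zY -[ap E _](z_nat (tens_inr (Reps R) X)) -rmorphM inr_tens.
    by rewrite -tensM mulr1 mul1r zY.
  have e2 : (d1 · eps R · 1) * ap E (1 · x) = d1 · eps R · x.
    by rewrite apF inr_tens -tensM mulr1 -tensM mulr1 mul1r.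
  by rewrite rmorphB mulrBr e1 e2 subrr.
have prod1 : ((d1 - 1) · eps R · (1 : X)) * ap E del = 0.
  apply: ker_mul0; last by rewrite p_nat del_ker rmorph0.
  by rewrite tensBl rmorphB p_cst -zY pzK subrr.
have prod2 : ((1 : D) · eps R · (1 : X)) * ap E del = 0.
  have e : (1 : D) · eps R · (1 : X) = d1 · eps R · 1 - (d1 - 1) · eps R · 1.
    by rewrite -tensBl subKr.
  by rewrite e mulrBl prod0 prod1 subrr.
have shuf y : tshuffle D (Reps R) X (ap E y) = 1 · y.
  rewrite -[LHS]/(calg_comp (tshuffle D (Reps R) X) (E : calg_hom _ _) y).
  rewrite -[RHS]/(tens_inr (Reps R) (tensor D X) y).
  congr ((_ : calg_hom _ _) y); apply: tensor_ext => d b.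
  by rewrite -[LHS]/(tshuffle D (Reps R) X (ap E (d · b))) apF tshuffleE.
have := congr1 (tshuffle D (Reps R) X) prod2.
rewrite rmorphM shuf tshuffleE rmorph0 tens11 -tensM mulr1 mul1r.
rewrite -(tens0r (tensor D X) (eps R)) => /eps_tens_inj /eqP.
by rewrite subr_eq0 => /eqP.
Qed.

Lemma p_tens (X : calg R) d (x : X) : ap (tp X) (d · x) = calg_str X (pi d) * x.
Proof. by rewrite tens_split rmorphM p_tens1 p_cst. Qed.

Lemma c_tens (X : calg R) d d' (x : X) : ap (tc X) (d · d' · x) = d' · d · x.
Proof.
have c1 y (b : X) : ap (tc X) (y · 1 · b) = 1 · y · b.
  have := congr1 (fun f => ap f (y · b)) (z_c X).
  by rewrite !ap_comp ap_prodF !z_cst.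
have c2 y (b : X) : ap (tc X) (1 · y · b) = y · 1 · b.
  by rewrite -c1 -ap_comp c_c.
have -> : d · d' · x = (d · 1 · 1) * (1 · d' · x).
  by rewrite -tensM mulr1 -tensM !mul1r.
by rewrite rmorphM c1 c2 -tensM mul1r -tensM mulr1 mul1r.
Qed.

Lemma l_cst (X : calg R) (x : X) : ap (tl X) (1 · x) = 1 · 1 · x.
Proof. by rewrite -z_cst -ap_comp z_l ap_comp !z_cst. Qed.

Lemma l_tens1 (X : calg R) d : ap (tl X) (d · (1 : X))
  = tmap (calg_id D) (tmap (calg_id D) (str_hom X)) (ap (tl base) (d · (1 : base))).
Proof.
have := congr1 (fun f => ap f (d · (1 : base))) (l_natural (str_hom X : @hom (Aff R) X base)).
by rewrite !ap_comp ap_prodF rmorph1 => <-.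
Qed.

(** The kernel of both augmentations of D (x) D (x) X is the image under l of
    the kernel of p. *)
Lemma l_onto (X : calg R) (y : tensor D (tensor D X)) :
  ap (tp (F X)) y = 0 -> ap (fmap F (tp X)) y = 0 ->
  exists2 y1, ap (tp X) y1 = 0 & y = ap (tl X) y1.
Proof.
move=> y0 y0'; have [y1 [y2 [p1 p2 e]]] := l_exists y0; exists y1 => //.
have pl : ap (fmap F (tp X)) (ap (tl X) y1) = 0.
  by rewrite -c_p ap_comp -(ap_comp (tl X)) l_c -ap_comp l_p ap_comp p1 rmorph0.
move: y0'; rewrite e rmorphD pl add0r -ap_comp -fmap_comp z_p fmap_id ap_id => ->.
by rewrite rmorph0 addr0.
Qed.

(** x (x) y lies in the image of l, which is fixed by the swap c. *)
Lemma ker_swap (x y : D) : pi x = 0 -> pi y = 0 -> x · y = y · x.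
Proof.
move=> x0 y0; pose v : tensor D (tensor D base) := x · y · 1.
have [||y1 y10 e] := @l_onto base v.
- by rewrite /v p_tens x0 rmorph0 mul0r.
- by rewrite /v ap_prodF p_tens y0 rmorph0 mul0r tens0r.
have cv : ap (tc base) v = v by rewrite e -ap_comp l_c.
move: cv; rewrite /v c_tens => /(congr1 (tmap (calg_id D) (tunit D))).
by rewrite !tmapE !tunitE !rmorph1 !mul1r => <-.
Qed.

Lemma ker_mul (x y : D) : pi x = 0 -> pi y = 0 -> x * y = 0.
Proof.
move=> x0 y0; apply: (@tens1_inj R D); rewrite tens0l -[X in _ · X](mulr1 (1 : base)) tensM.
by apply: ker_mul0; rewrite p_tens ?x0 ?y0 rmorph0 mul0r.
Qed.

(** The universal element w is a finite sum of tensors, and every element of D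
    is the image of w under a map applied to the second factors. *)
Lemma algebra_span : exists s : seq D, forall d, exists c : nat -> R,
  d = \sum_(i < size s) calg_str D (c i) * s`_i.
Proof.
have [u uE] := tens_span w; exists (map fst u) => d.
have [f fE] := w_exists (d · (1 : base)).
exists (fun i => f (nth (0, 0) u i).2).
apply: (@tens1_inj R D); rewrite -fE uE size_map.
rewrite (big_morph _ (rmorphD (tmap (calg_id D) f)) (rmorph0 _)) tens_suml.
rewrite (big_nth (0, 0)) big_mkord; apply: eq_bigr => i _.
by rewrite tmapE (nth_map (0, 0)) // tensZl -tensZr mulr1.
Qed.

(** Representability makes D flat: D (x) - preserves injections. *)
Lemma tmap_inj (X Y : calg R) (f : calg_hom X Y) :
  injective f -> injective (tmap (calg_id D) f).
Proof.
move=> f_inj y y' e; have [g gE] := w_exists y; have [g' g'E] := w_exists y'.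
rewrite -{}gE -{}g'E in e *; congr (tmap (calg_id D) _ w).
have comp_tmap h : tmap (calg_id D) f (tmap (calg_id D) h w)
    = tmap (calg_id D) (calg_comp f h) w.
  rewrite -[LHS]/(calg_comp (tmap (calg_id D) f) (tmap (calg_id D) h) w).
  congr ((_ : calg_hom _ _) w); apply: tensor_ext => d b.
  by rewrite -[LHS]/(tmap (calg_id D) f (tmap (calg_id D) h (d · b))) !tmapE.
have /w_unique ee : tmap (calg_id D) (calg_comp f g) w
    = tmap (calg_id D) (calg_comp f g') w by rewrite -!comp_tmap.
apply: calg_hom_ext => b; apply: f_inj.
exact: (congr1 (fun h : calg_hom W Y => h b) ee).
Qed.

Lemma piD d d' : pi (d + d') = pi d + pi d'.
Proof. by rewrite /augmentation tensDl rmorphD. Qed.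

Lemma pi0 : pi 0 = 0.
Proof. by rewrite /augmentation tens0l rmorph0. Qed.

Lemma pi_sum n (d : 'I_n -> D) : pi (\sum_i d i) = \sum_i pi (d i).
Proof. exact: (big_morph _ piD pi0). Qed.

Lemma dual_hom_inj n (S : calg R) (x : 'I_n -> S)
    (x_mul0 : forall i j, x i * x j = 0) :
  (forall (r : R) (f : 'I_n -> R),
    calg_str S r + \sum_i calg_str S (f i) * x i = 0 ->
    r = 0 /\ forall i, f i = 0) ->
  injective (dual_hom x_mul0).
Proof.
move=> x_free a b e; apply/eqP; rewrite -subr_eq0; apply/eqP.
have : dual_hom x_mul0 (a - b) = 0 by rewrite rmorphB e subrr.
have [r [f ->]] := dual_span (a - b).
rewrite rmorphD chom_str (big_morph _ (rmorphD (dual_hom x_mul0)) (rmorph0 _)).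
under eq_bigr do rewrite rmorphM chom_str dual_homE.
move/x_free => [-> f0]; rewrite rmorph0 add0r big1 // => i _.
by rewrite f0 rmorph0 mul0r.
Qed.

Lemma dual_free n (r : R) (f : 'I_n -> R) :
  calg_str (dual R n) r + \sum_i calg_str (dual R n) (f i) * dual_gen R i = 0 ->
  r = 0 /\ forall i, f i = 0.
Proof.
move/(congr1 (fun y => tens y (1 : base))); rewrite tens0l tensDl tens_suml.
rewrite -[calg_str _ r]mulr1 tensZl -tensZr mulr1.
under eq_bigr do rewrite tensZl -tensZr mulr1.
move=> e; split=> [|i].
  have := congr1 (@cst_coef R n base) e.
  by rewrite cst_coefD cst_coef_cst cst_coef_sum cst_coef0 addr0.
have := congr1 (@gen_coef R n base i) e.
by rewrite gen_coefD gen_coef_cst gen_coef_sum gen_coef0 add0r.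
Qed.

Hypothesis R_domain : forall a b : R, a * b = 0 -> a = 0 \/ b = 0.
Hypothesis R_one : (1 : R) <> 0.

(** For nonzero a the map eps |-> a eps embeds R[eps] into itself, and D is flat. *)
Lemma torsion_free (a : R) (x : D) : a <> 0 -> calg_str D a * x = 0 -> x = 0.
Proof.
move=> a0 ax.
have mul0 (i j : 'I_1) :
    calg_str (Reps R) a * eps R * (calg_str (Reps R) a * eps R) = 0.
  by rewrite mulrACA dual_gen_mul mulr0.
have inj : injective (dual_hom mul0).
  apply: dual_hom_inj => r f; rewrite big_ord1 mulrA -rmorphM.
  have := @dual_free 1 r (fun i => f i * a); rewrite big_ord1 => h /h [-> fa].
  split=> // i; have [//|/a0//] := R_domain (fa i).
have : tmap (calg_id D) (dual_hom mul0) (x · eps R) = tmap (calg_id D) (dual_hom mul0) 0.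
  rewrite tmapE [X in _ · X]dual_homE rmorph0 /=.
  by rewrite tensZr -tensZl ax tens0l.
move/(tmap_inj inj) => xe; have [|_ h] := @tensor_dual_inj 1 0 (fun=> x).
  by rewrite big_ord1 tens0l add0r.
exact: h ord0.
Qed.

(** Two independent x, y in the kernel would embed R[eps_1, eps_2] into D, and
    x (x) y = y (x) x would force x (x) eps_2 = y (x) eps_1. *)
Lemma ker_dependent (x y : D) : pi x = 0 -> pi y = 0 ->
  exists a b, (a <> 0 \/ b <> 0) /\ calg_str D a * x = calg_str D b * y.
Proof.
move=> x0 y0; apply: contrapT => nd.
have indep a b : calg_str D a * x = calg_str D b * y -> a = 0 /\ b = 0.
  by move=> e; split; apply: contrapT => h; apply: nd; exists a, b; split=> //; [left|right].
pose v (i : 'I_2) := if i == fst2 then x else y.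
have v0 i : pi (v i) = 0 by rewrite /v; case: ifP.
have v_mul0 i j : v i * v j = 0 by apply: ker_mul.
have inj : injective (dual_hom v_mul0).
  apply: dual_hom_inj => r f e; have r0 : r = 0.
    have := congr1 augmentation e; rewrite pi0 piD pi_str pi_sum big1 ?addr0 // => i _.
    by rewrite piZ v0 mulr0.
  split=> //; move: e; rewrite r0 rmorph0 add0r big_ord_recl big_ord1 /v /=.
  move/eqP; rewrite addr_eq0 -mulNr -rmorphN => /eqP/indep [f0 f1].
  by apply: ord2P; [rewrite -f0|rewrite -[RHS]oppr0 -f1 opprK];
    congr f; apply: val_inj.
have : x · dual_gen R snd2 = y · dual_gen R fst2.
  by apply: (tmap_inj inj); rewrite !tmapE !dual_homE; apply: ker_swap.
move/eqP; rewrite -subr_eq0 -tensNl => /eqP e.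
have [|_ /(_ snd2) /= xe] := @tensor_dual_inj 2 0 (fun i => if i == snd2 then x else - y).
  rewrite tens0l add0r big_ord_recl big_ord1.
  have -> : lift ord0 ord0 = snd2 by apply: val_inj.
  by rewrite /= addrC.
have [one0 _] : 1 = 0 :> R /\ 0 = 0 :> R.
  by apply: indep; rewrite xe mulr0 rmorph0 mul0r.
exact: R_one.
Qed.

Hypothesis R_pid : forall I : R -> Prop,
    I 0 -> (forall x y, I x -> I y -> I (x + y)) ->
    (forall a x, I x -> I (a * x)) ->
  exists g, forall x, I x <-> exists a, x = a * g.

(** From a x = b y with gcd d = p a + q b, a = a' d and b = b' d, the generator
    q x + p y has x and y as its multiples by b' and a'. *)
Lemma ker_pair_principal (x y : D) : pi x = 0 -> pi y = 0 ->
  exists g, [/\ pi g = 0, exists c, x = calg_str D c * g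
    & exists c, y = calg_str D c * g].
Proof.
move=> x0 y0; have [a [b [ab e]]] := ker_dependent x0 y0.
have [|u v [p [q ->]] [p' [q' ->]]|c u [p [q ->]]|d dP] :=
  R_pid (I := fun u => exists p q, u = p * a + q * b).
- by exists 0, 0; rewrite !mul0r addr0.
- by exists (p + p'), (q + q'); rewrite !mulrDl addrACA.
- by exists (c * p), (c * q); rewrite mulrDr !mulrA.
have [a' aE] : exists a', a = a' * d.
  by apply/dP; exists 1, 0; rewrite mul1r mul0r addr0.
have [b' bE] : exists b', b = b' * d.
  by apply/dP; exists 0, 1; rewrite mul1r mul0r add0r.
have [p [q dE]] : exists p q, d = p * a + q * b.
  by apply/dP; exists 1; rewrite mul1r.
have d0 : d <> 0.
  by move=> d0; case: ab; apply; rewrite ?aE ?bE d0 mulr0.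
have pq : p * a' + q * b' = 1.
  have : (p * a' + q * b' - 1) * d = 0.
    by rewrite mulrBl mul1r mulrDl -!mulrA -aE -bE -dE subrr.
  by case/R_domain => // /eqP; rewrite subr_eq0 => /eqP.
have e' : calg_str D a' * x = calg_str D b' * y.
  apply/eqP; rewrite -subr_eq0; apply/eqP; apply: (torsion_free d0).
  rewrite mulrBr !mulrA -!rmorphM [d * a']mulrC [d * b']mulrC -aE -bE e.
  by rewrite subrr.
have split_one z : z = calg_str D p * (calg_str D a' * z) + calg_str D q * (calg_str D b' * z).
  by rewrite !mulrA -!rmorphM -mulrDl -rmorphD pq rmorph1 mul1r.
exists (calg_str D q * x + calg_str D p * y); split.
- by rewrite piD !piZ x0 y0 !mulr0 addr0.
- exists b'; rewrite {1}[x]split_one e' mulrDr addrC; congr (_ + _); exact: mulrCA.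
- exists a'; rewrite {1}[y]split_one -e' mulrDr addrC; congr (_ + _); exact: mulrCA.
Qed.

Lemma ker_principal : exists g, pi g = 0 /\
  forall x, pi x = 0 -> exists c, x = calg_str D c * g.
Proof.
have [s s_span] := algebra_span.
have [g [g0 gP]] : exists g, pi g = 0 /\ forall i, (i < size s)%N ->
    exists c, s`_i - calg_str D (pi s`_i) = calg_str D c * g.
  elim: (s) => [|x r [g [g0 gP]]]; first by exists 0; rewrite pi0.
  have x0 : pi (x - calg_str D (pi x)) = 0 by rewrite pi_sub pi_str subrr.
  have [h [h0 xh [c gh]]] := ker_pair_principal x0 g0.
  exists h; split=> // -[|i] //= /gP [c' ->].
  by exists (c' * c); rewrite gh mulrA rmorphM.
exists g; split=> // x x0; have [c xE] := s_span x.
have -> : x = \sum_(i < size s) calg_str D (c i) * (s`_i - calg_str D (pi s`_i)).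
  transitivity (x - calg_str D (pi x)); first by rewrite x0 rmorph0 subr0.
  rewrite xE pi_sum (big_morph _ (rmorphD (calg_str D)) (rmorph0 _)) -sumrB.
  by apply: eq_bigr => i _; rewrite mulrBr piZ rmorphM.
elim/big_ind: _ => [|u v [cu ->] [cv ->]|i _].
- by exists 0; rewrite rmorph0 mul0r.
- by exists (cu + cv); rewrite rmorphD mulrDl.
- by have [e ->] := gP i (ltn_ord i); exists (c i * e); rewrite rmorphM mulrA.
Qed.

Lemma p_inv_trivial : (forall x, pi x = 0 -> x = 0) ->
  forall (X : calg R) (y : tensor D X), ap (tz X) (ap (tp X) y) = y.
Proof.
move=> ker0 X y; have dE d : d = calg_str D (pi d) * 1.
  apply/eqP; rewrite mulr1 -subr_eq0; apply/eqP/ker0.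
  by rewrite pi_sub pi_str subrr.
have [s ->] := tens_span y; elim: s => [|[d x] s IH].
  by rewrite big_nil !rmorph0.
rewrite big_cons !rmorphD {}IH; congr (_ + _).
by rewrite p_tens z_cst [in RHS](dE d) tensZl -tensZr.
Qed.

(** In terms of the basis 1, g of D, an element killed by both augmentations has
    only its g (x) g coefficient left. *)
Lemma tens_ker_span g : pi g = 0 ->
  (forall x, pi x = 0 -> exists c, x = calg_str D c * g) ->
  forall y : tensor D (tensor D base), ap (tp (F base)) y = 0 ->
  ap (fmap F (tp base)) y = 0 ->
  exists r, y = calg_str (tensor D (tensor D base)) r * (g · g · 1).
Proof.
move=> g0 gP y.
have dE d : exists c, d = calg_str D (pi d) + calg_str D c * g.
  have [|c e] := gP (d - calg_str D (pi d)); first by rewrite pi_sub pi_str subrr.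
  by exists c; rewrite -e addrC subrK.
have [d0 [d1 ->]] : exists d0 d1, y = 1 · d0 · (1 : base) + g · d1 · (1 : base).
  have [s ->] := tens_span y; elim: s => [|[d x] s [d0 [d1 IH]]].
    by exists 0, 0; rewrite big_nil !tens0l !tens0r addr0.
  rewrite big_cons {}IH /=; have [c c_tens] := dE d.
  exists (calg_str D (pi d) * tunit D x + d0), (calg_str D c * tunit D x + d1).
  have scal1 r (z : tensor D base) : calg_str D r · z = calg_str _ r * ((1 : D) · z).
    by rewrite -tensZl mulr1.
  rewrite !tensDl !tensDr addrACA {1}c_tens tensDl; congr (_ + _ + _).
    by rewrite scal1 tensZl tunitK tensZr.
  by rewrite [LHS]tensZl [in RHS]tensZl tunitK tensZr.
have pi1 : pi 1 = 1 by rewrite -(rmorph1 (calg_str D)) pi_str.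
rewrite !rmorphD !p_tens !ap_prodF !p_tens pi1 g0 !rmorph0 mul0r addr0 rmorph1 mul1r => h.
have -> : d0 = 0 by apply: (@tens1_inj R D); rewrite tens0l.
rewrite pi0 rmorph0 mul0r tens0l !tens0r !add0r mulr1 => /(congr1 (tunit D)).
rewrite tunitE rmorph0 => pg.
have [->|gn] := pselect (g = 0).
  by exists 0; rewrite !tens0l mulr0.
have /gP [c ->] : pi d1 = 0.
  by apply: contrapT => n; apply: gn; apply: torsion_free n pg.
by exists c; rewrite tensZl tensZr.
Qed.

(** Comparing l on a generator g of the kernel with g (x) g rescales g by a
    unit to an element e with l(e) = e (x) e, as for the dual numbers. *)
Lemma ker_generator g : pi g = 0 -> g <> 0 ->
  (forall x, pi x = 0 -> exists c, x = calg_str D c * g) ->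
  exists e, [/\ pi e = 0, e <> 0, forall x, pi x = 0 -> exists c, x = calg_str D c * e
    & ap (tl base) (e · (1 : base)) = e · e · 1].
Proof.
move=> g0 gn gP.
have pg1 r : ap (tp base) ((calg_str D r * g) · (1 : base)) = 0.
  by rewrite p_tens piZ g0 mulr0 rmorph0 mul0r.
have lZ r x : ap (tl base) ((calg_str D r * x) · (1 : base))
    = calg_str _ r * ap (tl base) (x · (1 : base)).
  by rewrite tensZl rmorphM ap_str.
have pg : ap (tp base) (g · (1 : base)) = 0 by rewrite p_tens g0 rmorph0 mul0r.
have [v lg] : exists v, ap (tl base) (g · (1 : base)) = calg_str _ v * (g · g · 1).
  apply: tens_ker_span => //.
    by rewrite -ap_comp l_p ap_comp pg rmorph0.
  by rewrite -c_p ap_comp -(ap_comp (tl base)) l_c -ap_comp l_p ap_comp pg rmorph0.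
have [||y1 y10 gg] := @l_onto base (g · g · 1).
- by rewrite p_tens g0 rmorph0 mul0r.
- by rewrite ap_prodF p_tens g0 rmorph0 mul0r tens0r.
have [r rE] : exists r, tunit D y1 = calg_str D r * g.
  by apply: gP; rewrite /augmentation tunitK.
have vr : v * r = 1.
  have e : g = calg_str D (v * r) * g.
    apply: (@tens1_inj R D); apply: l_unique; rewrite ?pg1 ?pg //.
    by rewrite lg gg -[y1]tunitK rE !lZ mulrA -rmorphM.
  have : calg_str D (1 - v * r) * g = 0.
    by rewrite rmorphB rmorph1 mulrBl mul1r -e subrr.
  move=> h; apply: contrapT => n; apply: gn; apply: torsion_free h => /eqP.
  by rewrite subr_eq0 => /eqP one; apply: n.
exists (calg_str D v * g); split.
- by rewrite piZ g0 mulr0.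
- move=> vg; apply: gn; rewrite -[g]mul1r -(rmorph1 (calg_str D)) -vr.
  by rewrite rmorphM mulrAC vg mul0r.
- move=> x /gP [c ->]; exists (c * r).
  by rewrite mulrA -rmorphM -mulrA [r * v]mulrC vr mulr1.
- by rewrite lZ lg [RHS]tensZl [in RHS]tensZl tensZr.
Qed.

(** The representing algebra is R or the algebra of dual numbers. *)
Lemma representing_algebra :
  (forall (X : calg R) (y : tensor D X), ap (tz X) (ap (tp X) y) = y)
  \/ exists (f : calg_hom (Reps R) D) (k : calg_hom D (Reps R)),
    [/\ calg_comp f k = calg_id D, calg_comp k f = calg_id (Reps R),
        pi (f (eps R)) = 0
      & ap (tl base) (f (eps R) · (1 : base)) = f (eps R) · f (eps R) · 1].
Proof.
have [g [g0 gP]] := ker_principal.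
have [gz|gn] := pselect (g = 0).
  left; apply: p_inv_trivial => x /gP [c ->].
  by rewrite gz mulr0.
right; have [e [e0 en eP le]] := ker_generator g0 gn gP.
have ee (i j : 'I_1) : e * e = 0 by apply: ker_mul.
pose f : calg_hom (Reps R) D := dual_hom ee.
have f_inj : injective f.
  apply: dual_hom_inj => r c; rewrite big_ord1 => h.
  have r0 : r = 0.
    by have := congr1 augmentation h; rewrite piD pi_str piZ e0 mulr0 addr0 pi0.
  split=> // i; move: h; rewrite r0 rmorph0 add0r (ord1 i) => h.
  by apply: contrapT => n; apply: en; apply: torsion_free n h.
have f_onto x : exists b, f b = x.
  have [|c xE] := eP (x - calg_str D (pi x)); first by rewrite pi_sub pi_str subrr.
  exists (calg_str _ (pi x) + calg_str _ c * eps R).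
  by rewrite rmorphD rmorphM !chom_str dual_homE -xE addrC subrK.
have [||k /(_ tt) ke] := @joint_lift R unit D (Reps R) (fun=> D) (fun=> f) (fun=> calg_id D).
- by move=> b b' /(_ tt); apply: f_inj.
- by move=> x; have [b be] := f_onto x; exists b.
exists f, k; rewrite {3 4 5}/f dual_homE; split=> //.
apply: calg_hom_ext => b; apply: f_inj.
by rewrite -[LHS]/(calg_comp f k (f b)) ke.
Qed.

Section Comparison.
Variables (f : calg_hom (Reps R) D) (k : calg_hom D (Reps R)).
Hypothesis fk : calg_comp f k = calg_id D.
Hypothesis kf : calg_comp k f = calg_id (Reps R).
Hypothesis f_eps : pi (f (eps R)) = 0.
Hypothesis l_eps :
  ap (tl base) (f (eps R) · (1 : base)) = f (eps R) · f (eps R) · 1.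
Local Notation E := (prod_functor P (Reps R)).

Definition compare_map (X : Aff R) : hom (F X) (E X) :=
  prod_map P (f : @hom (Aff R) D (Reps R)) (idm X).
Definition uncompare_map (X : Aff R) : hom (E X) (F X) :=
  prod_map P (k : @hom (Aff R) (Reps R) D) (idm X).

Fact compare_natural (X Y : Aff R) (h : hom X Y) :
  fmap E h ∘ compare_map X = compare_map Y ∘ fmap F h.
Proof.
by apply: prodF_ext => [d|x]; ap_comps; rewrite !(ap_prod_map, ap_prodF) ?rmorph1.
Qed.

Fact uncompare_natural (X Y : Aff R) (h : hom X Y) :
  fmap F h ∘ uncompare_map X = uncompare_map Y ∘ fmap E h.
Proof.
by apply: prodF_ext => [d|x]; ap_comps; rewrite !(ap_prod_map, ap_prodF) ?rmorph1.
Qed.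

Definition compare : nat_trans F E := NatTrans compare_natural.
Definition uncompare : nat_trans E F := NatTrans uncompare_natural.

Lemma compareE (X : calg R) b (x : X) : ap (compare X) (b · x) = f b · x.
Proof. exact: ap_prod_map. Qed.

Lemma uncompareE (X : calg R) d (x : X) : ap (uncompare X) (d · x) = k d · x.
Proof. exact: ap_prod_map. Qed.

Lemma compareK X : compare X ∘ uncompare X = idm (E X).
Proof.
apply: prodF_ext => [b|x]; ap_comps; rewrite ap_id !(compareE, uncompareE) ?rmorph1 //.
by rewrite -[X in X · _]/(calg_comp k f b) kf.
Qed.

Lemma uncompareK X : uncompare X ∘ compare X = idm (F X).
Proof.
apply: prodF_ext => [d|x]; ap_comps; rewrite ap_id !(compareE, uncompareE) ?rmorph1 //.
by rewrite -[X in X · _]/(calg_comp f k d) fk.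
Qed.

Lemma compare_p X : compare X ∘ tp X = tau_p X.
Proof.
apply: RepsF_ext => [|x]; ap_comps; rewrite compareE.
  by rewrite tau_p_eps p_tens1 f_eps rmorph0.
by rewrite rmorph1 p_cst tau_p_cst.
Qed.

Lemma compare_z X : tau_z X ∘ compare X = tz X.
Proof. by apply: ap_ext => x; ap_comps; rewrite tau_zE compareE rmorph1 z_cst. Qed.

Let compare2 X : hom (F (F X)) (E (E X)) := fmap E (compare X) ∘ compare (F X).

Let compare2E (X : calg R) b b' (x : X) :
  ap (compare2 X) (b · b' · x) = f b · f b' · x.
Proof. by rewrite /compare2; ap_comps; rewrite ap_prodF !compareE. Qed.

Lemma compare_l X : compare X ∘ tl X = tau_l X ∘ compare2 X.
Proof.
apply: RepsF_ext => [|x]; rewrite [LHS]ap_comp [RHS]ap_comp compareE.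
  by rewrite l_tens1 l_eps !tmapE tau_l_eps compare2E rmorph1.
by rewrite rmorph1 l_cst tau_l_cst compare2E rmorph1.
Qed.

Lemma compare_c X : compare2 X ∘ tc X = tau_c X ∘ compare2 X.
Proof.
by apply: RepsF2_ext => [||x]; rewrite [LHS]ap_comp [RHS]ap_comp tau_cE !compare2E c_tens.
Qed.

End Comparison.

End RepresentingAlgebra.

(** * The classification *)

Section Representability.
Variables (C : category) (P : finite_products C) (t : tangent_structure C).

(** Representability speaks of T_1, which is T up to isomorphism. *)
Lemma isomorphic_T_T1 : isomorphic_functors (tan_T t) (tan_Tn t (isT : (0 < 1)%N)).
Proof.
have compat A (j k : 'I_1) : tan_p t A ∘ idm (tan_T t A) = tan_p t A ∘ idm (tan_T t A) by [].
pose alpha A := fp_lift (tan_pow t (isT : (0 < 1)%N) A) (compat A).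
have alphaE A k : fp_proj (tan_pow t (isT : (0 < 1)%N) A) k ∘ alpha A = idm _.
  exact: fp_liftE.
have nat A B (f : hom A B) : fmap (tan_Tn t (isT : (0 < 1)%N)) f ∘ alpha A
    = alpha B ∘ fmap (tan_T t) f.
  apply: fp_ext => k.
  have e1 : fp_proj (tan_pow t (isT : (0 < 1)%N) B) k ∘ fmap (tan_Tn t (isT : (0 < 1)%N)) f
      = fmap (tan_T t) f ∘ fp_proj (tan_pow t (isT : (0 < 1)%N) A) k.
    exact: fp_liftE.
  by rewrite [LHS]compA e1 -[LHS]compA alphaE comp_idr [RHS]compA alphaE comp_idl.
exists (@NatTrans _ _ (tan_T t) (tan_Tn t (isT : (0 < 1)%N)) _ nat) => A.
exists (fp_proj (tan_pow t (isT : (0 < 1)%N) A) ord0); split; first exact: alphaE.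
apply: fp_ext => k; rewrite (ord1 k) compA [X in X ∘ _]alphaE comp_idl.
by rewrite [RHS]comp_idr.
Qed.

Lemma representable_adjunction : representable P t ->
  exists D, inhabited (adjunction (prod_functor P D) (tan_T t)).
Proof.
move=> /(_ 1%N isT) [D [G [[a] [g g_iso]]]]; exists D.
have [h h_iso] := isomorphic_T_T1; apply: (adj_of_iso a).
have nat A B (f : hom A B) : fmap G f ∘ (g A ∘ h A) = (g B ∘ h B) ∘ fmap (tan_T t) f.
  by rewrite compA naturality -compA naturality compA.
exists (@NatTrans _ _ (tan_T t) G _ nat) => A /=.
have [g' [gg1 gg2]] := g_iso A; have [h' [hh1 hh2]] := h_iso A.
exists (h' ∘ g'); split.
  by rewrite -compA (compA g') gg1 comp_idl.
by rewrite -compA (compA (h A)) hh2 comp_idl.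
Qed.

End Representability.

Section PolynomialAlgebra.
Variables (R : comPzRingType) (G : Type).

Definition poly_alg : calg R := pres_alg (fun _ _ : aexpr R G => False).
Definition poly_var (g : G) : poly_alg := pres_gen _ g.

Section Evaluation.
Variables (S : calg R) (v : G -> S).

Fact poly_eval_rel (x y : aexpr R G) :
  False -> aeval (calg_str S) v x = aeval (calg_str S) v y.
Proof. by []. Qed.

Definition poly_eval : calg_hom poly_alg S := pres_hom poly_eval_rel.

Lemma poly_eval_var g : poly_eval (poly_var g) = v g.
Proof. exact: pres_lift_gen. Qed.
End Evaluation.

Lemma poly_ext (S : calg R) (f h : calg_hom poly_alg S) :
  (forall g, f (poly_var g) = h (poly_var g)) -> f = h.
Proof.
move=> e; apply/calg_hom_ext/pres_ext => [r|g]; last exact: e.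
by rewrite -[pres_cst _ r]/(calg_str poly_alg r) !chom_str.
Qed.

End PolynomialAlgebra.

Lemma representable_classification (R : idomainType) (R_pid : is_pid R)
    (t : tangent_structure (Aff R)) : representable (aff_products R) t ->
  tangent_iso t (trivial_tangent (Aff R))
  \/ tangent_iso t (TangentStructure (TOmega R)).
Proof.
case/representable_adjunction => D [a].
have [tp [tz [tl [tc m]]]] : exists tp tz tl tc, comates a tp tz tl tc.
  by do 4 eexists; apply: comates_exist.
pose U (X : Aff R) : comPzRingType := calg_ring X.
pose Pol G : Aff R := poly_alg R G.
pose var G (g : G) : U (Pol G) := poly_var R g.
pose ev G (X : Aff R) (v : G -> U X) : hom X (Pol G) := poly_eval v.
have ev_var G (X : Aff R) (v : G -> U X) g : ap (ev _ _ v) (var _ g) = v g.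
  exact: poly_eval_var.
have Pol_ext G (X : Aff R) (f g : hom X (Pol G)) :
  (forall i, ap f (var _ i) = ap g (var _ i)) -> f = g by apply: poly_ext.
have sum := comates_additive_sum (@ap_comp R) ev_var Pol_ext m.
have mul0 := kernel_mul0 (@ap_comp R) ev_var Pol_ext m.
have l_ex := lift_exists (@ap_comp R) ev_var Pol_ext m.
have l_un := lift_unique (@ap_comp R) ev_var Pol_ext m.
have flE (X : Aff R) (f : hom X (tan_T t (Pol unit))) :
    ap (flat a f) (var _ tt) = tmap (calg_id D) (f : calg_hom _ X)
                             (ap (adj_counit a (Pol unit)) (var _ tt)).
  by [].
have w_ex (X : calg R) (y : tensor D X) : exists f : calg_hom (tan_T t (Pol unit)) X,
    tmap (calg_id D) f (ap (adj_counit a (Pol unit)) (var _ tt)) = y.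
  exists (sharp a (ev unit _ (fun=> y))); rewrite -flE sharpK.
  exact: ev_var.
have w_un (X : calg R) (f g : calg_hom (tan_T t (Pol unit)) X) :
    tmap (calg_id D) f (ap (adj_counit a (Pol unit)) (var _ tt))
    = tmap (calg_id D) g (ap (adj_counit a (Pol unit)) (var _ tt)) -> f = g.
  move=> e; apply: (flat_inj (a := a)); apply: Pol_ext; case.
  by rewrite !flE.
have R_domain (b c : R) : b * c = 0 -> b = 0 \/ c = 0.
  by move/eqP; rewrite mulf_eq0 => /orP [] /eqP; [left | right].
have R_one : (1 : R) <> 0 by apply/eqP/oner_neq0.
have [p_iso|[f [k [fk kf f_eps l_eps]]]] := representing_algebra
  (cm_p_natural m) (cm_z_natural m) (cm_z_p m) (cm_l_p m) (cm_c_p m)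
  (cm_z_c m) (cm_c_c m) (cm_l_c m) mul0 l_ex l_un w_ex w_un R_domain R_one R_pid.
  left; apply: tangent_iso_trivial => A.
  have [[pz _] _ _ _] := tan_monoid t A.
  exists (tan_z t A); split=> //.
  apply: (flat_inj (a := a)); rewrite (cm_z m).
  rewrite -[tan_p t A]comp_idr (cm_p m) -compA.
  have -> : tp (tan_T t A) ∘ tz (tan_T t A) = idm _.
    by apply: ap_ext => y; rewrite ap_comp p_iso.
  by rewrite comp_idr.
right; apply: (tangent_iso_of_comates (ap := @ap R) (@ap_comp R) (@ap_ext R)
  m (TOmega_comates R) sum (TOmega_additive_sum (R := R))
  (phi := uncompare k) (psi := compare f)) => X.
- exact: compareK.
- exact: uncompareK.
- exact: (compare_p (cm_p_natural m) (cm_z_natural m) (cm_z_p m) f_eps).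
- exact: (compare_z (cm_p_natural m) (cm_z_natural m) (cm_z_p m) mul0).
- exact: (compare_l (cm_p_natural m) (cm_z_natural m) (cm_l_natural m)
           (cm_z_p m) (cm_z_l m) mul0 l_eps).
- exact: (compare_c (cm_p_natural m) (cm_z_natural m)
           (cm_z_p m) (cm_z_c m) (cm_c_c m) mul0).
Qed.

Theorem corollary4p18 (R : idomainType) (R_pid : is_pid R) :
  exists2 TOmega : tangent_on (sym_kaehlerF R),
    is_TOmega TOmega
    & let P := aff_products R in
      let triv := trivial_tangent (Aff R) in
      let tOmega := TangentStructure TOmega in
      [/\ representable P triv,
          representable P tOmega,
          ~ tangent_iso triv tOmega
        & forall t : tangent_structure (Aff R), representable P t ->
            tangent_iso t triv \/ tangent_iso t tOmega].
Proof.
exists (TOmega R); first exact: TOmega_is.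
split.
- exact: trivial_representable.
- exact: TOmega_representable.
- by apply: trivial_not_TOmega; apply/eqP/oner_neq0.
- exact: representable_classification.
Qed.
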